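(* Let $q$ be a power of a prime and let $E$ be an ordinary elliptic curve over $\mathbb{F}_q$ given by $y^2 + a_1 x y + a_3 y = x^3 + a_2 x^2 + a_4 x + a_6$ with $a_i\in\mathbb{F}_q$, whose endomorphism ring $R$ over $\mathbb{F}_q$ is the full ring of integers of an imaginary quadratic field. Let $\pi_q\in R$ be the $q$-Frobenius endomorphism $(x,y)\mapsto(x^q,y^q)$. Let $\alpha\in R$ be an endomorphism of the form $\alpha(x,y)=(\alpha_1(x), y\cdot\alpha_2(x))$ with $\alpha_1,\alpha_2\in\mathbb{F}_q(x)$, $\alpha_1=a(x)/b(x)$, $a,b\in\mathbb{F}_q[x]$. Fix $n\ge 1$ and define $r:\mathbb{P}^1(\mathbb{F}_{q^n})\to\mathbb{P}^1(\mathbb{F}_{q^n})$ by $r(x)=\infty$ if $x=\infty$ or $b(x)=0$, and $r(x)=\alpha_1(x)$ otherwise. Let $E_0 := \{x\in\mathbb{F}_{q^n}: (x,0)\in E(\mathbb{F}_{q^n})\}\cup\{\infty\}$, $A_n := \{x\in\mathbb{F}_{q^n}: (x,y)\in E(\mathbb{F}_{q^n}) \text{ for some } y\in\mathbb{F}_{q^n}\}\cup\{\infty\}$, $B_n := \{x\in\mathbb{F}_{q^n}: (x,y)\in E(\mathbb{F}_{q^{2n}}) \text{ for some } y\in\mathbb{F}_{q^{2n}}\setminus\mathbb{F}_{q^n}\}\cup E_0$. Let either ($S:=A_n$ and $\delta:=\pi_q^n-1$) or ($S:=B_n$ and $\delta:=\pi_q^n+1$). Write $(\delta)=I_c\cdot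 I_t$ where $I_c$ is the product of the prime-power factors $\mathfrak{B}^e$ of $(\delta)$ with $\alpha\notin\mathfrak{B}$, and $I_t$ is the product of those with $\alpha\in\mathfrak{B}$. Write $I_t=\prod_{i=1}^{l}\mathfrak{B}_i^{e_i}$ with distinct nonzero prime ideals $\mathfrak{B}_i$ and $e_i\ge1$, and write $(\alpha)=\left(\prod_{i=1}^{l}\mathfrak{B}_i^{f_i}\right)\cdot J$ with integers $f_i\ge 0$ and $J$ an ideal in whose factorization no $\mathfrak{B}_i$ appears. Assume the set $\{\lceil e_i/f_i\rceil : i\in[1,l],\ f_i\neq 0\}$ is nonempty and let $d$ be its maximum. For $h\in[1,d]$ put $m_i:=\min\{e_i,f_i h\}$, $\tilde m_i:=\min\{e_i,f_i(h-1)\}$ and $v_h := \prod_{i=1}^{l} N(\mathfrak{B}_i^{m_i}) - \prod_{i=1}^{l} N(\mathfrak{B}_i^{\tilde m_i})$. Let $\tilde x\in S$ be $r$-periodic, let $T^S(\tilde x)$ be the tree rooted in $\tilde x$ formed by elements of $S$, let $T^S_h(\tilde x)$ be the set of its vertices at level $h$, and let $\tilde v_h := |T^S_h(\tilde x)\cap E_0|$. Then $T^S(\tilde x)$ has depth $d$, and for every $h\in[1,d]$, $|T^S_h(\tilde x)| = \frac{1}{2}\left(v_h+\tilde v_h\right)$ if $\tilde x\in E_0$, and $|T^S_h(\tilde x)| = v_h-\tilde v_h$ if $\tilde x\notin E_0$.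
   Context: $\mathbb{P}^1(\mathbb{F}_{q^n}) := \mathbb{F}_{q^n}\cup\{\infty\}$. An element $x$ is $r$-periodic if $r^m(x)=x$ for some $m\ge1$ ($r^m$ the $m$-fold composition). $N(I):=|R/I|$ is the absolute norm of an ideal $I$; $[1,d]:=\{x\in\mathbf{N}:1\le x\le d\}$. The tree rooted at an $r$-periodic element $\tilde x$ consists of $\tilde x$ together with all non-periodic $x\in\mathbb{P}^1(\mathbb{F}_{q^n})$ such that the first $r$-periodic element of the forward orbit $x, r(x), r^2(x),\dots$ is $\tilde x$; such an $x$ lies at level $h\ge1$ if $r^h(x)=\tilde x$ and $r^{h-1}(x)$ is not periodic. $T^S(\tilde x)$ is the subtree consisting of those vertices lying in $S$, and its depth is the largest $h$ with $T^S_h(\tilde x)\neq\emptyset$.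
   Formalization: The fraction a(x)/b(x) for α_1 is assumed to be in lowest terms (a and b coprime); otherwise r would send a removable common zero of a and b to ∞ and the count of vertices could fail. *)

(* Defs.v *)
From HB Require Import structures.
From mathcomp Require Import all_boot all_order all_algebra all_field.
From mathcomp Require Import finmap boolp classical_sets functions cardinality.
From mathcomp Require Import ring.

Set Implicit Arguments.
Unset Strict Implicit.
Unset Printing Implicit Defensive.

Import GRing.Theory.
Local Open Scope classical_set_scope.
Local Open Scope ring_scope.

(* fset_set sends infinite sets to fset0, so this is 0 on infinite sets. *)
Definition set_card (T : choiceType) (A : set T) : nat := #|` fset_set A|%fset.

Record weierstrass (K : Type) :=
  Weierstrass { a1 : K; a2 : K; a3 : K; a4 : K; a6 : K }.

Definition map_weierstrass (F K : Type) (f : F -> K) (W : weierstrass F) :=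
  Weierstrass (f (a1 W)) (f (a2 W)) (f (a3 W)) (f (a4 W)) (f (a6 W)).

Definition discriminant (K : fieldType) (W : weierstrass K) : K :=
  let b2 := a1 W ^+ 2 + 4%:R * a2 W in
  let b4 := 2%:R * a4 W + a1 W * a3 W in
  let b6 := a3 W ^+ 2 + 4%:R * a6 W in
  let b8 := a1 W ^+ 2 * a6 W + 4%:R * a2 W * a6 W - a1 W * a3 W * a4 W
            + a2 W * a3 W ^+ 2 - a4 W ^+ 2 in
  - b2 ^+ 2 * b8 - 8%:R * b4 ^+ 3 - 27%:R * b6 ^+ 2 + 9%:R * b2 * b4 * b6.

Definition is_elliptic (K : fieldType) (W : weierstrass K) : Prop :=
  discriminant W != 0.

Definition on_affine (K : fieldType) (W : weierstrass K) (x y : K) : bool :=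
  y ^+ 2 + a1 W * x * y + a3 W * y ==
  x ^+ 3 + a2 W * x ^+ 2 + a4 W * x + a6 W.

(* None is the point at infinity. *)
Definition on_curve (K : fieldType) (W : weierstrass K)
    (P : option (K * K)) : bool :=
  if P is Some (x, y) then on_affine W x y else true.

Record curve_point (K : fieldType) (W : weierstrass K) :=
  CurvePoint { coords :> option (K * K); _ : on_curve W coords }.

HB.instance Definition _ (K : fieldType) (W : weierstrass K) :=
  [isSub for @coords K W].
HB.instance Definition _ (K : fieldType) (W : weierstrass K) :=
  [Choice of curve_point W by <:].

Definition infinity (K : fieldType) (W : weierstrass K) : curve_point W :=
  @CurvePoint K W None isT.

(* (x3, y3) is minus the third intersection point of the curve with the line
   of slope s through (x1, y1). *)
Definition chord_tangent (K : fieldType) (W : weierstrass K)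
    (s x1 y1 x2 : K) : K * K :=
  let x3 := s ^+ 2 + a1 W * s - a2 W - x1 - x2 in
  (x3, - (s * (x3 - x1) + y1) - a1 W * x3 - a3 W).

Definition add_coords (K : fieldType) (W : weierstrass K)
    (P Q : option (K * K)) : option (K * K) :=
  match P, Q with
  | None, _ => Q
  | _, None => P
  | Some (x1, y1), Some (x2, y2) =>
    if x1 == x2 then
      if y2 == - y1 - a1 W * x1 - a3 W then None
      else
        let s := (3%:R * x1 ^+ 2 + 2%:R * a2 W * x1 + a4 W - a1 W * y1)
                 / (2%:R * y1 + a1 W * x1 + a3 W) in
        Some (chord_tangent W s x1 y1 x2)
    else Some (chord_tangent W ((y2 - y1) / (x2 - x1)) x1 y1 x2)
  end.

Lemma chord_tangent_on_affine (K : fieldType) (W : weierstrass K)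
    (s x1 y1 x2 : K) :
  on_affine W x1 y1 ->
  x1 ^+ 2 + x1 * x2 + x2 ^+ 2 + (a2 W - s ^+ 2 - a1 W * s) * (x1 + x2)
    + a4 W - 2%:R * s * (y1 - s * x1) - a1 W * (y1 - s * x1) - a3 W * s = 0 ->
  let P := chord_tangent W s x1 y1 x2 in on_affine W P.1 P.2.
Proof.
rewrite /on_affine /chord_tangent -subr_eq0 => /eqP H D /=.
set x3 := s ^+ 2 + _ - _ - _ - _.
rewrite -subr_eq0; apply/eqP; rewrite -[RHS](mulr0 (x1 - x3)) -{1}D -[RHS]addr0.
by rewrite -[X in _ = _ + X]H /x3; ring.
Qed.

Lemma add_coords_on_curve (K : fieldType) (W : weierstrass K)
    (P Q : option (K * K)) :
  on_curve W P -> on_curve W Q -> on_curve W (add_coords W P Q).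
Proof.
case: P Q => [[x1 y1]|] [[x2 y2]|] //= H1 H2.
have H : (y1 ^+ 2 + a1 W * x1 * y1 + a3 W * y1
           - (x1 ^+ 3 + a2 W * x1 ^+ 2 + a4 W * x1 + a6 W))
         - (y2 ^+ 2 + a1 W * x2 * y2 + a3 W * y2
           - (x2 ^+ 3 + a2 W * x2 ^+ 2 + a4 W * x2 + a6 W)) = 0.
  by rewrite (eqP H1) (eqP H2) !subrr.
have [e|ne] := eqVneq x1 x2; last first.
  apply: chord_tangent_on_affine => //.
  have ne' : x2 - x1 != 0 by rewrite subr_eq0 eq_sym.
  apply: (mulfI ne'); rewrite mulr0 -{}[RHS]H; field.
  by [].
subst x2; case: ifPn => [//|ny]; apply: chord_tangent_on_affine => //.
have e : y2 = y1.
  apply/eqP; rewrite -subr_eq0.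
  suff : (y2 - y1) * (y2 - (- y1 - a1 W * x1 - a3 W)) == 0.
    by rewrite mulf_eq0 => /orP[//|/eqP/subr0_eq/eqP]; rewrite (negPf ny).
  by apply/eqP; rewrite -[RHS]oppr0 -[in RHS]H; ring.
subst y2; field.
by move: ny; rewrite -subr_eq0; congr (_ != 0); ring.
Qed.

Definition add (K : fieldType) (W : weierstrass K) (P Q : curve_point W) :
    curve_point W :=
  CurvePoint (add_coords_on_curve (valP P) (valP Q)).

Definition mul_nat (K : fieldType) (W : weierstrass K) (n : nat)
    (P : curve_point W) : curve_point W :=
  iter n (add P) (infinity W).

(* E[p] is cyclic of order p, where K is to be algebraically closed. *)
Definition ordinary (K : fieldType) (W : weierstrass K) : Prop :=
  exists p, p \in [pchar K] /\
    exists2 P : curve_point W, P <> infinity W &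
      forall Q, mul_nat p Q = infinity W <-> exists k, Q = mul_nat k P.

Definition eval (F K : fieldType) (iota : {rmorphism F -> K}) (u : {poly F})
    (x : K) : K :=
  (map_poly iota u).[x].

Definition eval2 (F K : fieldType) (iota : {rmorphism F -> K})
    (u : {poly {poly F}}) (x y : K) : K :=
  (map_poly (map_poly iota) u).[y%:P].[x].

(* Endomorphisms over F act on the points over the algebraic closure K.  They
   are the group endomorphisms given by rational functions over F; different
   formulas may be needed at finitely many points, and the zero map, being
   constant at infinity, has no affine formula. *)
Definition is_endomorphism (F K : fieldType) (iota : {rmorphism F -> K})
    (W : weierstrass F)
    (f : curve_point (map_weierstrass iota W) ->
         curve_point (map_weierstrass iota W)) : Prop :=
  (forall P Q, f (add P Q) = add (f P) (f Q)) /\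
  ((forall P, f P = infinity _) \/
   exists n1 d1 n2 d2 : {poly {poly F}},
   exists s : seq (curve_point (map_weierstrass iota W)),
     forall (P : curve_point (map_weierstrass iota W)) (x y : K),
       coords P = Some (x, y) -> P \notin s ->
       [/\ eval2 iota d1 x y != 0, eval2 iota d2 x y != 0 &
         coords (f P) = Some (eval2 iota n1 x y / eval2 iota d1 x y,
                              eval2 iota n2 x y / eval2 iota d2 x y)]).

(* phi is an isomorphism of the ring R onto End_F(E). *)
Record endomorphism_ring (F K : fieldType) (iota : {rmorphism F -> K})
    (W : weierstrass F) (R : comNzRingType)
    (phi : R -> curve_point (map_weierstrass iota W) ->
           curve_point (map_weierstrass iota W)) : Prop := EndomorphismRing {
  end_in : forall u, is_endomorphism (phi u);
  end_onto : forall f, is_endomorphism f -> exists u, phi u =1 f;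
  end_inj : forall u v, phi u =1 phi v -> u = v;
  end_add : forall u v P, phi (u + v) P = add (phi u P) (phi v P);
  end_mul : forall u v P, phi (u * v) P = phi u (phi v P);
  end_one : forall P, phi 1 P = P }.

Definition imaginary_quadratic (L : fieldExtType rat) : Prop :=
  \dim {:L} = 2%N /\
  exists (m : nat) (z : L), (0 < m)%N /\ z ^+ 2 = - m%:R.

Definition imaginary_quadratic_integers (R : comNzRingType) : Prop :=
  exists (L : fieldExtType rat) (j : {rmorphism R -> L}),
    [/\ imaginary_quadratic L, injective j &
        forall z : L,
          integralOver (intr : int -> L) z <-> exists u : R, j u = z].

Definition principal (R : comNzRingType) (u : R) : set R :=
  [set v * u | v in setT].

Definition is_ideal (R : comNzRingType) (I : set R) : Prop :=
  I 0 /\ forall u v w, I v -> I w -> I (u * v + w).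

Definition prime_ideal (R : comNzRingType) (I : set R) : Prop :=
  [/\ is_ideal I, ~ I 1 & forall u v, I (u * v) -> I u \/ I v].

Definition ideal_mul (R : comNzRingType) (I J : set R) : set R :=
  [set x | exists s : seq (R * R),
     (forall p, p \in s -> I p.1 /\ J p.2) /\ x = \sum_(p <- s) p.1 * p.2].

Definition ideal_exp (R : comNzRingType) (I : set R) (k : nat) : set R :=
  iter k (ideal_mul I) setT.

Definition ideal_prod (R : comNzRingType) (l : nat) (B : 'I_l -> set R)
    (e : 'I_l -> nat) : set R :=
  \big[@ideal_mul R/setT]_(i < l) ideal_exp (B i) (e i).

Definition ideal_norm (R : comNzRingType) (I : set R) : nat :=
  set_card [set [set u + v | v in I] | u in [set: R]].

Definition prime_factorization (R : comNzRingType) (I : set R) (l : nat)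
    (B : 'I_l -> set R) (e : 'I_l -> nat) : Prop :=
  [/\ forall i, prime_ideal (B i) /\ B i <> [set 0],
      injective B, forall i, (0 < e i)%N & I = ideal_prod B e].

(* F_{q^k} inside an algebraic closure of F_q. *)
Definition subfield (K : fieldType) (q k : nat) : set K :=
  [set x | x ^+ (q ^ k) = x].

(* The projective line is option K, with None as infinity. *)
Definition E0 (K : fieldType) (W : weierstrass K) (q n : nat) :
    set (option K) :=
  [set X | if X is Some x then subfield q n x /\ on_affine W x 0 else True].

Definition An (K : fieldType) (W : weierstrass K) (q n : nat) :
    set (option K) :=
  [set X | if X is Some x
           then subfield q n x /\ exists2 y, subfield q n y & on_affine W x y
           else True].

Definition Bn (K : fieldType) (W : weierstrass K) (q n : nat) :
    set (option K) :=
  [set X | if X is Some x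
           then subfield q n x /\
                exists2 y, subfield q (2 * n) y /\ ~ subfield q n y
                         & on_affine W x y
           else False] `|` E0 W q n.

Definition P1 (K : fieldType) (q n : nat) : set (option K) :=
  [set X | if X is Some x then subfield q n x else True].

(* As a and b have coefficients in F_q, this maps P1 q n to itself. *)
Definition x_map (F K : fieldType) (iota : {rmorphism F -> K})
    (a b : {poly F}) (X : option K) : option K :=
  if X is Some x then
    if eval iota b x == 0 then None else Some (eval iota a x / eval iota b x)
  else None.

Definition periodic (T : Type) (r : T -> T) (x : T) : Prop :=
  exists2 m : nat, (0 < m)%N & iter m r x = x.

Definition tree (T : Type) (D : set T) (r : T -> T) (t : T) : set T :=
  [set x | x = t \/
     [/\ D x, ~ periodic r x &
       exists k, iter k r x = t /\
         forall j, (j < k)%N -> ~ periodic r (iter j r x)]].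

Definition level (T : Type) (D : set T) (r : T -> T) (t : T) (S : set T)
    (h : nat) : set T :=
  [set x | [/\ S x, tree D r t x, iter h r x = t &
               ~ periodic r (iter h.-1 r x)]].

(* The ceiling of m / k, for k > 0. *)
Definition ceil_div (m k : nat) : nat := ((m + k.-1) %/ k)%N.

Definition has_depth (T : Type) (D : set T) (r : T -> T) (t : T) (S : set T)
    (d : nat) : Prop :=
  level D r t S d !=set0 /\
  forall h, level D r t S h !=set0 -> (h <= d)%N.

(* The map (x, y) |-> (a(x) / b(x), y c(x) / w(x)) on the points where both
   denominators are nonzero. *)
Definition has_form (F K : fieldType) (iota : {rmorphism F -> K})
    (W : weierstrass F) (a b c w : {poly F})
    (f : curve_point (map_weierstrass iota W) ->
         curve_point (map_weierstrass iota W)) : Prop :=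
  forall (P : curve_point (map_weierstrass iota W)) (x y : K),
    coords P = Some (x, y) -> eval iota b x != 0 -> eval iota w x != 0 ->
    coords (f P) = Some (eval iota a x / eval iota b x,
                         y * (eval iota c x / eval iota w x)).

Definition is_frobenius (K : fieldType) (W : weierstrass K) (q : nat)
    (f : curve_point W -> curve_point W) : Prop :=
  forall P, coords (f P) =
    if coords P is Some (x, y) then Some (x ^+ q, y ^+ q) else None.

Definition vertex_count (R : comNzRingType) (l : nat) (B : 'I_l -> set R)
    (e f : 'I_l -> nat) (h : nat) : rat :=
  \prod_(i < l) (ideal_norm (ideal_exp (B i) (minn (e i) (f i * h))))%:R
  - \prod_(i < l) (ideal_norm (ideal_exp (B i) (minn (e i) (f i * h.-1))))%:R.

(* Main.v *)
(* Let x be the first coordinate map.  As alpha is not a unit, its special form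
   forces a1 = a3 = 0 and odd characteristic: otherwise y / (a1 x + a3) would be
   an alpha-invariant function with fibres of at most three points.  Then S is
   the image under x of the R-module G = ker delta, x identifies P with - P, E_0
   comes from the 2-torsion of G, and r (x P) = x (alpha P).  The level h over
   x P0 is the image of the points P* + N, where alpha^h P* = P0 with P* periodic
   and N runs through ker alpha^h minus ker alpha^(h - 1) in G; x is injective on
   this set if P0 <> - P0, and two-to-one off the 2-torsion otherwise.

   It remains to show that the kernel of alpha^h in G has as many elements as
   R / ((alpha^h) + (delta)), and more generally that the I-torsion has N(I)
   elements if I contains delta.  The degree of an endomorphism, read off the
   fraction which gives its action on x, is multiplicative and satisfies the
   parallelogram law, so it is the norm of R, and it bounds the number of points
   of the kernel.  For a prime p, some element of p^j has norm at most a constant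
   times N(p)^j, so the p-torsion, whose size is multiplicative in ideals since
   endomorphisms are surjective, has at most N(p) elements.  Equality for p
   dividing delta follows from counting: each x in F_(q^n) comes from two points
   of ker (pi_q^n - 1) and ker (pi_q^n + 1) together, so that these kernels have
   2 q^n + 2 = N(pi_q^n - 1) + N(pi_q^n + 1) elements in all. *)
From HB Require Import structures.
Require Import Defs.
From mathcomp Require Import all_boot all_order all_algebra all_field.
From mathcomp Require Import finmap boolp classical_sets functions cardinality.
From mathcomp Require Import ring zify.

Set Implicit Arguments.
Unset Strict Implicit.
Unset Printing Implicit Defensive.

Import Order.TTheory GRing.Theory Num.Theory.
Local Open Scope classical_set_scope.
Local Open Scope ring_scope.

(** Endomorphisms are only known to agree with rational functions off a finite set of points, so
    function fields are replaced by the quantifier [ae], meaning all but finitely many points.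
    Identities are checked generically and then extended, either by translating with the group law
    or because a regular function that vanishes at almost all points vanishes on the whole affine
    curve. Even associativity is obtained in this way, by cancelling a generic point.

    Three obstacles shape the rest. Kernels may be smaller than degrees because of inseparability,
    so the degree only bounds torsion from above; the bounds become equalities only because several
    of them add up, or multiply up, to a total that is known exactly. The powers used in these
    bounds absorb any constant, which is why crude index estimates suffice. Finally, the given
    formula for alpha says nothing at the zeros of its denominators, whereas r is defined there;
    that x (alpha P) = r (x P) holds at every point takes a separate argument. *)

Local Notation addp := Defs.add.

(** * The group law *)

(* (P + Q) + R = P + (Q + R) in coordinates: the line y = s x + c cuts the cubic
   in the abscissas p, q of P, Q and in t, and R = (u, s u + c + v).  Allowing
   p = q covers the case P = Q. *)
Lemma chord_assoc (K : fieldType) (p q t s u v c : K) :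
  let a2 := s ^+ 2 - p - q - t in
  v ^+ 2 + v * (2%:R * (s * u + c)) = (u - p) * (u - q) * (u - t) ->
  v != 0 -> u != q -> u != t ->
  let l1 := (s * u + c + v + (s * t + c)) / (u - t) in
  let x1 := l1 ^+ 2 - a2 - t - u in
  let l2 := (s * u + c + v - (s * q + c)) / (u - q) in
  let x2 := l2 ^+ 2 - a2 - q - u in
  let y2 := l2 * (q - x2) - (s * q + c) in
  x2 != p ->
  let l3 := (y2 - (s * p + c)) / (x2 - p) in
  let x3 := l3 ^+ 2 - a2 - p - x2 in
  x3 = x1 /\ l3 * (p - x3) - (s * p + c) = l1 * (t - x1) + (s * t + c).
Proof.
move=> a2 H v0 uq ut l1 x1 l2 x2 y2 x2p l3 x3.
have uq0 : u - q != 0 by rewrite subr_eq0.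
have ut0 : u - t != 0 by rewrite subr_eq0.
have d0 : x2 - p != 0 by rewrite subr_eq0.
(* With the slope difference [m] and with [d] as free parameters, t and 2 c are rational in p, q, u,
   s, m, d. This solves [H], and identities of rational functions remain. Only 2 c is ever solved
   for, so that nothing is divided by 2. *)
pose m := v / (u - q); pose d := x2 - p.
have m0 : m != 0 by rewrite mulf_neq0 // invr_eq0.
have ev : v = m * (u - q) by rewrite divfK.
have el2 : l2 = s + m by rewrite /l2 /m; field.
have et : t = d + u - m ^+ 2 - 2%:R * s * m by rewrite /d /x2 el2 /a2; ring.
have el1 : l1 = (u - p) / m - s.
  have -> : (u - p) / m = (u - p) * (u - q) * (u - t) / (v * (u - t)).
    by rewrite /m; field; rewrite ?v0 ?uq0 ?ut0.
  rewrite -H /l1; field.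
  by rewrite ?v0 ?ut0.
have ew : 2%:R * c = (u - p) * (u - t) / m - m * (u - q) - 2%:R * s * u.
  apply: (mulfI v0).
  have -> : v * (2%:R * c) = v * (2%:R * (s * u + c)) - v * (2%:R * s * u) by ring.
  rewrite -[X in X - _](addKr (v ^+ 2)) H ev; field.
  exact: m0.
have ex2 : x2 = p + d by rewrite /d; ring.
have el3 : l3 = ((s + m) * (q - x2) - (s * q + s * p + 2%:R * c)) / d.
  by rewrite /l3 /y2 el2; congr (_ / _); ring.
rewrite ew ex2 in el3.
have ex1 : x1 = ((u - p) / m) ^+ 2 - 2%:R * s * (u - p) / m + p + q - u.
  by rewrite /x1 el1 /a2; field.
have ex3 : x3 = x1.
  rewrite ex1 /x3 el3 ex2 /a2 et; field.
  by rewrite m0 /d d0.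
split=> //; rewrite ex3; apply/eqP; rewrite -subr_eq0.
have -> : l3 * (p - x1) - (s * p + c) - (l1 * (t - x1) + (s * t + c)) =
  l3 * (p - x1) - (s * p + s * t + 2%:R * c) - l1 * (t - x1) by ring.
rewrite ew el3 el1 ex1 et; apply/eqP; field.
by rewrite m0 /d d0.
Qed.

(** A root of prod (X - z) + 1 is none of the z; the additional factor for z = 0 keeps this
    polynomial nonconstant when [s] is empty. *)
Lemma closed_field_avoid (K : closedFieldType) (s : seq K) : exists x, x \notin s.
Proof.
pose g : {poly K} := \prod_(z <- 0 :: s) ('X - z%:P) + 1.
have szg : size g != 1%N.
  rewrite size_polyDl size_prod_XsubC ?size_poly1 //=.
have /closed_rootP[x] := szg.
rewrite /root hornerD hornerC => gx; exists x; apply/negP => xs.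
have /rootP e0 : root (\prod_(z <- 0 :: s) ('X - z%:P)) x by rewrite root_prod_XsubC inE xs orbT.
by move: gx; rewrite e0 add0r oner_eq0.
Qed.

Lemma size_cubic (K : idomainType) (c2 c1 c0 : K) :
  size ('X^3 + c2 *: 'X^2 + c1 *: 'X + c0%:P) = 4%N.
Proof.
have s1 : (size (c2 *: 'X^2) <= 3)%N by rewrite (leq_trans (size_scale_leq _ _)) ?size_polyXn.
have s2 : (size (c1 *: 'X) <= 2)%N by rewrite (leq_trans (size_scale_leq _ _)) ?size_polyX.
have s23 : (size (c1 *: 'X + c0%:P)%R <= 2)%N.
  by rewrite (leq_trans (size_polyD _ _)) // geq_max s2 (leq_trans (size_polyC_leq1 _)).
have s123 : (size (c2 *: 'X^2 + (c1 *: 'X + c0%:P))%R <= 3)%N.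
  by rewrite (leq_trans (size_polyD _ _)) // geq_max s1 (leq_trans s23).
by rewrite -!addrA size_polyDl size_polyXn.
Qed.

Lemma coords_inj (K : fieldType) (W : weierstrass K) (P Q : curve_point W) :
  coords P = coords Q -> P = Q.
Proof. exact: val_inj. Qed.

(** The curves to which the vanishing of the linear terms reduces the problem. The coercion keeps
    points over this record convertible with points over the bare equation, so that endomorphisms
    can be transferred without translation. *)
Record ecurve (K : closedFieldType) := ECurve {
  wei :> weierstrass K;
  ec_a1 : a1 wei = 0;
  ec_a3 : a3 wei = 0;
  ec_two : 2%:R != 0 :> K;
  ec_disc : is_elliptic wei }.

Section Curve.
Variables (K : closedFieldType) (E : ecurve K).
Implicit Types (P Q R T : curve_point E) (x y : K).

Definition rhs : {poly K} := locked ('X^3 + (a2 E) *: 'X^2 + (a4 E) *: 'X + (a6 E)%:P).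

Lemma rhsE x : rhs.[x] = x ^+ 3 + a2 E * x ^+ 2 + a4 E * x + a6 E.
Proof. by rewrite /rhs -lock !hornerE. Qed.

Lemma size_rhs : size rhs = 4%N.
Proof. by rewrite /rhs -lock size_cubic. Qed.

Lemma rhs_neq0 : rhs != 0.
Proof. by rewrite -size_poly_gt0 size_rhs. Qed.

Lemma derhsE x : rhs^`().[x] = 3%:R * x ^+ 2 + 2%:R * a2 E * x + a4 E.
Proof. by rewrite /rhs -lock !derivE /= !(hornerD, hornerZ, hornerMn, hornerXn, hornerX, hornerC); ring. Qed.

(** At a double root the two equations can be solved for [a6] and [a4], and the discriminant then
    vanishes identically. *)
Lemma rhs_simple_root x : rhs.[x] = 0 -> rhs^`().[x] != 0.
Proof.
rewrite rhsE derhsE => e0; apply/negP => /eqP e1.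
have e4 : a4 E = - (3%:R * x ^+ 2 + 2%:R * a2 E * x).
  by apply/eqP; rewrite -subr_eq0 -[X in _ == X]e1; apply/eqP; ring.
have e6 : a6 E = - (x ^+ 3 + a2 E * x ^+ 2 + a4 E * x).
  by apply/eqP; rewrite -subr_eq0 -[X in _ == X]e0; apply/eqP; ring.
have := ec_disc E; rewrite /is_elliptic /discriminant ec_a1 ec_a3 e6 e4.
by move/eqP; apply; ring.
Qed.

Lemma on_affineE x y : on_affine E x y = (y ^+ 2 == rhs.[x]).
Proof. by rewrite /on_affine ec_a1 ec_a3 !mul0r !addr0 rhsE. Qed.

Lemma coordsP P x y : coords P = Some (x, y) -> y ^+ 2 = rhs.[x].
Proof.
by case: P => c /= oc ec; move: oc; rewrite ec /= on_affineE => /eqP.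
Qed.

Lemma point_of x y : y ^+ 2 = rhs.[x] -> exists P, coords P = Some (x, y).
Proof.
move=> e; have oc : on_curve E (Some (x, y)) by rewrite /= on_affineE e.
by exists (CurvePoint oc).
Qed.

Lemma coords_infinity : coords (infinity E) = None. Proof. by []. Qed.

Lemma coords_None P : coords P = None -> P = infinity E.
Proof. by move=> e; apply: coords_inj. Qed.

Definition xc P : option K := omap fst (coords P).

Lemma xc_coords P x y : coords P = Some (x, y) -> xc P = Some x.
Proof. by rewrite /xc => ->. Qed.

Lemma xcP P x : xc P = Some x -> exists y, coords P = Some (x, y).
Proof. by rewrite /xc; case: (coords P) => [[a b]|] //= [->]; exists b. Qed.

Lemma sqrt_exists (z : K) : exists y, y ^+ 2 = z.
Proof.
have /closed_rootP[y] : size ('X^2 - z%:P : {poly K}) != 1%N.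
  by rewrite size_XnsubC.
by rewrite /root !hornerE subr_eq0 => /eqP; exists y.
Qed.

Lemma eq_sqr_or x y1 y2 : y1 ^+ 2 = rhs.[x] -> y2 ^+ 2 = rhs.[x] -> y2 = y1 \/ y2 = - y1.
Proof. by move=> <- /eqP; rewrite eqf_sqr => /orP[] /eqP; [left | right]. Qed.

Lemma neg_proof P : on_curve E (if coords P is Some (x, y) then Some (x, - y) else None).
Proof. by case: P => [[[x y]|]] //=; rewrite !on_affineE sqrrN. Qed.

Definition opp_pt P : curve_point E := CurvePoint (neg_proof P).

Lemma coords_opp P :
  coords (opp_pt P) = if coords P is Some (x, y) then Some (x, - y) else None.
Proof. by []. Qed.

Lemma coords_opp_aff P x y : coords P = Some (x, y) -> coords (opp_pt P) = Some (x, - y).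
Proof. by rewrite coords_opp => ->. Qed.

Lemma opp_ptK P : opp_pt (opp_pt P) = P.
Proof.
by apply: coords_inj; rewrite !coords_opp; case: (coords P) => [[x y]|] //; rewrite opprK.
Qed.

Lemma xc_opp P : xc (opp_pt P) = xc P.
Proof. by rewrite /xc coords_opp; case: (coords P) => [[]|]. Qed.

Lemma xc_eq P Q : xc P = xc Q -> P = Q \/ P = opp_pt Q.
Proof.
rewrite /xc; case eP: (coords P) => [[x y]|]; case eQ: (coords Q) => [[x' y']|] //=.
  move=> [ex]; rewrite -ex in eQ.
  have [e|e] := eq_sqr_or (coordsP eQ) (coordsP eP); [left|right]; apply: coords_inj.
    by rewrite eP eQ e.
  by rewrite (coords_opp_aff eQ) eP e.
by move=> _; left; apply: coords_inj; rewrite eP eQ.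
Qed.

Lemma coords_add P Q : coords (addp P Q) = add_coords E (coords P) (coords Q).
Proof. by []. Qed.

Lemma add0pt P : addp (infinity E) P = P.
Proof. by apply: coords_inj; rewrite coords_add coords_infinity. Qed.

Lemma addpt0 P : addp P (infinity E) = P.
Proof. by apply: coords_inj; rewrite coords_add coords_infinity /=; case: (coords P) => [[]|]. Qed.

Lemma addptN P : addp P (opp_pt P) = infinity E.
Proof.
apply: coords_inj; rewrite coords_add coords_opp; case: (coords P) => [[x y]|] //=.
by rewrite eqxx ec_a1 ec_a3 mul0r !subr0 eqxx.
Qed.

Lemma coords_chord P Q x1 y1 x2 y2 : coords P = Some (x1, y1) -> coords Q = Some (x2, y2) ->
  x1 != x2 -> let s := (y2 - y1) / (x2 - x1) in let x3 := s ^+ 2 - a2 E - x1 - x2 in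
  coords (addp P Q) = Some (x3, s * (x1 - x3) - y1).
Proof.
move=> eP eQ n s x3; rewrite coords_add eP eQ /= (negPf n) /chord_tangent ec_a1 ec_a3.
rewrite !mul0r !subr0 addr0 -/s -/x3; congr (Some (_, _)); ring.
Qed.

Lemma addptC P Q : addp P Q = addp Q P.
Proof.
case eP: (coords P) => [[x1 y1]|]; last first.
  by rewrite (coords_None eP) add0pt addpt0.
case eQ: (coords Q) => [[x2 y2]|]; last first.
  by rewrite (coords_None eQ) add0pt addpt0.
have [e|n] := eqVneq x1 x2; last first.
  apply: coords_inj; rewrite (coords_chord eP eQ n) (coords_chord eQ eP) 1?eq_sym //.
  have n' : x2 - x1 != 0 by rewrite subr_eq0 eq_sym.
  have n'' : x1 - x2 != 0 by rewrite subr_eq0.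
  by congr (Some (_, _)); field; rewrite ?n' ?n''.
subst x2; have [e|e] := eq_sqr_or (coordsP eP) (coordsP eQ).
  by have -> : P = Q; first apply: coords_inj; rewrite ?eP ?eQ ?e.
have -> : Q = opp_pt P by apply: coords_inj; rewrite (coords_opp_aff eP) eQ e.
by rewrite addptN -{2}[P]opp_ptK addptN.
Qed.

(* The line through P and Q (tangent if P = Q) is y = s x + c, and t is the
   third root of the cubic it cuts out. *)
Lemma add_line P Q p q yp yq : coords P = Some (p, yp) -> coords Q = Some (q, yq) ->
  Q <> opp_pt P -> exists s c t,
  [/\ yp = s * p + c, yq = s * q + c, a2 E = s ^+ 2 - p - q - t,
      forall x, rhs.[x] = (s * x + c) ^+ 2 + (x - p) * (x - q) * (x - t) &
      coords (addp P Q) = Some (t, - (s * t + c))].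
Proof.
move=> eP eQ nQ.
have rP := coordsP eP; have rQ := coordsP eQ; rewrite !rhsE in rP rQ.
have [e|n] := eqVneq p q.
  subst q; have ey : yq = yp.
    have [//|e] := eq_sqr_or (coordsP eP) (coordsP eQ).
    by case: nQ; apply: coords_inj; rewrite (coords_opp_aff eP) eQ e.
  subst yq; have y0 : yp != 0.
    apply/eqP => y0; apply: nQ; apply: coords_inj.
    by rewrite (coords_opp_aff eP) eQ y0 oppr0.
  have ye : (yp == - yp) = false.
    apply/negP; rewrite -addr_eq0 -mulr2n -mulr_natl mulf_eq0 (negPf y0) orbF.
    exact/negP/ec_two.
  have y20 : 2%:R * yp != 0 by rewrite mulf_neq0 ?ec_two.
  pose s := (3%:R * p ^+ 2 + 2%:R * a2 E * p + a4 E) / (2%:R * yp).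
  exists s, (yp - s * p), (s ^+ 2 - a2 E - p - p).
  have e4 : a4 E = s * (2%:R * yp) - 3%:R * p ^+ 2 - 2%:R * a2 E * p by rewrite /s divfK //; ring.
  have e6 : a6 E = yp ^+ 2 - (p ^+ 3 + a2 E * p ^+ 2 + a4 E * p) by rewrite rP; ring.
  split; try ring.
    by move=> x; rewrite rhsE e6 e4; ring.
  rewrite coords_add eP eQ /= eqxx ec_a1 ec_a3 !mul0r !subr0 !addr0 ye /chord_tangent.
  by rewrite ec_a1 ec_a3 !mul0r !subr0 addr0 -/s; congr (Some (_, _)); ring.
pose s := (yq - yp) / (q - p).
exists s, (yp - s * p), (s ^+ 2 - a2 E - p - q).
have n' : q - p != 0 by rewrite subr_eq0 eq_sym.
have ey : yq = s * q + (yp - s * p).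
  by rewrite -[LHS](subrK yp) -{1}[yq - yp](divfK n') -/s; ring.
have e4 : a4 E = s * (yq + yp) - (q ^+ 2 + p * q + p ^+ 2) - a2 E * (p + q).
  apply: (mulfI n').
  have -> : (q - p) * (s * (yq + yp) - (q ^+ 2 + p * q + p ^+ 2) - a2 E * (p + q)) =
    s * (q - p) * (yq + yp) - (q - p) * (q ^+ 2 + p * q + p ^+ 2 + a2 E * (p + q)) by ring.
  have -> : s * (q - p) * (yq + yp) = yq ^+ 2 - yp ^+ 2 by rewrite divfK //; ring.
  by rewrite rP rQ; ring.
have e6 : a6 E = yp ^+ 2 - (p ^+ 3 + a2 E * p ^+ 2 + a4 E * p) by rewrite rP; ring.
split=> //; try ring.
  by move=> x; rewrite rhsE e6 e4 ey; ring.
rewrite (coords_chord eP eQ n) -/s; congr (Some (_, _)); ring.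
Qed.

Lemma coords_double P x y : coords P = Some (x, y) -> y != 0 ->
  let s := (3%:R * x ^+ 2 + 2%:R * a2 E * x + a4 E) / (2%:R * y) in
  let x3 := s ^+ 2 - a2 E - x - x in
  coords (addp P P) = Some (x3, s * (x - x3) - y).
Proof.
move=> eP y0 s x3; have yN : (y == - y) = false.
  apply/negP; rewrite -addr_eq0 -mulr2n -mulr_natl mulf_eq0 (negPf y0) orbF.
  exact/negP/ec_two.
rewrite coords_add eP /= eqxx ec_a1 ec_a3 !mul0r !subr0 !addr0 yN /chord_tangent.
by rewrite ec_a1 ec_a3 !mul0r !subr0 addr0 -/s -/x3; congr (Some (_, _)); ring.
Qed.

End Curve.

(** * Statements that hold at all but finitely many points *)

Lemma poly_neq0_avoid (K : closedFieldType) (g : {poly K}) : g != 0 ->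
  exists r : seq K, forall x, x \notin r -> g.[x] != 0.
Proof.
have [r e] := closed_field_poly_normal g; rewrite -lead_coef_eq0 => g0.
exists r => x xr; rewrite e hornerZ mulf_neq0 // -[_ == 0]/(root _ x).
by rewrite root_prod_XsubC.
Qed.

Section AlmostAllPoints.
Variables (K : closedFieldType) (W : weierstrass K).
Local Notation pt := (curve_point W).
Implicit Types (P Q X Y : pt) (x y : K).

Definition cubic_part : {poly K} := 'X^3 + a2 W *: 'X^2 + a4 W *: 'X + (a6 W)%:P.
Definition linear_part : {poly K} := a1 W *: 'X + (a3 W)%:P.
Local Notation cubic := cubic_part.
Local Notation lin := linear_part.

Lemma linear_partE x : lin.[x] = a1 W * x + a3 W.
Proof. by rewrite /linear_part !(hornerD, hornerZ, hornerX, hornerC). Qed.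

Lemma cubic_partE x : cubic.[x] = x ^+ 3 + a2 W * x ^+ 2 + a4 W * x + a6 W.
Proof. by rewrite /cubic_part !(hornerD, hornerZ, hornerX, hornerC, hornerXn). Qed.

Lemma weierstrass_eq P x y : coords P = Some (x, y) -> y ^+ 2 + lin.[x] * y = cubic.[x].
Proof.
rewrite linear_partE cubic_partE; case: P => co /= oc e; move: oc; rewrite e => /= /eqP <-.
by ring.
Qed.

(** Membership in the cofinite filter on points. It is set up for an arbitrary Weierstrass equation
    because it serves before [a1] and [a3] are known to vanish. *)
Definition ae (A : curve_point W -> Prop) : Prop :=
  exists s : seq (curve_point W), forall P, P \notin s -> A P.

Lemma aeT (A : curve_point W -> Prop) : (forall P, A P) -> ae A.
Proof. by exists [::]. Qed.

Lemma ae_imp (A B : curve_point W -> Prop) : (forall P, A P -> B P) -> ae A -> ae B.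
Proof. by move=> h [s hs]; exists s => P /hs /h. Qed.

Lemma ae_and (A B : curve_point W -> Prop) : ae A -> ae B -> ae (fun P => A P /\ B P).
Proof.
move=> [s hs] [t ht]; exists (s ++ t) => P; rewrite mem_cat negb_or => /andP[/hs ? /ht ?].
by split.
Qed.

Lemma ae_imp2 (A B C : curve_point W -> Prop) :
  (forall P, A P -> B P -> C P) -> ae A -> ae B -> ae C.
Proof. by move=> h a b; apply: ae_imp (ae_and a b) => P []; apply: h. Qed.

Lemma ae_all (I : eqType) (A : I -> curve_point W -> Prop) (s : seq I) :
  (forall i, i \in s -> ae (A i)) -> ae (fun P => forall i, i \in s -> A i P).
Proof.
elim: s => [|i s IH] h; first exact: aeT.
apply: ae_imp2 (h i (mem_head _ _)) (IH _) => [P Ai As j|j js].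
  by rewrite inE => /predU1P[->|/As].
by apply: h; rewrite inE js orbT.
Qed.

Lemma ae_neq Q : ae (fun P => P <> Q).
Proof. by exists [:: Q] => P; rewrite inE => /eqP. Qed.

Let quad x : {poly K} := 'X^2 + (lin.[x] *: 'X - (cubic.[x])%:P).

Let size_quad x : size (quad x) = 3%N.
Proof.
rewrite /quad size_polyDl size_polyXn // ltnS (leq_trans (size_polyD _ _)) // geq_max.
rewrite size_polyN (leq_trans (size_polyC_leq1 _)) // andbT.
by rewrite (leq_trans (size_scale_leq _ _)) ?size_polyX.
Qed.

Let quadE x y : (quad x).[y] = y ^+ 2 + lin.[x] * y - cubic.[x].
Proof. by rewrite hornerD hornerXn hornerD hornerN hornerZ hornerX hornerC addrA. Qed.

Lemma point_above x : exists P y, coords P = Some (x, y).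
Proof.
have /closed_rootP[y] : size (quad x) != 1%N by rewrite size_quad.
rewrite /root quadE subr_eq0 => /eqP e.
have oc : on_curve W (Some (x, y)).
  by rewrite /= /on_affine -subr_eq0; move/eqP: e; rewrite -subr_eq0 linear_partE cubic_partE; congr (_ == _); ring.
by exists (CurvePoint oc), y.
Qed.

Lemma ae_abscissa x : ae (fun P => forall y, coords P <> Some (x, y)).
Proof.
have q0 : quad x != 0 by rewrite -size_poly_gt0 size_quad.
have [r hr] := poly_neq0_avoid q0.
exists (pmap insub [seq Some (x, y) | y <- r]) => P nP y e; move: nP; apply/negP; rewrite negbK.
rewrite mem_pmap; apply/mapP; exists (coords P); last by rewrite -[RHS]/(insub (val P)) valK.
rewrite e; apply: map_f; apply: contraT => /hr.
by rewrite quadE (weierstrass_eq e) subrr eqxx.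
Qed.

Lemma ae_affine_poly (g : {poly K}) : g != 0 ->
  ae (fun P => exists x y, coords P = Some (x, y) /\ g.[x] != 0).
Proof.
move=> /poly_neq0_avoid[r hr].
have h1 : ae (fun P => forall x, x \in r -> forall y, coords P <> Some (x, y)).
  by apply: ae_all => x _; apply: ae_abscissa.
have h2 := ae_neq (infinity W).
apply: ae_imp (ae_and h1 h2) => P [n1 n2].
case e : (coords P) => [[x y]|]; last by case: n2; apply: coords_inj.
by exists x, y; split=> //; apply: hr; apply/negP => /n1 /(_ y).
Qed.

(** The filter is proper: there are infinitely many abscissas and each of them carries a point. *)
Lemma ae_ex (A : pt -> Prop) : ae A -> exists P, A P.
Proof.
move=> [s hs]; have [x xs] := closed_field_avoid (pmap (fun P => omap fst (coords P)) s).
have [P [y e]] := point_above x; exists P; apply: hs; apply: contra xs => Ps.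
by rewrite mem_pmap; apply/mapP; exists P; rewrite ?e.
Qed.

End AlmostAllPoints.

(** * Associativity of the addition *)

Section GroupLaw.
Variables (K : closedFieldType) (E : ecurve K).
Implicit Types (P Q R T : curve_point E) (x y : K).

Lemma ae_xc (X : option K) : ae (fun P => xc P <> X).
Proof.
have [[P0 e0]|h] := pselect (exists P0 : curve_point E, xc P0 = X).
  exists [:: P0; opp_pt P0] => P; rewrite !inE negb_or => /andP[/eqP n1 /eqP n2].
  by rewrite -e0 => /xc_eq[].
by apply: aeT => P e; apply: h; exists P.
Qed.

Lemma ae_affine : ae (fun P => exists x y, coords P = Some (x, y)).
Proof.
apply: ae_imp (ae_neq (infinity E)) => P n.
case e: (coords P) => [[x y]|]; first by exists x, y.
by case: n; apply: coords_None.
Qed.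

Lemma ae_poly (g : {poly K}) : g != 0 ->
  ae (fun P => forall x, xc P = Some x -> g.[x] != 0).
Proof.
move=> /poly_neq0_avoid[r hr].
have : ae (fun P => forall x, x \in r -> xc P <> Some x).
  by apply: ae_all => x _; apply: ae_xc.
by apply: ae_imp => P h x e; apply: hr; apply/negP => /h.
Qed.

(** The line through -P and P + Q is the mirror image of the line through P and Q, of slope -s. This
    is the cancellation available before associativity. *)
Lemma add_ptK P Q x y x' y' : coords P = Some (x, y) -> coords Q = Some (x', y') ->
  x != x' -> xc (addp P Q) <> Some x -> addp (opp_pt P) (addp P Q) = Q.
Proof.
move=> eP eQ n; have nQ : Q <> opp_pt P.
  move=> eq; move: eQ; rewrite eq (coords_opp_aff eP) => -[e _].
  by rewrite e eqxx in n.
have [s [c [t [ey ey' e2 _ eA]]]] := add_line eP eQ nQ.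
rewrite (xc_coords eA) => nt; apply: coords_inj.
have nt' : x != t by apply/eqP => e; apply: nt; rewrite e.
rewrite (coords_chord (coords_opp_aff eP) eA nt') eQ.
have nt0 : t - x != 0 by rewrite subr_eq0 eq_sym.
have -> : (- (s * t + c) - - y) / (t - x) = - s by rewrite ey; field.
by rewrite ey ey' e2; congr (Some (_, _)); ring.
Qed.

Lemma scaled_rhs_not_square k (p : {poly K}) : k != 0 -> k *: rhs E <> p ^+ 2.
Proof.
move=> k0 /(congr1 (fun u : {poly K} => odd (size u).-1)) /=.
by rewrite size_exp size_scale // size_rhs oddM andbF.
Qed.

Lemma four_neq0 : 4%:R != 0 :> K.
Proof. by rewrite (natrM _ 2 2) mulf_neq0 ?(ec_two E). Qed.

(** For R = (u, v) the chord formula turns x (Q + R) = x0 into p(u) = - 2 v w, and squaring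
    eliminates v, so u is a root of [g]. If w is nonzero, [g] is nonzero because a multiple of a
    cubic is not a square; if w = 0, then p = 0 would make q a double root of the cubic. *)
Lemma ae_xc_addl Q x0 : Q <> infinity E -> ae (fun R => xc (addp Q R) <> Some x0).
Proof.
move=> nQ; case eQ: (coords Q) => [[q w]|]; last by case: nQ; apply: coords_None.
pose p : {poly K} := ('X + (x0 + a2 E + q)%:P) * ('X - q%:P) ^+ 2 - rhs E - (w ^+ 2)%:P.
pose g := (4%:R * w ^+ 2) *: rhs E - p ^+ 2.
have g0 : g != 0.
  rewrite /g subr_eq0; apply/eqP => e.
  have [w0|w0] := eqVneq w 0; last first.
    by apply: scaled_rhs_not_square e; rewrite mulf_neq0 ?four_neq0 ?expf_neq0.
  move: e; rewrite w0 expr0n mulr0 scale0r => /esym/eqP; rewrite expf_eq0 /= /p w0.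
  rewrite expr0n subr0 subr_eq0 expr2 => /eqP e.
  have rq : (rhs E).[q] = 0 by rewrite -(coordsP eQ) w0 expr0n.
  have := rhs_simple_root rq; rewrite -e !derivM !(hornerXsubC, hornerD, hornerM) subrr.
  by rewrite !(mul0r, mulr0, addr0) eqxx.
apply: ae_imp2 (ae_affine) (ae_and (ae_poly g0) (ae_xc (Some q))) => R [u [v eR]] [gu nu] exc.
have nqu : q != u by apply/eqP => e; apply: nu; rewrite e (xc_coords eR).
have := gu _ (xc_coords eR); rewrite /g /p !(hornerXsubC, hornerD, hornerN, hornerZ, hornerM, horner_exp, hornerC, hornerX) -(coordsP eR).
move: exc; rewrite (xc_coords (coords_chord eQ eR nqu)) => -[<-].
have nqu' : u - q != 0 by rewrite subr_eq0 eq_sym.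
move/eqP; apply.
have -> : (u + (((v - w) / (u - q)) ^+ 2 - a2 E - q - u + a2 E + q)) * (u - q) ^+ 2 = (v - w) ^+ 2.
  by field.
by ring.
Qed.

(** The elimination of [ae_xc_addl] with the unknown abscissa in place of x0. Here p has leading
    term 2 X^3 - X^3, so that p^2 has degree 6 and cannot be a multiple of the cubic. *)
Lemma ae_xc_addr Q : Q <> infinity E -> ae (fun T => xc (addp T Q) <> xc T).
Proof.
move=> nQ; case eQ: (coords Q) => [[q w]|]; last by case: nQ; apply: coords_None.
pose p : {poly K} := (2%:R *: 'X + (a2 E + q)%:P) * ('X - q%:P) ^+ 2 - rhs E - (w ^+ 2)%:P.
pose g := (4%:R * w ^+ 2) *: rhs E - p ^+ 2.
have two := ec_two E.
have szp : size p = 4%N.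
  set c2 := - 3%:R * q; set c1 := - 2%:R * a2 E * q - a4 E.
  rewrite -(size_cubic c2 c1 ((a2 E + q) * q ^+ 2 - a6 E - w ^+ 2)); congr (size (polyseq _)).
  rewrite /p /c2 /c1 /rhs -lock -!mul_polyC !(polyCD, polyCN, polyCM); ring.
have g0 : g != 0.
  rewrite /g subr_eq0; apply/eqP => /(congr1 (fun u : {poly K} => size u)).
  have -> : size (p ^+ 2) = 7%N.
    by have := size_exp p 2; rewrite szp; case: (size _) => //= n ->.
  move=> e; have := size_scale_leq (4%:R * w ^+ 2) (rhs E).
  by rewrite e size_rhs.
apply: ae_imp2 (ae_affine) (ae_and (ae_poly g0) (ae_xc (Some q))) => R [u [v eR]] [gu nu].
rewrite (xc_coords eR) => exc.
have nqu : u != q by apply/eqP => e; apply: nu; rewrite -e (xc_coords eR).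
have := gu _ (xc_coords eR); rewrite /g /p !(hornerXsubC, hornerD, hornerN, hornerZ, hornerM, horner_exp, hornerC, hornerX) -(coordsP eR).
move: exc; rewrite (xc_coords (coords_chord eR eQ nqu)) => -[e].
have nqu' : q - u != 0 by rewrite subr_eq0 eq_sym.
move/eqP; apply.
have -> : (2 * u + (a2 E + q)) * (u - q) ^+ 2 = (v - w) ^+ 2.
  have -> : 2 * u + (a2 E + q) = ((w - v) / (q - u)) ^+ 2.
    set S := _ ^+ 2 in e *.
    have -> : S = (S - a2 E - u - q) + (a2 E + u + q) by ring.
    by rewrite e; ring.
  by field.
by ring.
Qed.

Lemma add_pt_generic P Q R p q u yp yq yu :
  coords P = Some (p, yp) -> coords Q = Some (q, yq) -> coords R = Some (u, yu) ->
  Q <> opp_pt P -> u != p -> u != q -> xc (addp P Q) <> Some u ->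
  xc (addp Q R) <> Some p ->
  addp (addp P Q) R = addp P (addp Q R).
Proof.
move=> eP eQ eR nQ up uq nt nx.
have [s [c [t [ey ey' e2 ef eA]]]] := add_line eP eQ nQ.
have ut : t != u by apply/eqP => e; apply: nt; rewrite (xc_coords eA) e.
have ut' : u != t by rewrite eq_sym.
have uq' : q != u by rewrite eq_sym.
(* The height of R above the line through P and Q. It is nonzero since that line meets the curve
   only at the abscissas p, q, t. *)
pose v := yu - (s * u + c).
have ev : v ^+ 2 + v * (2%:R * (s * u + c)) = (u - p) * (u - q) * (u - t).
  have := coordsP eR; rewrite ef /v => /eqP; rewrite -subr_eq0 => /eqP e.
  by apply/eqP; rewrite -subr_eq0 -[X in _ == X]e; apply/eqP; ring.
have v0 : v != 0.
  apply/eqP => v0; move: ev; rewrite v0 expr0n mul0r addr0 => /esym/eqP.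
  by rewrite !mulf_eq0 !subr_eq0 (negPf up) (negPf uq) (negPf ut').
have eyu : yu = s * u + c + v by rewrite /v; ring.
have := chord_assoc ev v0 uq ut'.
have eB := coords_chord eQ eR uq'.
have eC := coords_chord eA eR ut.
rewrite -e2 -ey' -eyu -ey.
have -> : (yu + (s * t + c)) / (u - t) = (yu - - (s * t + c)) / (u - t) by rewrite opprK.
move=> /= h; have nx' : p != ((yu - yq) / (u - q)) ^+ 2 - a2 E - q - u.
  by apply/eqP => e; apply: nx; rewrite (xc_coords eB) -e.
have [|h1 h2] := h; first by rewrite eq_sym.
apply: coords_inj; rewrite eC (coords_chord eP eB nx'); congr (Some (_, _)); first exact/esym.
by rewrite h2 opprK.
Qed.

Lemma ae_translate P (A : curve_point E -> Prop) : ae A -> ae (fun T => A (addp P T)).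
Proof.
move=> [s hs].
have : ae (fun T => forall S, S \in s -> addp P T <> S).
  apply: ae_all => S _.
  have [->|/eqP nP] := eqVneq P (infinity E).
    by apply: ae_imp (ae_neq S) => T; rewrite add0pt.
  case eS: (coords S) => [[x y]|].
    by apply: ae_imp (ae_xc_addl x nP) => T h e; apply: h; rewrite e (xc_coords eS).
  rewrite (coords_None eS).
  case eP: (coords P) => [[p yp]|]; last by case: nP; apply: coords_None.
  apply: ae_imp2 ae_affine (ae_xc (Some p)) => T [u [v eT]].
  rewrite (xc_coords eT) => n e; have n' : p != u by apply/eqP => e'; apply: n; rewrite e'.
  by have := coords_chord eP eT n'; rewrite e.
by apply: ae_imp => T h; apply: hs; apply/negP => /h.
Qed.

Lemma ae_addA P Q : ae (fun R => addp (addp P Q) R = addp P (addp Q R)).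
Proof.
case eP: (coords P) => [[p yp]|]; last first.
  by apply: aeT => R; rewrite (coords_None eP) !add0pt.
case eQ: (coords Q) => [[q yq]|]; last first.
  by apply: aeT => R; rewrite (coords_None eQ) addpt0 add0pt.
have nQ : Q <> infinity E by move=> e; move: eQ; rewrite e.
have [e|/eqP nPQ] := eqVneq Q (opp_pt P).
  apply: ae_imp2 (ae_imp2 _ ae_affine (ae_xc (Some q))) (ae_xc_addl q nQ); last first.
    by move=> R h1 h2; exact: (conj h1 h2).
  move=> R [[u [v eR]] n1] n2 /=; rewrite e addptN add0pt -e.
  have -> : P = opp_pt Q by rewrite e opp_ptK.
  rewrite (add_ptK eQ eR) //; apply/eqP => e'; apply: n1.
  by rewrite (xc_coords eR) e'.
apply: ae_imp2 (ae_and ae_affine (ae_and (ae_xc (Some q)) (ae_xc (xc (addp P Q)))))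
               (ae_and (ae_xc (Some p)) (ae_xc_addl p nQ)).
move=> R [[u [v eR]] [n1 n2]] [n3 n4]; rewrite (xc_coords eR) in n1 n2 n3.
apply: (add_pt_generic eP eQ eR) => //; last by move=> e; apply: n2.
  by apply/eqP => e; apply: n3; rewrite e.
by apply/eqP => e; apply: n1; rewrite e.
Qed.

(** For generic T, [add_ptK] recovers X from T + X, and likewise Y. *)
Lemma ae_addI X Y : ae (fun T => addp X T = addp Y T) -> X = Y.
Proof.
have cancel X0 : ae (fun T => addp (opp_pt T) (addp T X0) = X0).
  have [->|/eqP nX] := eqVneq X0 (infinity E).
    by apply: aeT => T; rewrite addpt0 addptC addptN.
  case eX: (coords X0) => [[q yq]|]; last by case: nX; apply: coords_None.
  apply: ae_imp2 ae_affine (ae_and (ae_xc (Some q)) (ae_xc_addr nX)) => T [u [v eT]] [n1 n2].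
  apply: (add_ptK eT eX); first by apply/eqP => e; apply: n1; rewrite (xc_coords eT) e.
  by rewrite -(xc_coords eT).
move=> h; have [T [[e1 e2] e3]] := ae_ex (ae_and (ae_and (cancel X) (cancel Y)) h).
by rewrite -e1 -e2 [addp T X]addptC e3 [addp Y T]addptC.
Qed.

(** Both sides are compared after adding a generic fourth point T: every regrouping then needed has
    T or R + T as its last term, where [ae_addA] applies. *)
Lemma addptA P Q R : addp P (addp Q R) = addp (addp P Q) R.
Proof.
apply/esym/ae_addI.
apply: ae_imp2 (ae_and (ae_addA (addp P Q) R) (ae_translate R (ae_addA P Q)))
               (ae_and (ae_addA Q R) (ae_addA P (addp Q R))).
by move=> T [-> ->] [<- ->].
Qed.

End GroupLaw.

HB.instance Definition _ (K : closedFieldType) (E : ecurve K) :=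
  GRing.isZmodule.Build (curve_point E) (@addptA K E) (@addptC K E) (@add0pt K E)
    (fun P => etrans (addptC _ _) (addptN P)).

(** * Isogenies and their degrees *)

Section Rational.
Variables (K : closedFieldType) (E : ecurve K).
Local Notation pt := (curve_point E).
Implicit Types (P Q : pt) (x y : K) (a b c d p : {poly K}).

Lemma opp_ptE P : opp_pt P = - P. Proof. by []. Qed.

Lemma coords_None0 P : coords P = None -> P = 0. Proof. exact: coords_None. Qed.

Lemma xc_oppr P : xc (- P) = xc P. Proof. exact: xc_opp. Qed.

Lemma xc0 : xc (0 : pt) = None. Proof. by []. Qed.

Lemma xc_None P : xc P = None -> P = 0.
Proof. by rewrite /xc; case e: (coords P) => [[x y]|] // _; apply: coords_None. Qed.

Lemma ae_shift P (A : pt -> Prop) : ae A -> ae (fun T => A (P + T)).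
Proof. exact: ae_translate. Qed.

Lemma ae_opp (A : pt -> Prop) : ae A -> ae (fun P => A (- P)).
Proof.
move=> [s hs]; exists (map -%R s) => P h; apply: hs.
by apply: contra h => Ps; rewrite -[P]opprK map_f.
Qed.

Lemma ae_y_neq0 : ae (fun P => forall x y, coords P = Some (x, y) -> y != 0).
Proof.
apply: ae_imp (ae_poly E (rhs_neq0 E)) => P h x y e.
have := h _ (xc_coords e); rewrite -(coordsP e).
by apply: contra => /eqP->; rewrite expr0n.
Qed.

Lemma ae_double : ae (fun P => P + P != 0).
Proof.
apply: ae_imp2 (ae_affine E) ae_y_neq0 => P [x [y e]] /(_ _ _ e) y0.
apply/eqP => e2; have : P = - P by apply: (addIr P); rewrite addNr.
move/(congr1 (@coords K E)); rewrite e (coords_opp_aff e) => -[e3].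
move: y0; have /eqP : 2%:R * y = 0 by rewrite mulr_natl mulr2n {1}e3 addNr.
by rewrite mulf_eq0 (negPf (ec_two E)) => /= ->.
Qed.

Lemma ae_poly_eq0 p : ae (fun P => forall x, xc P = Some x -> p.[x] = 0) -> p = 0.
Proof.
move=> h; apply/eqP; apply: contraT => /(ae_poly E) h'.
have [P [[x [y e]] [h1 h2]]] := ae_ex (ae_and (ae_affine E) (ae_and h h')).
by move: (h2 _ (xc_coords e)); rewrite (h1 _ (xc_coords e)) eqxx.
Qed.

(** The coordinate ring of the affine curve, with basis 1, y over K[x]; the values of h off the
    curve are irrelevant. *)
Definition regular (h : K -> K -> K) : Prop :=
  exists a b, forall x y, y ^+ 2 = (rhs E).[x] -> h x y = a.[x] + b.[x] * y.

Lemma regular_poly p : regular (fun x _ => p.[x]).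
Proof. by exists p, 0 => x y _; rewrite horner0 mul0r addr0. Qed.

Lemma regular_cst (k : K) : regular (fun _ _ => k).
Proof. by exists k%:P, 0 => x y _; rewrite horner0 mul0r addr0 hornerC. Qed.

Lemma regular_x : regular (fun x _ => x).
Proof. by exists 'X, 0 => x y _; rewrite horner0 mul0r addr0 hornerX. Qed.

Lemma regular_y : regular (fun _ y => y).
Proof. by exists 0, 1 => x y _; rewrite horner0 add0r hornerC mul1r. Qed.

Lemma regularD h g : regular h -> regular g -> regular (fun x y => h x y + g x y).
Proof.
move=> [a [b e]] [c [d e']]; exists (a + c), (b + d) => x y exy.
by rewrite (e _ _ exy) (e' _ _ exy) !hornerD; ring.
Qed.

Lemma regularM h g : regular h -> regular g -> regular (fun x y => h x y * g x y).
Proof.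
move=> [a [b e]] [c [d e']]; exists (a * c + b * d * rhs E), (a * d + b * c) => x y exy.
by rewrite (e _ _ exy) (e' _ _ exy) !(hornerD, hornerM) -exy; ring.
Qed.

Lemma regularN h : regular h -> regular (fun x y => - h x y).
Proof.
move=> [a [b e]]; exists (- a), (- b) => x y exy.
by rewrite (e _ _ exy) !hornerN; ring.
Qed.

Lemma regularB h g : regular h -> regular g -> regular (fun x y => h x y - g x y).
Proof. by move=> rh rg; apply: regularD rh _; apply: regularN. Qed.

Lemma regularX h n : regular h -> regular (fun x y => h x y ^+ n).
Proof.
move=> rh; elim: n => [|n IH]; first exact: regular_cst.
have [a [b e]] := regularM rh IH.
by exists a, b => x y exy; rewrite exprS; exact: e.
Qed.

Lemma regular_sum n (h : nat -> K -> K -> K) : (forall i, regular (h i)) ->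
  regular (fun x y => \sum_(i < n) h i x y).
Proof.
move=> rh; elim: n => [|n IH].
  by have [a [b e]] := regular_cst 0; exists a, b => x y exy; rewrite big_ord0; exact: e.
have [a [b e]] := regularD IH (rh n).
by exists a, b => x y exy; rewrite big_ord_recr; exact: e.
Qed.

(** Evaluating a + b y at P and at -P separates a from b y, and both polynomials then vanish at
    almost all abscissas. *)
Lemma regular_eq0 h : regular h ->
  ae (fun P => forall x y, coords P = Some (x, y) -> h x y = 0) ->
  forall x y, y ^+ 2 = (rhs E).[x] -> h x y = 0.
Proof.
move=> [a [b e]] h0.
have ab0 : ae (fun P => forall x, xc P = Some x -> a.[x] = 0 /\ b.[x] = 0).
  apply: ae_imp2 (ae_and h0 (ae_opp h0)) ae_y_neq0 => P [h1 h2] h3 x /xcP[y eP].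
  have exy := coordsP eP; have y0 := h3 _ _ eP.
  have := h2 _ _ (coords_opp_aff eP); rewrite e ?sqrrN // => e2.
  have := h1 _ _ eP; rewrite e // => e1.
  have a0 : a.[x] = 0.
    have /eqP : 2%:R * a.[x] = 0 by rewrite -[RHS]addr0 -{1}e1 -e2; ring.
    by rewrite mulf_eq0 (negPf (ec_two E)) => /eqP.
  by move/eqP: e1; rewrite a0 add0r mulf_eq0 (negPf y0) orbF => /eqP.
have a0 : a = 0 by apply: ae_poly_eq0; apply: ae_imp ab0 => P hP x /hP[].
have b0 : b = 0 by apply: ae_poly_eq0; apply: ae_imp ab0 => P hP x /hP[].
by move=> x y exy; rewrite e // a0 b0 !horner0 mul0r addr0.
Qed.

Definition xrep (g : pt -> pt) a b : Prop := coprimep a b /\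
  ae (fun P => forall x, xc P = Some x -> b.[x] != 0 /\ xc (g P) = Some (a.[x] / b.[x])).

Definition rational (g : pt -> pt) : Prop := exists n d : K -> K -> K,
  [/\ regular n, regular d &
    ae (fun P => forall x y, coords P = Some (x, y) ->
      d x y != 0 /\ xc (g P) = Some (n x y / d x y))].

(** Being nonzero is expressed as finiteness of the kernel, from which all fibres are finite by
    translation. Rationality is asked of the abscissa only, since the degree is read off there. *)
Definition isogeny (g : pt -> pt) : Prop :=
  [/\ forall P Q, g (P + Q) = g P + g Q, ae (fun P => g P <> 0) & rational g].

(** The degree of a / b as a self-map of the projective line. As x has degree 2 on source and target
    alike, it is also the degree of the isogeny. *)
Definition rdeg a b := (maxn (size a) (size b)).-1.

Section Isogeny.
Variable g : pt -> pt.
Hypothesis isog : isogeny g.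

Lemma isogD P Q : g (P + Q) = g P + g Q. Proof. by case: isog. Qed.

Lemma isog0 : g 0 = 0.
Proof. by apply: (addrI (g 0)); rewrite -isogD !addr0. Qed.

Lemma isogN P : g (- P) = - g P.
Proof. by apply: (addrI (g P)); rewrite -isogD !subrr isog0. Qed.

Lemma isog_fiber Q : ae (fun P => g P <> Q).
Proof.
have [[P0 e0]|h] := pselect (exists P0, g P0 = Q); last first.
  by apply: aeT => P e; apply: h; exists P.
case: isog => _ h _; apply: ae_imp (ae_shift (- P0) h) => P n e; apply: n.
by rewrite isogD isogN e e0 addNr.
Qed.

Lemma ae_pull (A : pt -> Prop) : ae A -> ae (fun P => A (g P)).
Proof.
move=> [s hs]; have : ae (fun P => forall Q, Q \in s -> g P <> Q).
  by apply: ae_all => Q _; apply: isog_fiber.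
by apply: ae_imp => P h; apply: hs; apply/negP => /h.
Qed.

(** Multiplying by the conjugate c - e y of the denominator c + e y makes the denominator the
    polynomial [N] and the numerator [A] + [B] y. Since g (-P) = - g P has the same abscissa as g P,
    the term in y vanishes. *)
Lemma xrep_exists : exists a b, xrep g a b.
Proof.
case: isog => _ _ [n [d [[a [b en]] [c [e ed]] h]]].
pose N := c ^+ 2 - e ^+ 2 * rhs E.
pose A := a * c - b * e * rhs E; pose B := b * c - a * e.
have key : ae (fun P => forall x, xc P = Some x ->
    N.[x] != 0 /\ xc (g P) = Some (A.[x] / N.[x])).
  apply: ae_imp2 (ae_and h (ae_opp h)) ae_y_neq0 => P [h1 h2] h3 x /xcP[y eP].
  have exy := coordsP eP; have y0 := h3 _ _ eP.
  have [] := h1 _ _ eP; rewrite en ?ed // => d1 e1.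
  have [] := h2 _ _ (coords_opp_aff eP).
  rewrite en ?ed ?sqrrN // isogN xc_oppr e1 => d2 [e2].
  have eN : N.[x] = (c.[x] + e.[x] * y) * (c.[x] + e.[x] * - y).
    by rewrite /N !(hornerD, hornerN, hornerM, horner_exp) -exy; ring.
  have N0 : N.[x] != 0 by rewrite eN mulf_neq0.
  split=> //; congr Some.
  have eA : A.[x] + B.[x] * y = (a.[x] + b.[x] * y) * (c.[x] + e.[x] * - y).
    by rewrite /A /B !(hornerD, hornerN, hornerM) -exy; ring.
  have eA' : A.[x] - B.[x] * y = (a.[x] + b.[x] * - y) * (c.[x] + e.[x] * y).
    by rewrite /A /B !(hornerD, hornerN, hornerM) -exy; ring.
  have /eqP : 2%:R * (B.[x] * y) = 0.
    have -> : 2%:R * (B.[x] * y) = (A.[x] + B.[x] * y) - (A.[x] - B.[x] * y) by ring.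
    rewrite eA eA'; apply/eqP; rewrite subr_eq0; apply/eqP.
    by move/eqP: e2; rewrite eqr_div // => /eqP.
  rewrite mulf_eq0 (negPf (ec_two E)) => /eqP /= By.
  have : A.[x] = (a.[x] + b.[x] * y) * (c.[x] + e.[x] * - y) by rewrite -eA By addr0.
  by rewrite eN => ->; rewrite -mulf_div divff // mulr1.
have N0 : N != 0.
  have [P [[x [y eP]] h']] := ae_ex (ae_and (ae_affine E) key).
  have [+ _] := h' _ (xc_coords eP).
  by apply: contraNneq => ->; rewrite horner0.
pose G := gcdp A N.
have G0 : G != 0 by rewrite gcdp_eq0 negb_and N0 orbT.
exists (A %/ G), (N %/ G); split; first by rewrite coprimep_div_gcd ?N0 ?orbT.
apply: ae_imp key => P h' x /h'[Nx ->].
have eAG := divpK (dvdp_gcdl A N); have eNG := divpK (dvdp_gcdr A N).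
rewrite -/G in eAG eNG; move: Nx; rewrite -{1 3}eNG -{1}eAG !hornerM.
rewrite mulf_eq0 negb_or => /andP[n0 g0]; split=> //.
by rewrite -mulf_div divff // mulr1.
Qed.

End Isogeny.
End Rational.

(** * The degree of a rational function of one variable *)

Section RationalDegree.
Variable K : closedFieldType.
Implicit Types (a b c d g p q : {poly K}) (x t : K).

Lemma eq_poly_generic g p q : g != 0 ->
  (forall x, g.[x] != 0 -> p.[x] = q.[x]) -> p = q.
Proof.
move=> g0 h; apply/eqP; rewrite -subr_eq0; apply: contraT => pq0.
have [r hr] := poly_neq0_avoid (mulf_neq0 pq0 g0).
have [x xr] := closed_field_avoid r; have := hr _ xr.
rewrite hornerM hornerD hornerN mulf_eq0 negb_or => /andP[h1 /h e].
by rewrite e subrr eqxx in h1.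
Qed.

Lemma coprimep_common_root a b x : coprimep a b -> a.[x] = 0 -> b.[x] != 0.
Proof. by move/Pdiv.ClosedField.coprimepP => h a0; apply: h; rewrite /root a0. Qed.

Lemma rdeg_gt0 a b : coprimep a b -> (0 < maxn (size a) (size b))%N.
Proof.
move=> cab; rewrite leq_max !size_poly_gt0 -negb_and; apply/negP => /andP[/eqP a0 /eqP b0].
by have := @coprimep_common_root a b 0 cab; rewrite a0 b0 !horner0 eqxx => /(_ erefl).
Qed.

Lemma size_rdeg a b : coprimep a b -> maxn (size a) (size b) = (rdeg a b).+1.
Proof. by move=> /rdeg_gt0 h; rewrite /rdeg prednK. Qed.

(** The roots of a - t b form the fibre of a / b over t. The values to avoid are 0, where t b loses
    its size, the ratio at which the leading terms cancel, and the values of a / b at the zeros of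
    g. *)
Lemma pencil_generic a b g : coprimep a b -> g != 0 ->
  exists r : seq K, forall t, t \notin r ->
    size (a - t *: b) = (rdeg a b).+1 /\ coprimep (a - t *: b) g.
Proof.
move=> cab g0; have [rg hg] := poly_neq0_avoid g0.
exists [:: 0, lead_coef a / lead_coef b & [seq a.[z] / b.[z] | z <- rg]] => t.
rewrite !inE !negb_or => /and3P[t0 tl tr]; split.
  rewrite -size_rdeg //; have stb : size (- (t *: b)) = size b by rewrite size_polyN size_scale.
  have [lt|gt|e] := ltngtP (size a) (size b).
  - by rewrite addrC size_polyDl stb.
  - by rewrite size_polyDl ?stb.
  have b0 : b != 0.
    by rewrite -size_poly_gt0; have := rdeg_gt0 cab; rewrite e maxnn.
  apply/eqP; rewrite eqn_leq (leq_trans (size_polyD _ _)) ?stb ?e ?maxnn //=.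
  rewrite -(prednK (_ : 0 < size b)%N) ?size_poly_gt0 //.
  rewrite ltnNge; apply: contra tl => /leq_sizeP/(_ _ (leqnn _)).
  rewrite coefD coefN coefZ => /eqP; rewrite subr_eq0 => /eqP el; rewrite /lead_coef e el mulfK //.
  by rewrite -[_`_ _]/(lead_coef b) lead_coef_eq0.
rewrite coprimep_sym; apply/Pdiv.ClosedField.coprimepP => z /rootP gz.
have zr : z \in rg by apply: contraT => /hg; rewrite gz eqxx.
rewrite hornerD hornerN hornerZ subr_eq0; apply: contra tr => /eqP e.
have bz : b.[z] != 0.
  by apply/eqP => bz; have := coprimep_common_root cab (_ : a.[z] = 0); rewrite e bz mulr0 eqxx => /(_ erefl).
by apply/mapP; exists z; rewrite // e mulfK.
Qed.

(** The polynomial d^(k-1) p(c / d), that is, the form of degree k - 1 attached to p, taken at (c,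
    d). Here k bounds the size of p. *)
Definition homog k p c d := \sum_(i < k) p`_i *: (c ^+ i * d ^+ (k.-1 - i)).

Lemma homogE k p c d x : (size p <= k)%N -> d.[x] != 0 ->
  (homog k p c d).[x] = d.[x] ^+ k.-1 * p.[c.[x] / d.[x]].
Proof.
move=> sp dx; rewrite (horner_coef_wide _ sp) mulr_sumr horner_sum.
apply: eq_bigr => i _; rewrite hornerZ hornerM !horner_exp expr_div_n.
have ik : (i <= k.-1)%N by case: k i {sp} => [[]|k i] //=; rewrite -ltnS.
rewrite [RHS]mulrCA; congr (_ * _); rewrite [RHS]mulrCA; congr (_ * _).
by rewrite -[in RHS](subnK ik) exprD mulfK // expf_neq0.
Qed.

Lemma homog_infty k p c d x : d.[x] = 0 ->
  (homog k.+1 p c d).[x] = p`_k * c.[x] ^+ k.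
Proof.
move=> dx; rewrite /homog big_ord_recr /= subnn expr0 mulr1 hornerD hornerZ horner_exp.
rewrite horner_sum big1 ?add0r // => i _.
by rewrite hornerZ hornerM !horner_exp dx expr0n subn_eq0 leqNgt ltn_ord /= !mulr0.
Qed.

Lemma homog_pencil k a b c d t : homog k (a - t *: b) c d = homog k a c d - t *: homog k b c d.
Proof.
rewrite /homog scaler_sumr -sumrB; apply: eq_bigr => i _.
by rewrite coefD coefN coefZ scalerBl scalerA.
Qed.

(** At a zero of d both forms reduce to their top coefficients times a power of c. These do not both
    vanish, because the degree of the forms is exactly [rdeg a b]. *)
Lemma homog_coprime a b c d : coprimep a b -> coprimep c d ->
  coprimep (homog (rdeg a b).+1 a c d) (homog (rdeg a b).+1 b c d).
Proof.
move=> cab ccd; have [sa sb] : (size a <= (rdeg a b).+1)%N /\ (size b <= (rdeg a b).+1)%N.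
  by rewrite -size_rdeg // leq_maxl leq_maxr.
apply/Pdiv.ClosedField.coprimepP => x /rootP.
have [dx|dx] := eqVneq d.[x] 0; last first.
  rewrite !homogE // => /eqP; rewrite mulf_eq0 expf_eq0 (negPf dx) andbF /= => /eqP ax.
  by rewrite mulf_neq0 ?expf_neq0 // (coprimep_common_root cab ax).
have cx : c.[x] != 0 by rewrite coprimep_sym in ccd; apply: coprimep_common_root ccd dx.
rewrite !homog_infty // => /eqP; rewrite mulf_eq0 expf_eq0 (negPf cx) andbF orbF => /eqP al.
rewrite mulf_neq0 ?expf_neq0 //; apply/eqP => bl.
have drop p : (size p <= (rdeg a b).+1)%N -> p`_(rdeg a b) = 0 -> (size p <= rdeg a b)%N.
  move=> sp p0; apply/leq_sizeP => j; rewrite leq_eqVlt => /predU1P[<- //|lj].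
  by have /leq_sizeP := sp; apply.
have /eqP := size_rdeg cab; rewrite eqn_leq leq_max => /andP[_].
by rewrite !ltnNge !drop.
Qed.

Lemma homog_prod (rs : seq K) lc c d : d != 0 ->
  homog (size rs).+1 (lc *: \prod_(r <- rs) ('X - r%:P)) c d = lc *: \prod_(r <- rs) (c - r *: d).
Proof.
move=> d0; apply: (eq_poly_generic d0) => x dx.
rewrite homogE //; last by rewrite (leq_trans (size_scale_leq _ _)) // size_prod_XsubC.
rewrite !hornerZ !horner_prod mulrCA; congr (_ * _).
elim: rs => [|r rs IH]; first by rewrite !big_nil mulr1.
rewrite !big_cons -IH /= exprS mulrACA; congr (_ * _).
by rewrite hornerXsubC hornerD hornerN hornerZ mulrBr mulrCA divff // mulr1 mulrC.
Qed.

(** The degree is the number of points in a generic fibre. For generic t the polynomial A - t B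
    splits into factors c - z d, one for each root z of a - t b, and each has full degree since
    these z avoid the bad values of the inner pencil. *)
Lemma rdeg_homog a b c d : coprimep a b -> coprimep c d -> d != 0 ->
  rdeg (homog (rdeg a b).+1 a c d) (homog (rdeg a b).+1 b c d) = (rdeg a b * rdeg c d)%N.
Proof.
move=> cab ccd d0; have cAB := homog_coprime cab ccd.
have [r0 h0] := pencil_generic ccd (oner_neq0 _).
pose g : {poly K} := \prod_(z <- r0) ('X - z%:P).
have g0 : g != 0 by rewrite monic_neq0 // monic_prod_XsubC.
have [r1 h1] := pencil_generic cab g0.
have [r2 h2] := pencil_generic cAB (oner_neq0 _).
have [t] := closed_field_avoid (r1 ++ r2); rewrite mem_cat negb_or => /andP[/h1[s1 c1] /h2[s2 _]].
apply/eqP; rewrite -eqSS -s2 -homog_pencil.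
have [rs ers] := closed_field_poly_normal (a - t *: b).
have lc0 : lead_coef (a - t *: b) != 0 by rewrite lead_coef_eq0 -size_poly_gt0 s1.
have srs : size rs = rdeg a b.
  by apply/eqP; rewrite -eqSS -s1 ers size_scale // size_prod_XsubC.
rewrite ers -srs homog_prod // size_scale //.
have sz z : z \in rs -> size (c - z *: d) = (rdeg c d).+1.
  move=> zrs; have /h0[] // : z \notin r0.
  rewrite -root_prod_XsubC; apply/negP => gz.
  have az : (a - t *: b).[z] = 0.
    rewrite ers hornerZ (_ : _.[z] = 0) ?mulr0 //; apply/rootP.
    by rewrite root_prod_XsubC.
  by have := coprimep_common_root c1 az; rewrite (rootP gz) eqxx.
elim: rs sz {ers srs} => [|z rs IH] sz; first by rewrite big_nil size_poly1 mul0n.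
rewrite big_cons size_mul; last first.
- rewrite prodf_seq_neq0; apply/allP => w wrs /=.
  by rewrite -size_poly_gt0 sz // inE wrs orbT.
- by rewrite -size_poly_gt0 sz // mem_head.
have /eqP -> := IH (fun w wrs => sz w (mem_behead (s := z :: rs) wrs)).
by rewrite sz ?mem_head // addSn /= addnS mulSn.
Qed.

Lemma rdeg_eq a b c d : coprimep a b -> coprimep c d -> a * d = c * b -> rdeg a b = rdeg c d.
Proof.
move=> cab ccd e; rewrite /rdeg; congr (maxn _ _).-1; apply: eqp_size.
  rewrite /eqp -(Gauss_dvdpl c cab) -e dvdp_mulr //=.
  by rewrite -(Gauss_dvdpl a ccd) e dvdp_mulr.
rewrite coprimep_sym in cab; rewrite coprimep_sym in ccd.
rewrite /eqp -(Gauss_dvdpr d cab) e dvdp_mull //=.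
by rewrite -(Gauss_dvdpr b ccd) -e dvdp_mull.
Qed.

End RationalDegree.

(** * Kernels, surjectivity and the parallelogram inequality *)

Section IsogenyDegree.
Variables (K : closedFieldType) (E : ecurve K).
Local Notation pt := (curve_point E).
Implicit Types (P Q : pt) (x y : K) (a b c d p : {poly K}) (g h : pt -> pt).

Lemma xrep_denom g a b : xrep g a b -> b != 0.
Proof.
move=> [_ h]; have [P [[x [y eP]] h']] := ae_ex (ae_and (ae_affine E) h).
have [+ _] := h' _ (xc_coords eP).
by apply: contraNneq => ->; rewrite horner0.
Qed.

Lemma xrep_uniq g a b c d : xrep g a b -> xrep g c d -> rdeg a b = rdeg c d.
Proof.
move=> [cab h1] [ccd h2]; apply: rdeg_eq => //; apply/eqP; rewrite -subr_eq0; apply/eqP.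
apply: (@ae_poly_eq0 K E); apply: ae_imp2 h1 h2 => P h1 h2 x eP.
have [b0 e1] := h1 _ eP; have [d0] := h2 _ eP; rewrite e1 => -[/eqP].
rewrite eqr_div // hornerD hornerN !hornerM => /eqP ->.
by rewrite subrr.
Qed.

Lemma xrep_nonconst g a b : isogeny g -> xrep g a b -> (0 < rdeg a b)%N.
Proof.
move=> ig xr; have [cab h] := xr; rewrite lt0n; apply/eqP => r0.
have := size_rdeg cab; rewrite r0 => sz.
have /size1_polyC ea : (size a <= 1)%N by rewrite -sz leq_maxl.
have /size1_polyC eb : (size b <= 1)%N by rewrite -sz leq_maxr.
have [P [[x [y eP]] [h1 h2]]] := ae_ex (ae_and (ae_affine E)
  (ae_and h (ae_pull ig (ae_xc E (Some (a`_0 / b`_0)))))).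
have [_] := h1 _ (xc_coords eP).
by rewrite ea eb !hornerC.
Qed.

Lemma xrep_comp g h a b c d : isogeny g -> isogeny h -> xrep g a b -> xrep h c d ->
  exists A B, xrep (g \o h) A B /\ rdeg A B = (rdeg a b * rdeg c d)%N.
Proof.
move=> ig ih xg xh; have [cab hg] := xg; have [ccd hh] := xh.
exists (homog (rdeg a b).+1 a c d), (homog (rdeg a b).+1 b c d).
split; last by rewrite rdeg_homog // (xrep_denom xh).
split; first exact: homog_coprime.
have [sa sb] : (size a <= (rdeg a b).+1)%N /\ (size b <= (rdeg a b).+1)%N.
  by rewrite -size_rdeg // leq_maxl leq_maxr.
apply: ae_imp2 hh (ae_pull ih hg) => P h1 h2 x eP.
have [d0 e1] := h1 _ eP; have [b0 e2] := h2 _ e1.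
rewrite !homogE // mulf_neq0 ?expf_neq0 //; split=> //.
by rewrite /= e2 -mulf_div divff ?mul1r // expf_neq0.
Qed.

(** Translates P + Q of a generic P by kernel elements Q all lie over t = x (g P), so their
    abscissas are roots of a - t b. These abscissas are distinct because g P differs from - g P. *)
Lemma isog_ker_bound g a b (s : seq pt) : isogeny g -> xrep g a b ->
  uniq s -> (forall P, P \in s -> g P = 0) -> (size s <= rdeg a b)%N.
Proof.
move=> ig xr us hs; have [cab h] := xr.
have [r hr] := pencil_generic cab (oner_neq0 _).
have A1 : ae (fun P => forall Q, Q \in s -> forall x, xc (Q + P) = Some x ->
    b.[x] != 0 /\ xc (g P) = Some (a.[x] / b.[x])).
  apply: ae_all => Q Qs; apply: ae_imp (ae_shift Q h) => P hP x /hP.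
  by rewrite (isogD ig) hs // add0r.
have A2 : ae (fun P => forall Q, Q \in s -> Q + P != 0).
  by apply: ae_all => Q Qs; apply: ae_imp (ae_neq (- Q)) => P n; rewrite addrC addr_eq0; apply/eqP.
have A3 : ae (fun P => forall x, xc (g P) = Some x -> x \notin r).
  have : ae (fun P => forall z, z \in r -> xc (g P) <> Some z).
    by apply: ae_all => z _; apply: (ae_pull ig (ae_xc E (Some z))).
  by apply: ae_imp => P hP x e; apply/negP => /hP.
have A4 : ae (fun P => g P + g P <> 0).
  by apply: ae_imp (ae_pull ig (ae_double E)) => P /eqP.
have [P [[h1 h2] [h3 [h4 h5]]]] := ae_ex (ae_and (ae_and A1 A2) (ae_and A3 (ae_and A4 (isog_fiber ig 0)))).
case eg : (xc (g P)) => [t|]; last by case: h5; apply: xc_None.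
have [st _] := hr _ (h3 _ eg).
pose f Q := odflt 0 (xc (Q + P)).
have fE Q : Q \in s -> xc (Q + P) = Some (f Q).
  move=> Qs; rewrite /f; case e: (xc (Q + P)) => [x|] //.
  by have := h2 _ Qs; rewrite (xc_None e) eqxx.
rewrite -ltnS -st -(size_map f); apply: max_poly_roots.
- by rewrite -size_poly_gt0 st.
- apply/allP => _ /mapP[Q Qs ->]; have [b0] := h1 _ Qs _ (fE _ Qs).
  rewrite eg => -[->]; apply/rootP.
  by rewrite hornerD hornerN hornerZ divfK // subrr.
rewrite map_inj_in_uniq // => Q Q' Qs Q's eQ.
have := fE _ Qs; rewrite eQ -(fE _ Q's) => /xc_eq[/addIr //|e].
case: h4; have := congr1 g e; rewrite opp_ptE (isogN ig) !(isogD ig) (hs _ Qs) (hs _ Q's).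
by rewrite !add0r => {1}->; rewrite addNr.
Qed.

(** Generic points are attained since a - t b has a root, and any Q is the sum of the two generic
    points T and Q - T. *)
Lemma isog_surj g : isogeny g -> forall Q, exists P, g P = Q.
Proof.
move=> ig; have [a [b xr]] := xrep_exists ig; have [cab [s hs]] := xr.
have D0 := xrep_nonconst ig xr.
have [r hr] := pencil_generic cab (oner_neq0 _).
pose bad := [seq a.[x] / b.[x] | x <- pmap (@xc K E) s].
have main : ae (fun Q => exists P, g P = Q).
  have : ae (fun Q => forall z, z \in r ++ bad -> xc Q <> Some z).
    by apply: ae_all => z _; apply: ae_xc.
  apply: ae_imp2 (ae_affine E) => Q [t [y eQ]] hQ.
  have tr : t \notin r ++ bad by apply/negP => /hQ; rewrite (xc_coords eQ).
  move: tr; rewrite mem_cat negb_or => /andP[/hr[st _] tbad].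
  have /closed_rootP[x] : size (a - t *: b) != 1%N by rewrite st eqSS -lt0n.
  rewrite /root hornerD hornerN hornerZ subr_eq0 => /eqP ex.
  have b0 : b.[x] != 0.
    apply/eqP => b0; have ax : a.[x] = 0 by rewrite ex b0 mulr0.
    by have := coprimep_common_root cab ax; rewrite b0 eqxx.
  have [w ew] := sqrt_exists (rhs E).[x]; have [P eP] := point_of ew.
  have Ps : P \notin s.
    apply: contra tbad => Ps; apply/mapP; exists x; last by rewrite ex mulfK.
    by rewrite mem_pmap -(xc_coords eP) map_f.
  have [_] := hs _ Ps _ (xc_coords eP); rewrite ex mulfK // -(xc_coords eQ).
  by move/xc_eq => [e|e]; [exists P | exists (- P); rewrite (isogN ig) e opp_ptE opprK].
move=> Q; have [T [[P1 e1] [P2 e2]]] := ae_ex (ae_and main (ae_opp (ae_shift Q main))).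
by exists (P1 + P2); rewrite (isogD ig) e1 e2 addrC subrK.
Qed.

(** The tangent formula reads x (2 P) = f'^2 / (4 f) - a2 - 2 x. The fraction is reduced because f
    has simple roots, and its numerator has leading coefficient 9 - 8 = 1 in every
    characteristic. *)
Lemma xrep_double : exists a b, xrep (fun P : pt => P + P) a b /\ rdeg a b = 4%N.
Proof.
pose f := rhs E; pose b := 4%:R *: f.
pose a := f^`() ^+ 2 - (4%:R *: ((a2 E)%:P + 2%:R *: 'X)) * f.
have four0 := four_neq0 E.
exists a, b; split.
  split.
    rewrite coprimep_sym; apply/Pdiv.ClosedField.coprimepP => x /rootP.
    rewrite /b hornerZ => /eqP; rewrite mulf_eq0 (negPf four0) => /eqP fx.
    rewrite /a hornerD hornerN horner_exp hornerM fx mulr0 subr0 expf_neq0 //.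
    exact: rhs_simple_root.
  apply: ae_imp (ae_y_neq0 E) => P h x /xcP[y eP].
  have y0 := h _ _ eP; have ey := coordsP eP.
  have fx0 : f.[x] != 0 by rewrite -ey expf_neq0.
  split; first by rewrite /b hornerZ mulf_neq0.
  rewrite (xc_coords (coords_double eP y0)); congr Some.
  rewrite -(derhsE E x) /a /b hornerD hornerN horner_exp hornerM !hornerZ hornerD hornerC hornerZ hornerX.
  by rewrite -/f -ey; field; rewrite y0 four0 (ec_two E).
have sb : size b = 4%N by rewrite /b size_scale // size_rhs.
have sa : size a = 5%N.
  pose r : {poly K} := (- 2%:R * a4 E) *: 'X^2 + (- 8%:R * a6 E) *: 'X
    + (a4 E ^+ 2 - 4%:R * a2 E * a6 E)%:P.
  have -> : a = 'X^4 + r.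
    by rewrite /a /r /f /rhs -lock !derivE -!mul_polyC !(polyCD, polyCN, polyCM) /=; ring.
  have s3 : size ('X^3 + r) = 4%N by rewrite /r !addrA size_cubic.
  rewrite size_polyDl size_polyXn // ltnS -[r](addKr 'X^3).
  by rewrite (leq_trans (size_polyD _ _)) // size_polyN size_polyXn s3.
by rewrite /rdeg sa sb.
Qed.

(** The classical expressions of x3 + x4 and x3 x4 in x1 and x2, packed into one identity in t. *)
Lemma xc_add_sub P Q x1 x2 x3 x4 t : xc P = Some x1 -> xc Q = Some x2 -> x1 != x2 ->
  xc (P + Q) = Some x3 -> xc (P - Q) = Some x4 ->
  (x3 - t) * (x4 - t) * (x1 - x2) ^+ 2 =
  (x1 * x2 - a4 E) ^+ 2 - 4%:R * a6 E * (x1 + x2 + a2 E)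
  - t * (2%:R * (x1 + x2) * (x1 * x2 + a4 E) + 4%:R * a2 E * (x1 * x2) + 4%:R * a6 E)
  + t ^+ 2 * (x1 - x2) ^+ 2.
Proof.
move=> /xcP[y1 eP] /xcP[y2 eQ] n.
have n' : x2 - x1 != 0 by rewrite subr_eq0 eq_sym.
rewrite (xc_coords (coords_chord eP eQ n)) => -[<-].
rewrite (xc_coords (coords_chord eP (coords_opp_aff eQ) n)) => -[<-].
have ef : a6 E = y1 ^+ 2 - (x1 ^+ 3 + a2 E * x1 ^+ 2 + a4 E * x1).
  by rewrite (coordsP eP) rhsE; ring.
have e4 : a4 E = (y2 ^+ 2 - y1 ^+ 2) / (x2 - x1) - (x2 ^+ 2 + x1 * x2 + x1 ^+ 2 + a2 E * (x1 + x2)).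
  by rewrite (coordsP eP) (coordsP eQ) !rhsE; field.
by rewrite ef e4; field.
Qed.

Lemma size_mul_le p (q : {poly K}) n m :
  (size p <= n.+1)%N -> (size q <= m.+1)%N -> (size (p * q)%R <= (n + m).+1)%N.
Proof.
move=> sp sq; apply: leq_trans (size_polyMleq _ _) _.
by have := leq_add sp sq; rewrite addSn addnS; case: (_ + _)%N.
Qed.

Lemma size_add_le p (q : {poly K}) n : (size p <= n)%N -> (size q <= n)%N -> (size (p + q)%R <= n)%N.
Proof. by move=> sp sq; apply: leq_trans (size_polyD _ _) _; rewrite geq_max sp. Qed.

(* With x, x' the abscissas of the sum and of the difference, (x - t)(x' - t) is a
   fraction whose numerator has degree rdeg a3 b3 + rdeg a4 b4 for generic t, and
   is prime to the denominators. *)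
Lemma rdeg_add_sub g h k l a1 b1 a2 b2 a3 b3 a4 b4 :
  isogeny g -> isogeny h -> isogeny k -> isogeny l ->
  (forall P, k P = g P + h P) -> (forall P, l P = g P - h P) ->
  xrep g a1 b1 -> xrep h a2 b2 -> xrep k a3 b3 -> xrep l a4 b4 ->
  (rdeg a3 b3 + rdeg a4 b4 <= 2 * rdeg a1 b1 + 2 * rdeg a2 b2)%N.
Proof.
move=> ig ih ik il ek el xg xh xk xl.
have [[c1 h1] [c2 h2] [c3 h3] [c4 h4]] := And4 xg xh xk xl.
have b30 := xrep_denom xk; have b40 := xrep_denom xl.
have [r3 hr3] := pencil_generic c3 (mulf_neq0 b30 b40).
have [r4 hr4] := pencil_generic c4 (mulf_neq0 b30 b40).
have [t] := closed_field_avoid (r3 ++ r4); rewrite mem_cat negb_or => /andP[/hr3[s3 k3] /hr4[s4 k4]].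
(* [W0], [W1], [W2] are the coefficients of t^2, -t and 1 in [xc_add_sub], multiplied by (b1 b2)^2
   to clear the denominators. *)
pose W0 := (a1 * b2 - a2 * b1) ^+ 2.
pose W1 := 2%:R *: ((a1 * b2 + a2 * b1) * (a1 * a2 + Defs.a4 E *: (b1 * b2)))
  + (4%:R * Defs.a2 E) *: ((a1 * a2) * (b1 * b2)) + (4%:R * a6 E) *: ((b1 * b2) * (b1 * b2)).
pose W2 := (a1 * a2 - Defs.a4 E *: (b1 * b2)) ^+ 2
  - (4%:R * a6 E) *: ((a1 * b2 + a2 * b1 + Defs.a2 E *: (b1 * b2)) * (b1 * b2)).
pose Wt := W2 - t *: W1 + t ^+ 2 *: W0.
have gen : ae (fun P => forall x, xc P = Some x ->
    [/\ W0.[x] != 0, b3.[x] != 0, b4.[x] != 0 &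
     b3.[x] * b4.[x] * Wt.[x] = W0.[x] * ((a3 - t *: b3).[x] * (a4 - t *: b4).[x])]).
  have kl : ae (fun P => k P <> 0 /\ l P <> 0) by apply: ae_and; apply: isog_fiber.
  apply: ae_imp2 (ae_and kl (ae_and h1 h2)) (ae_and h3 h4) => P [[k0 l0] [g1 g2]] [g3 g4] x eP.
  have [[d1 e1] [d2 e2] [d3 e3] [d4 e4]] := And4 (g1 _ eP) (g2 _ eP) (g3 _ eP) (g4 _ eP).
  have n12 : a1.[x] / b1.[x] != a2.[x] / b2.[x].
    apply/eqP => e; have /xc_eq : xc (g P) = xc (h P) by rewrite e1 e2 e.
    by case=> e'; [case: l0; rewrite el e' subrr | case: k0; rewrite ek e' opp_ptE addNr].
  rewrite ek in e3; rewrite el in e4.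
  have := xc_add_sub t e1 e2 n12 e3 e4.
  have nd : a1.[x] * b2.[x] - a2.[x] * b1.[x] != 0.
    by rewrite subr_eq0 -eqr_div.
  rewrite /Wt /W0 /W1 /W2 !(hornerD, hornerN, hornerZ, horner_exp, hornerM) => key.
  split=> //; first by rewrite expf_neq0.
  set B := b1.[x] * b2.[x]; have B0 : B != 0 by rewrite mulf_neq0.
  have b34 : b3.[x] * b4.[x] != 0 by rewrite mulf_neq0.
  transitivity (b3.[x] * b4.[x] * B ^+ 2 * ((a3.[x] / b3.[x] - t) * (a4.[x] / b4.[x] - t) * (a1.[x] / b1.[x] - a2.[x] / b2.[x]) ^+ 2)).
    by rewrite key /B; field; rewrite d1 d2.
  by rewrite /B; field; rewrite d1 d2 d3 d4.
have W00 : W0 != 0.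
  have [P [[x [y eP]] hP]] := ae_ex (ae_and (ae_affine E) gen).
  by have [+ _ _ _] := hP _ (xc_coords eP); apply: contraNneq => ->; rewrite horner0.
have ePoly : b3 * b4 * Wt = W0 * ((a3 - t *: b3) * (a4 - t *: b4)).
  apply/eqP; rewrite -subr_eq0; apply/eqP; apply: (@ae_poly_eq0 K E).
  apply: ae_imp gen => P hP x /hP[_ _ _ e].
  have push (p q u v z w : {poly K}) :
      (p * q * u - v * (z * w)).[x] = p.[x] * q.[x] * u.[x] - v.[x] * (z.[x] * w.[x]).
    by rewrite hornerD hornerN !hornerM.
  by rewrite push e subrr.
have t3 : a3 - t *: b3 != 0 by rewrite -size_poly_gt0 s3.
have t4 : a4 - t *: b4 != 0 by rewrite -size_poly_gt0 s4.
have Wt0 : Wt != 0.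
  apply/eqP => e; have := mulf_neq0 W00 (mulf_neq0 t3 t4).
  by rewrite -ePoly e mulr0 eqxx.
have dv : (a3 - t *: b3) * (a4 - t *: b4) %| Wt.
  rewrite -(Gauss_dvdpr Wt (_ : coprimep _ (b3 * b4))); last by rewrite coprimepMl k3 k4.
  by rewrite ePoly dvdp_mull.
have sWt : (size Wt <= (2 * rdeg a1 b1 + 2 * rdeg a2 b2).+1)%N.
  set n := rdeg a1 b1; set m := rdeg a2 b2.
  have [sa1 sb1] : (size a1 <= n.+1)%N /\ (size b1 <= n.+1)%N.
    by rewrite -size_rdeg // leq_maxl leq_maxr.
  have [sa2 sb2] : (size a2 <= m.+1)%N /\ (size b2 <= m.+1)%N.
    by rewrite -size_rdeg // leq_maxl leq_maxr.
  have Z (z : K) p s : (size p <= s)%N -> (size (z *: p)%R <= s)%N.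
    by apply: leq_trans; apply: size_scale_leq.
  have N p s : (size p <= s)%N -> (size (- p)%R <= s)%N by rewrite size_polyN.
  have -> : (2 * n + 2 * m)%N = ((n + m) + (n + m))%N by rewrite !mul2n -!addnn addnACA.
  have M p (q : {poly K}) : (size p <= n.+1)%N -> (size q <= m.+1)%N -> (size (p * q)%R <= (n + m).+1)%N.
    exact: size_mul_le.
  have M' p (q : {poly K}) : (size p <= m.+1)%N -> (size q <= n.+1)%N -> (size (p * q)%R <= (n + m).+1)%N.
    by rewrite addnC; apply: size_mul_le.
  have h12 := M _ _ sa1 sb2; have h21 := M' _ _ sa2 sb1.
  have haa := M _ _ sa1 sa2; have hbb := M _ _ sb1 sb2.
  have sW0 : (size W0 <= (n + m + (n + m)).+1)%N.
    by rewrite /W0 expr2; have hh := size_add_le h12 (N _ _ h21); exact: (size_mul_le hh hh).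
  have sW1 : (size W1 <= (n + m + (n + m)).+1)%N.
    have hh := size_add_le haa (Z (Defs.a4 E) _ _ hbb).
    have h' := Z 2%:R _ _ (size_mul_le (size_add_le h12 h21) hh).
    have h'' := size_add_le h' (Z (4%:R * Defs.a2 E) _ _ (size_mul_le haa hbb)).
    exact: (size_add_le h'' (Z (4%:R * a6 E) _ _ (size_mul_le hbb hbb))).
  have sW2 : (size W2 <= (n + m + (n + m)).+1)%N.
    rewrite /W2 expr2; have hh := size_add_le haa (N _ _ (Z (Defs.a4 E) _ _ hbb)).
    have h' := size_add_le (size_add_le h12 h21) (Z (Defs.a2 E) _ _ hbb).
    exact: (size_add_le (size_mul_le hh hh) (N _ _ (Z (4%:R * a6 E) _ _ (size_mul_le h' hbb)))).
  exact: (size_add_le (size_add_le sW2 (N _ _ (Z t _ _ sW1))) (Z (t ^+ 2) _ _ sW0)).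
have := dvdp_leq Wt0 dv; rewrite size_mul // s3 s4 addSn addnS /= => sle.
by have := leq_trans sle sWt.
Qed.

End IsogenyDegree.

(** * The degree as a function on a ring of endomorphisms *)

Record isogeny_action (K : closedFieldType) (E : ecurve K) (R : comNzRingType)
    (phi : R -> curve_point E -> curve_point E) : Prop := IsogenyAction {
  actD : forall u v P, phi (u + v) P = phi u P + phi v P;
  actM : forall u v P, phi (u * v) P = phi u (phi v P);
  act1 : forall P, phi 1 P = P;
  act_isog : forall u, u != 0 -> isogeny (phi u);
  act_two : 2%:R != 0 :> R;
  act_dom : forall u v : R, u * v = 0 -> u = 0 \/ v = 0 }.

Section Degree.
Variables (K : closedFieldType) (E : ecurve K) (R : comNzRingType).
Variable phi : R -> curve_point E -> curve_point E.
Hypothesis act : isogeny_action phi.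
Local Notation pt := (curve_point E).
Implicit Types (P Q : pt) (u v : R).

Lemma act0l P : phi 0 P = 0.
Proof. by apply: (addrI (phi 0 P)); rewrite -(actD act) !addr0. Qed.

Lemma actNl u P : phi (- u) P = - phi u P.
Proof. by apply: (addrI (phi u P)); rewrite -(actD act) !subrr act0l. Qed.

Lemma actBl u v P : phi (u - v) P = phi u P - phi v P.
Proof. by rewrite (actD act) actNl. Qed.

Lemma act_mul_neq0 u v : u != 0 -> v != 0 -> u * v != 0.
Proof. by move=> u0 v0; apply/eqP => /(act_dom act)[] /eqP; apply/negP. Qed.

Lemma degree_exists : exists D : R -> nat, D 0 = 0%N /\
  forall u a b, u != 0 -> xrep (phi u) a b -> D u = rdeg a b.
Proof.
have h u : exists n, (u = 0 -> n = 0%N) /\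
    (u != 0 -> forall a b, xrep (phi u) a b -> n = rdeg a b).
  have [->|u0] := eqVneq u 0; first by exists 0%N.
  have [a [b xr]] := xrep_exists (act_isog act u0).
  exists (rdeg a b); split=> [e|_ c d xr']; first by rewrite e eqxx in u0.
  exact: xrep_uniq xr xr'.
have [D hD] := choice h; exists D; split; first by have [->] := hD 0.
by move=> u a b u0; apply: (hD u).2.
Qed.

Variable D : R -> nat.
Hypothesis D0 : D 0 = 0%N.
Hypothesis D_xrep : forall u a b, u != 0 -> xrep (phi u) a b -> D u = rdeg a b.

Lemma degree_frob (Q : nat) u : u != 0 ->
  (forall P, xc (phi u P) = omap (fun x => x ^+ Q) (xc P)) -> D u = Q.
Proof.
move=> u0 h; have xr : xrep (phi u) 'X^Q 1.
  split; first exact: coprimep1.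
  apply: aeT => P x e; rewrite h e hornerXn hornerC divr1.
  by rewrite oner_neq0.
rewrite (D_xrep u0 xr) /rdeg size_polyXn size_poly1.
by rewrite maxnSS maxn0.
Qed.

Lemma degree1 : D 1 = 1%N.
Proof.
by apply: degree_frob (oner_neq0 _) _ => P; rewrite (act1 act); case: (xc P).
Qed.

Lemma degreeM u v : D (u * v) = (D u * D v)%N.
Proof.
have [->|u0] := eqVneq u 0; first by rewrite mul0r D0.
have [->|v0] := eqVneq v 0; first by rewrite mulr0 D0 muln0.
have uv0 := act_mul_neq0 u0 v0.
have iu := act_isog act u0; have iv := act_isog act v0.
have [a [b xu]] := xrep_exists iu; have [c [d xv]] := xrep_exists iv.
have [A [B [xuv e]]] := xrep_comp iu iv xu xv.
rewrite (D_xrep u0 xu) (D_xrep v0 xv) -e; apply: D_xrep uv0 _.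
case: xuv => cAB h; split=> //; apply: ae_imp h => P h x /h.
by rewrite (actM act).
Qed.

Lemma degreeN u : D (- u) = D u.
Proof.
have [->|u0] := eqVneq u 0; first by rewrite oppr0.
have [a [b xu]] := xrep_exists (act_isog act u0).
rewrite (D_xrep u0 xu); apply: D_xrep; first by rewrite oppr_eq0.
case: xu => cab h; split=> //; apply: ae_imp h => P h x /h.
by rewrite actNl xc_oppr.
Qed.

Lemma degree2 : D 2%:R = 4%N.
Proof.
have [a [b [xr <-]]] := xrep_double E; apply: D_xrep (act_two act) _.
case: xr => cab h; split=> //; apply: ae_imp h => P h x /h.
by rewrite (actD act) !(act1 act).
Qed.

Lemma degreeD u : D (u + u) = (4 * D u)%N.
Proof. by rewrite -degree2 -degreeM mulr_natl. Qed.

(** Only one inequality is at hand. Applied to u + v and u - v, whose sum and difference are 2 u and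
    2 v, it yields the opposite one, since doubling multiplies degrees by 4. Vanishing elements are
    set apart because zero is not an isogeny. *)
Lemma degree_parallelogram u v : (D (u + v) + D (u - v) = 2 * D u + 2 * D v)%N.
Proof.
have [->|u0] := eqVneq u 0; first by rewrite !add0r degreeN D0; lia.
have [->|v0] := eqVneq v 0; first by rewrite oppr0 !addr0 D0; lia.
have [uv|s0] := eqVneq (u + v) 0.
  have -> : v = - u by apply/eqP; rewrite -addr_eq0 addrC uv.
  by rewrite subrr opprK degreeN degreeD D0; lia.
have [uv|d0] := eqVneq (u - v) 0.
  by rewrite -(subr0_eq uv) subrr degreeD D0; lia.
have le u' v' : u' != 0 -> v' != 0 -> u' + v' != 0 -> u' - v' != 0 ->
    (D (u' + v') + D (u' - v') <= 2 * D u' + 2 * D v')%N.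
  move=> n1 n2 n3 n4; have [i1 i2 i3 i4] := And4 (act_isog act n1) (act_isog act n2) (act_isog act n3) (act_isog act n4).
  have [a1 [b1 x1]] := xrep_exists i1; have [a2 [b2 x2]] := xrep_exists i2.
  have [a3 [b3 x3]] := xrep_exists i3; have [a4 [b4 x4]] := xrep_exists i4.
  rewrite (D_xrep n1 x1) (D_xrep n2 x2) (D_xrep n3 x3) (D_xrep n4 x4).
  exact: (rdeg_add_sub i1 i2 i3 i4 (actD act u' v') (actBl u' v')).
have e1 : (u + v) + (u - v) = u + u by rewrite addrACA subrr addr0.
have e2 : (u + v) - (u - v) = v + v by rewrite opprB addrC addrA subrK.
have nn (w : R) : w != 0 -> w + w != 0.
  by move=> w0; rewrite -mulr2n -mulr_natl act_mul_neq0 ?(act_two act).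
have := le _ _ u0 v0 s0 d0; have := le _ _ s0 d0.
rewrite e1 e2 !degreeD !nn // => /(_ isT isT); lia.
Qed.

Lemma degree_ker_bound u (s : seq pt) : u != 0 -> uniq s ->
  (forall P, P \in s -> phi u P = 0) -> (size s <= D u)%N.
Proof.
move=> u0; have [a [b xr]] := xrep_exists (act_isog act u0).
by rewrite (D_xrep u0 xr); apply: isog_ker_bound (act_isog act u0) xr.
Qed.

End Degree.

(** * Integers of an imaginary quadratic field *)

(** What is retained of the maximal order. [z] need not generate it, only a subring of finite index.
    [qo_closed] is integral closure: u / g is a root of a monic polynomial with coefficients tr u /
    g and nm u / g^2, up to sign. *)
Record quadratic_order (R : comNzRingType) (sigma : R -> R) (tr nm : R -> int)
    (z : R) (m : nat) : Prop := QuadraticOrder {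
  qo_dom : forall u v : R, u * v = 0 -> u = 0 \/ v = 0;
  qo_char0 : forall k : int, k%:~R = 0 :> R -> k = 0;
  qo_sigmaD : forall u v, sigma (u + v) = sigma u + sigma v;
  qo_sigmaM : forall u v, sigma (u * v) = sigma u * sigma v;
  qo_sigmaK : involutive sigma;
  qo_tr : forall u, u + sigma u = (tr u)%:~R;
  qo_nm : forall u, u * sigma u = (nm u)%:~R;
  qo_closed : forall (g : int) u, g != 0 -> (g %| tr u)%Z -> (g ^+ 2 %| nm u)%Z ->
    exists v, u = g%:~R * v;
  qo_z : z * z = - m%:R;
  qo_sigmaz : sigma z = - z;
  qo_m : (0 < m)%N }.

(** Integral closedness of Z, obtained by mapping the equation to [algC], where a rational algebraic
    integer is an integer. *)
Lemma integral_rat_int (L : fieldExtType rat) (k : rat) :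
  integralOver (intr : int -> L) k%:A -> exists c : int, k = c%:~R.
Proof.
move=> [p mp /rootP pk].
have pk' : (map_poly (intr : int -> rat) p).[k] = 0.
  apply: (fmorph_inj (in_alg L)); rewrite rmorph0 -[RHS]pk -horner_map /=.
  rewrite -map_poly_comp; congr (_.[_]); apply: eq_map_poly => i /=.
  by rewrite -in_algE rmorph_int.
have : (ratr k : algC) \in Num.int.
  apply: Cint_rat_Aint; first exact: Crat_rat.
  apply: (@root_monic_Aint (map_poly (intr : int -> algC) p)).
  - apply/rootP; rewrite -[0](rmorph0 (ratr : {rmorphism rat -> algC})) -pk' -horner_map.
    rewrite -map_poly_comp; congr (_.[_]); apply: eq_map_poly => i /=.
    by rewrite rmorph_int.
  - exact: monic_map.
  by apply/polyOverP => i; rewrite coef_map /=; apply/intrP; exists p`_i.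
move/intrP => [c ec]; exists c; apply: (fmorph_inj (ratr : {rmorphism rat -> algC})).
by rewrite /= ec rmorph_int.
Qed.

Section Quadratic.
Variables (L : fieldExtType rat) (z : L) (m : nat).
Hypotheses (m_gt0 : (0 < m)%N) (z2 : z ^+ 2 = - m%:R) (dimL : \dim {:L} = 2%N).

Lemma quadratic_irrational (x y : rat) : x%:A + y *: z = 0 -> x = 0 /\ y = 0.
Proof.
move=> e; have [y0|y0] := eqVneq y 0.
  move: e; rewrite y0 scale0r addr0 => /eqP.
  by rewrite scaler_eq0 oner_eq0 orbF => /eqP.
have ez : z = (- (x / y))%:A.
  have : y *: z = (- x)%:A by rewrite -[LHS](addKr x%:A) e addr0 scaleNr.
  by move/(congr1 (fun w => y^-1 *: w)); rewrite !scalerA mulVf // scale1r mulrN mulrC.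
have : (x / y) ^+ 2 = - m%:R.
  apply: (fmorph_inj (in_alg L)); rewrite rmorphXn rmorphN rmorph_nat -z2 ez /=.
  by rewrite scaleNr sqrrN.
move=> e'; have := sqr_ge0 (x / y); rewrite e' oppr_ge0.
by rewrite lern0 => /eqP m0; move: m_gt0; rewrite m0.
Qed.

Lemma quadratic_coord (w : L) : exists xy : rat * rat, w = xy.1%:A + xy.2 *: z.
Proof.
have zn1 : z \notin <<[:: 1%R : L]>>%VS.
  apply/negP; rewrite span_seq1 => /vlineP[k ek].
  have := @quadratic_irrational (- k) 1; rewrite scale1r scaleNr ek addNr.
  by move=> /(_ erefl)[_ /eqP]; rewrite oner_eq0.
have bz : basis_of {:L} [:: z; 1%R : L].
  rewrite basisEfree free_cons zn1 /= dimL subvf /= andbT.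
  by rewrite free_cons span_nil memv0 oner_eq0 nil_free.
have : w \in <<[:: z; 1%R : L]>>%VS by rewrite (span_basis bz) memvf.
rewrite span_cons span_seq1 => /memv_addP[_ /vlineP[y ->] [_ /vlineP[x ->] ->]].
by exists (x, y); rewrite addrC.
Qed.

Lemma quadratic_eq (x y x' y' : rat) : x%:A + y *: z = x'%:A + y' *: z -> x = x' /\ y = y'.
Proof.
move=> e; have : (x - x')%:A + (y - y') *: z = 0.
  by rewrite !scalerBl addrACA e -opprD subrr.
by move=> /quadratic_irrational[/subr0_eq-> /subr0_eq->].
Qed.

Lemma quadratic_mul (x y x' y' : rat) (s : L) : s ^+ 2 = - m%:R ->
  (x%:A + y *: s) * (x'%:A + y' *: s) = (x * x' - m%:R * y * y')%:A + (x * y' + x' * y) *: s.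
Proof.
have gen (a b a' b' : L) : s ^+ 2 = - m%:R ->
    (a + b * s) * (a' + b' * s) = (a * a' - m%:R * b * b') + (a * b' + a' * b) * s.
  by move=> s2; rewrite -[m%:R]opprK -s2; ring.
have e u v : u%:A + v *: s = in_alg L u + in_alg L v * s by rewrite /= mulr_algl.
by move=> /gen h; rewrite !e h !(rmorphD, rmorphN, rmorphM) rmorph_nat.
Qed.

(** The same X and Y serve for s = z and s = -z, so that conjugation carries roots of an integer
    polynomial to roots. *)
Lemma quadratic_horner (p : {poly int}) (x y : rat) : exists X Y : rat, forall s : L, s ^+ 2 = - m%:R ->
  (map_poly (intr : int -> L) p).[x%:A + y *: s] = X%:A + Y *: s.
Proof.
elim/poly_ind: p => [|p c [X [Y h]]].
  by exists 0, 0 => s _; rewrite rmorph0 horner0 !scale0r addr0.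
exists (X * x - m%:R * Y * y + c%:~R), (X * y + x * Y) => s s2.
rewrite rmorphD rmorphM /= map_polyX map_polyC /= hornerD hornerM hornerX hornerC h //.
rewrite quadratic_mul // addrAC [in RHS]scalerDl; congr (_ + _ + _).
by rewrite -in_algE rmorph_int.
Qed.

Lemma integral_conj (x y : rat) :
  integralOver (intr : int -> L) (x%:A + y *: z) ->
  integralOver (intr : int -> L) (x%:A - y *: z).
Proof.
move=> [p mp /rootP pr]; exists p => //; apply/rootP.
have [X [Y h]] := quadratic_horner p x y.
have := pr; rewrite h // => /quadratic_irrational[X0 Y0].
by rewrite -scalerN h ?sqrrN // X0 Y0 !scale0r addr0.
Qed.

End Quadratic.

Lemma monic_quadratic (T N : int) : 'X^2 - T *: 'X + N%:P \is monic.
Proof.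
have s1 : (size (- (T *: 'X) + N%:P)%R <= 2)%N.
  apply: leq_trans (size_polyD _ _) _; rewrite size_polyN geq_max.
  rewrite (leq_trans (size_scale_leq _ _)) ?size_polyX //=.
  by rewrite (leq_trans (size_polyC_leq1 _)).
by rewrite -addrA monicE lead_coefDl ?size_polyXn // lead_coefXn.
Qed.

Lemma quadratic_order_of_integers (R : comNzRingType) : imaginary_quadratic_integers R ->
  exists sigma tr nm z m, @quadratic_order R sigma tr nm z m.
Proof.
move=> [L [j [[dimL [m [z [m0 z2]]]] injj hint]]].
have [c hc] := choice (quadratic_coord m0 z2 dimL).
pose s w : L := (c w).1%:A - (c w).2 *: z.
have sE x y : s (x%:A + y *: z) = x%:A - y *: z.
  by have [e1 e2] := quadratic_eq m0 z2 (hc (x%:A + y *: z)); rewrite /s -e1 -e2.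
have sD w w' : s (w + w') = s w + s w'.
  rewrite {1}(hc w) {1}(hc w') addrACA -!scalerDl sE /s !scalerDl opprD addrACA //.
have sM w w' : s (w * w') = s w * s w'.
  rewrite {1}(hc w) {1}(hc w') (quadratic_mul _ _ _ _ z2) sE /s -!scalerN.
  by rewrite (quadratic_mul (m := m) _ _ _ _ (s := - z)) ?sqrrN.
have sK w : s (s w) = w by rewrite [s w]/s -scaleNr sE scaleNr opprK -hc.
have ints u : integralOver (intr : int -> L) (j u) by apply/hint; exists u.
have sgP u : exists v, j v = s (j u).
  by apply/hint; rewrite /s; apply: (integral_conj m0 z2); rewrite -hc; apply: ints.
have [sg hsg] := choice sgP.
have trL w : w + s w = (2%:R * (c w).1)%:A.
  by rewrite {1}(hc w) /s addrACA subrr addr0 -scalerDl mulr_natl mulr2n.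
have nmL w : w * s w = ((c w).1 ^+ 2 + m%:R * (c w).2 ^+ 2)%:A.
  rewrite {1}(hc w) /s -scaleNr (quadratic_mul _ _ _ _ z2).
  by rewrite !mulrN addNr scale0r addr0 opprK -mulrA -!expr2.
have trP u : exists k : int, u + sg u = k%:~R.
  have : integralOver (intr : int -> L) (j (u + sg u)) by apply: ints.
  rewrite rmorphD hsg trL => h; have [k ek] := integral_rat_int h.
  by exists k; apply: injj; rewrite rmorphD hsg trL ek -in_algE !rmorph_int.
have nmP u : exists k : int, u * sg u = k%:~R.
  have : integralOver (intr : int -> L) (j (u * sg u)) by apply: ints.
  rewrite rmorphM hsg nmL => h; have [k ek] := integral_rat_int h.
  by exists k; apply: injj; rewrite rmorphM hsg nmL ek -in_algE !rmorph_int.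
have [tr htr] := choice trP; have [nm hnm] := choice nmP.
have [zR ezR] : exists zR, j zR = z.
  apply/hint; exists ('X^2 - 0 *: 'X + (m%:R)%:P); first exact: monic_quadratic.
  apply/rootP; rewrite scale0r subr0 rmorphD /= map_polyXn map_polyC hornerD hornerXn hornerC /=.
  by rewrite z2 mulrz_nat addNr.
have intrL0 (k : int) : k%:~R = 0 :> L -> k = 0.
  rewrite -(rmorph_int (in_alg L)) => /eqP; rewrite fmorph_eq0 intr_eq0.
  by move/eqP.
exists sg, tr, nm, zR, m; split=> //.
- move=> u v e; have /eqP := congr1 j e.
  rewrite rmorphM rmorph0 mulf_eq0 => /orP[] /eqP e0; [left|right]; apply: injj;
  by rewrite e0 rmorph0.
- by move=> k e; apply: intrL0; rewrite -(rmorph_int j) e rmorph0.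
- by move=> u v; apply: injj; rewrite hsg !rmorphD !hsg sD.
- by move=> u v; apply: injj; rewrite hsg !rmorphM !hsg sM.
- by move=> u; apply: injj; rewrite !hsg sK.
- move=> g u g0 /dvdzP[T eT] /dvdzP[N eN].
  have gL : g%:~R != 0 :> L by apply/eqP => /intrL0 e; rewrite e eqxx in g0.
  have [v ev] : exists v, j v = j u / g%:~R.
    apply/hint; exists ('X^2 - T *: 'X + N%:P); first exact: monic_quadratic.
    apply/rootP; rewrite !(rmorphD, rmorphN) /= map_polyXn map_polyC map_polyZ map_polyX /=.
    rewrite !(hornerD, hornerN, hornerZ, hornerXn, hornerX, hornerC).
    have g2L : g%:~R ^+ 2 != 0 :> L by rewrite expf_neq0.
    have e : j u ^+ 2 - (T * g)%:~R * j u + (N * g ^+ 2)%:~R = 0.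
      have /(congr1 j) := htr u; rewrite rmorphD rmorph_int eT => <-.
      have /(congr1 j) := hnm u; rewrite rmorphM rmorph_int eN => <-.
      by ring.
    apply: (mulfI g2L); rewrite mulr0 -[RHS]e !intrM; field.
    exact: gL.
  exists v; apply: injj; rewrite rmorphM rmorph_int ev mulrC divfK //.
- by apply: injj; rewrite rmorphM rmorphN rmorph_nat ezR -expr2.
apply: injj; rewrite hsg rmorphN ezR.
by have := sE 0 1; rewrite scale0r add0r sub0r scale1r.
Qed.

(** * The degree is the norm *)

Lemma expn_succ_lower b j : (b ^ j.+1 + j.+1 * b ^ j <= b.+1 ^ j.+1)%N.
Proof.
elim: j => [|j IH]; first by rewrite expn0 !expn1 mul1n addn1.
rewrite [(b.+1 ^ _)%N]expnS; apply: leq_trans (_ : b.+1 * (b ^ j.+1 + j.+1 * b ^ j) <= _)%N.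
  rewrite !expnS; set c := (b ^ j)%N; nia.
by rewrite leq_mul2l IH orbT.
Qed.

(** If b < a, the power j + 1 with j = C b contradicts the bound: (b + 1)^(j+1) is at least (b + j +
    1) b^j, which exceeds C b^(j+1). *)
Lemma leq_of_powers C a b : (forall j, a ^ j <= C * b ^ j)%N -> (a <= b)%N.
Proof.
move=> h; rewrite leqNgt; apply/negP => ba.
have [b0|b0] := posnP b.
  by have := h 1%N; rewrite b0 !expn1 muln0 leqn0 => /eqP a0; rewrite a0 in ba.
have := h (C * b).+1; rewrite leqNgt => /negP; apply.
apply: leq_trans (_ : b.+1 ^ (C * b).+1 <= _)%N; last by rewrite leq_exp2r.
apply: leq_trans (expn_succ_lower b (C * b)).
rewrite !expnS; set c := (b ^ (C * b))%N.
have : (0 < c)%N by rewrite expn_gt0 b0.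
nia.
Qed.

Lemma int_second_difference (g : int -> int) (c : int) :
  (forall k, g (k + 1) + g (k - 1) = 2%:R * g k + 2%:R * c) ->
  forall k, g k = k ^+ 2 * c + k * (g 1 - g 0 - c) + g 0.
Proof.
move=> h; set b := g 1 - g 0 - c.
pose A k := g k = k ^+ 2 * c + k * b + g 0.
have up k : A (k - 1) -> A k -> A (k + 1).
  by rewrite /A => e1 e2; have := h k; rewrite e1 e2 => /(canRL (addrK _)) ->; ring.
have down k : A (k + 1) -> A k -> A (k - 1).
  by rewrite /A => e1 e2; have := h k; rewrite e1 e2 addrC => /(canRL (addrK _)) ->; ring.
have A0 : A 0 by rewrite /A; ring.
have A1 : A 1 by rewrite /A /b; ring.
have pos (n : nat) : A n%:Z /\ A (n%:Z + 1).
  elim: n => [|n [h1 h2]]; first by rewrite add0r.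
  have e : n.+1%:Z = n%:Z + 1 by rewrite -addn1 PoszD.
  by rewrite e; split=> //; apply: up => //; rewrite addrK.
have neg (n : nat) : A (- n%:Z) /\ A (- n%:Z - 1).
  elim: n => [|n [h1 h2]].
    by rewrite oppr0; split=> //; apply: down => //; rewrite add0r.
  have e : - n.+1%:Z = - n%:Z - 1 by rewrite -addn1 PoszD opprD.
  by rewrite e; split=> //; apply: down => //; rewrite subrK.
case=> n; first by have [] := pos n.
by rewrite NegzE; have [] := neg n.+1.
Qed.

Section DegreeNorm.
Variables (R : comNzRingType) (sigma : R -> R) (tr nm : R -> int) (z : R) (m : nat).
Hypothesis qo : quadratic_order sigma tr nm z m.
Variable D : R -> nat.
Hypotheses (D0 : D 0 = 0%N) (D1 : D 1 = 1%N) (DN : forall u, D (- u) = D u).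
Hypothesis DM : forall u v, D (u * v) = (D u * D v)%N.
Hypothesis D_par : forall u v, (D (u + v) + D (u - v) = 2 * D u + 2 * D v)%N.
Implicit Types u v : R.
Local Notation d u := (D u)%:Z.

Lemma intr_injR : injective (intr : int -> R).
Proof.
move=> x y e; apply/eqP; rewrite -subr_eq0; apply/eqP/(qo_char0 qo).
by rewrite rmorphB /= e subrr.
Qed.

Lemma quadratic_progression u v (k : int) :
  d (u + k%:~R * v) = k ^+ 2 * d v + k * (d (u + v) - d u - d v) + d u.
Proof.
have h k' : d (u + (k' + 1)%:~R * v) + d (u + (k' - 1)%:~R * v)
    = 2%:R * d (u + k'%:~R * v) + 2%:R * d v.
  have -> : u + (k' + 1)%:~R * v = u + k'%:~R * v + v by rewrite rmorphD /= mulrDl mul1r addrA.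
  have -> : u + (k' - 1)%:~R * v = u + k'%:~R * v - v by rewrite rmorphB /= mulrBl mul1r addrA.
  by rewrite -PoszD D_par; lia.
by have := int_second_difference h k; rewrite !mul1r mul0r addr0.
Qed.

Lemma degree_int (k : int) : d k%:~R = k ^+ 2.
Proof.
have := quadratic_progression 0 1 k; rewrite !add0r mulr1 D0 D1 => ->.
by ring.
Qed.

(** D z = m because z^2 = -m. The parallelogram law leaves a cross term k b(w) in the degree of k +
    w z; computing the degree of z (w + w z) = - m w + w z in two ways gives b(w) w = 0. *)
Lemma degree_lattice (x y : int) : d (x%:~R + y%:~R * z) = x ^+ 2 + m%:Z * y ^+ 2.
Proof.
have m0 : m%:Z != 0 by have := qo_m qo; case: m.
have dz : d z = m%:Z.
  have : (D z * D z = m * m)%N.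
    by apply/eqP; rewrite -eqz_nat -DM (qo_z qo) DN PoszM -expr2 -degree_int.
  by move=> h; congr Posz; nia.
have dyz w : d (w%:~R * z) = m%:Z * w ^+ 2 by rewrite DM PoszM degree_int dz mulrC.
pose b w : int := d (w%:~R * z + 1) - d (w%:~R * z) - 1.
have e w k : d (k%:~R + w%:~R * z) = k ^+ 2 + k * b w + m%:Z * w ^+ 2.
  have := quadratic_progression (w%:~R * z) 1 k.
  by rewrite mulr1 D1 addrC dyz /b dyz => ->; ring.
have key w : b w * w = 0.
  have : d (z * (w%:~R + w%:~R * z)) = d ((- m%:Z * w)%:~R + w%:~R * z).
    have -> : z * (w%:~R + w%:~R * z) = w%:~R * (z * z) + w%:~R * z by ring.
    by rewrite (qo_z qo) mulrC intrM rmorphN.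
  rewrite DM PoszM dz !e => h; apply: (mulfI m0); nia.
rewrite e; have [->|y0] := eqVneq y 0.
  by rewrite /b mul0r add0r D1 D0; ring.
by have /eqP := key y; rewrite mulf_eq0 (negPf y0) orbF => /eqP ->; rewrite mulr0 addr0.
Qed.

(** Coordinates with respect to 1, z are read off the traces of u and u z; in particular 2 m u lies
    in Z[z]. *)
Lemma lattice_coord u : (2 * m)%:R * u = (m%:Z * tr u)%:~R - (tr (u * z))%:~R * z.
Proof.
have e1 := qo_tr qo u; have e2 := qo_tr qo (u * z).
rewrite (qo_sigmaM qo) (qo_sigmaz qo) in e2.
rewrite intrM -e1 -e2 -pmulrn natrM.
have -> : m%:R = - (z * z) :> R by rewrite (qo_z qo) opprK.
by ring.
Qed.

Lemma sigma1 : sigma 1 = 1.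
Proof. by rewrite -[LHS]mulr1 -{2}(qo_sigmaK qo 1) -(qo_sigmaM qo) mul1r (qo_sigmaK qo). Qed.

Lemma sigma0 : sigma 0 = 0.
Proof. by apply: (addrI (sigma 0)); rewrite -(qo_sigmaD qo) !addr0. Qed.

Lemma sigmaN u : sigma (- u) = - sigma u.
Proof. by apply: (addrI (sigma u)); rewrite -(qo_sigmaD qo) !subrr sigma0. Qed.

Lemma sigma_int (k : int) : sigma k%:~R = k%:~R.
Proof.
have nat_case (n : nat) : sigma n%:R = n%:R.
  by elim: n => [|n IH]; rewrite ?sigma0 // -addn1 natrD (qo_sigmaD qo) IH sigma1.
by case: k => n; rewrite ?NegzE ?rmorphN ?sigmaN /= -pmulrn nat_case.
Qed.

(** Multiplication by 2 m moves u into Z[z], where the degree is known, and scales both sides by (2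
    m)^2. *)
Lemma degree_norm u : d u = nm u.
Proof.
have m0 := qo_m qo.
have k0 : ((2 * m)%:Z ^+ 2 : int) != 0 by rewrite expf_neq0 //; lia.
apply: (mulfI k0).
have -> : (2 * m)%:Z ^+ 2 * d u = d ((2 * m)%:R * u).
  by rewrite DM [RHS]PoszM [(2 * m)%:R]pmulrn degree_int.
rewrite lattice_coord -mulNr -rmorphN degree_lattice.
apply: intr_injR; rewrite intrM -(qo_nm qo) rmorphXn /=.
have -> : ((2 * m)%:Z%:~R : R) ^+ 2 * (u * sigma u) = ((2 * m)%:R * u) * sigma ((2 * m)%:R * u).
  by rewrite (qo_sigmaM qo) [(2 * m)%:R]pmulrn sigma_int; ring.
rewrite lattice_coord (qo_sigmaD qo) sigmaN (qo_sigmaM qo) !sigma_int (qo_sigmaz qo).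
rewrite sqrrN rmorphD !(rmorphM, rmorphXn) /=.
have -> : (m%:Z%:~R : R) = - (z * z) by rewrite (qo_z qo) opprK -pmulrn.
by ring.
Qed.

End DegreeNorm.

(** * Ideals and their torsion *)

Lemma maximal_seq (T : Type) (ok : seq T -> Prop) (N : nat) : ok [::] ->
  (forall s, ok s -> (size s <= N)%N) -> exists s, ok s /\ forall x, ~ ok (x :: s).
Proof.
move=> ok0 bd.
suff h k s : ok s -> (N <= size s + k)%N -> exists s, ok s /\ forall x, ~ ok (x :: s).
  by apply: (h N [::]).
elim: k s => [|k IH] s oks; rewrite ?addn0 => Ns.
  by exists s; split=> // x /bd /=; rewrite ltnNge Ns.
have [[x okx]|no] := pselect (exists x, ok (x :: s)); last first.
  by exists s; split=> // x okx; apply: no; exists x.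
by apply: (IH _ okx); rewrite /= addSnnS.
Qed.

Definition enumerates (T : eqType) (s : seq T) (A : T -> Prop) : Prop :=
  uniq s /\ forall x, x \in s <-> A x.

Lemma set_card_enumerates (T : choiceType) (s : seq T) (A : set T) :
  enumerates s A -> set_card A = size s.
Proof.
move=> [us hs]; have -> : A = [set` seq_fset tt s].
  apply/seteqP; split=> x; first by move/hs => xs; apply: etrans xs; exact: seq_fsetE.
  by move=> xs; apply/hs; rewrite -(seq_fsetE tt).
by rewrite /set_card set_fsetK size_seq_fset undup_id.
Qed.

Lemma enumerate_bounded (T : eqType) (A : T -> Prop) N :
  (forall s, uniq s -> (forall x, x \in s -> A x) -> (size s <= N)%N) ->
  exists2 s, enumerates s A & (size s <= N)%N.
Proof.
move=> bd; have [||s [[us sA] mx]] := @maximal_seq T (fun s => uniq s /\ forall x, x \in s -> A x) N.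
- by split.
- by move=> s [us sA]; apply: bd.
exists s; last exact: bd.
split=> // x; split=> [/sA //|Ax]; apply: contrapT => /negP xs; apply: (mx x).
by split=> [/=|y]; rewrite ?xs // inE => /predU1P[->|/sA].
Qed.

Section Ideals.
Variable R : comNzRingType.
Implicit Types (I J L : set R) (u v w : R).

Lemma is_ideal0 I : is_ideal I -> I 0. Proof. by case. Qed.

Lemma is_idealM I u v : is_ideal I -> I v -> I (u * v).
Proof. by move=> [I0 h] Iv; have := h u v 0 Iv I0; rewrite addr0. Qed.

Lemma is_idealD I u v : is_ideal I -> I u -> I v -> I (u + v).
Proof. by move=> [I0 h] Iu Iv; have := h 1 u v Iu Iv; rewrite mul1r. Qed.

Lemma is_idealN I u : is_ideal I -> I u -> I (- u).
Proof. by move=> iI Iu; rewrite -mulN1r; apply: is_idealM. Qed.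

Lemma is_idealB I u v : is_ideal I -> I u -> I v -> I (u - v).
Proof. by move=> iI Iu Iv; apply: is_idealD => //; apply: is_idealN. Qed.

Lemma is_ideal_sum (T : eqType) I (s : seq T) (F : T -> R) : is_ideal I ->
  (forall x, x \in s -> I (F x)) -> I (\sum_(x <- s) F x).
Proof.
move=> iI h; rewrite big_seq; elim/big_ind: _ => [||x /h //]; first exact: is_ideal0.
by move=> u v; apply: is_idealD.
Qed.

Lemma ideal_mul_mem I J u v : I u -> J v -> ideal_mul I J (u * v).
Proof.
move=> Iu Jv; exists [:: (u, v)]; rewrite big_seq1; split=> // p.
by rewrite inE => /eqP ->.
Qed.

Lemma ideal_mul_sub I J L : is_ideal L ->
  (forall u v, I u -> J v -> L (u * v)) -> ideal_mul I J `<=` L.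
Proof.
move=> iL h _ [s [hs ->]]; apply: is_ideal_sum => // p /hs[]; exact: h.
Qed.

Lemma ideal_mul_ideal I J : is_ideal I -> is_ideal (ideal_mul I J).
Proof.
move=> iI; split; first by exists [::]; rewrite big_nil; split.
move=> u _ _ [s [hs ->]] [t [ht ->]].
exists ([seq (u * p.1, p.2) | p <- s] ++ t); split; last first.
  by rewrite big_cat big_map mulr_sumr; congr (_ + _); apply: eq_bigr => p _ /=; rewrite mulrA.
move=> p; rewrite mem_cat => /orP[/mapP[q qs ->]|/ht //] /=.
by have [h1 h2] := hs _ qs; split=> //; apply: is_idealM.
Qed.

Lemma setT_ideal : is_ideal [set: R]. Proof. by []. Qed.

(** The colon ideal (I : A). It allows an inclusion for a product of ideals to be checked on
    generators, one factor at a time. *)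
Lemma transporter_ideal I (A : set R) : is_ideal I ->
  is_ideal [set u | forall v, A v -> I (u * v)].
Proof.
move=> iI; split=> [v _|u v w hv hw x Ax]; first by rewrite mul0r; apply: is_ideal0.
rewrite mulrDl -mulrA; apply: is_idealD => //; last exact: hw.
by apply: is_idealM => //; apply: hv.
Qed.

(** Bundling makes multiplication a commutative monoid law, so that factorizations become big
    products; for arbitrary subsets the unit law fails. *)
Record idl := Idl { idl_set :> set R; idlP : is_ideal idl_set }.
Definition idl_mem (I : idl) : R -> Prop := idl_set I.
Coercion idl_mem : idl >-> Funclass.

Lemma idl_eq (I J : idl) : (forall u, I u <-> J u) -> I = J.
Proof.
case: I J => [I iI] [J iJ] /= h; have e : I = J by apply/seteqP; split=> u /h.
by subst J; congr Idl; apply: Prop_irrelevance.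
Qed.

HB.instance Definition _ := gen_eqMixin idl.

Definition idl_mul (I J : idl) : idl := Idl (ideal_mul_ideal J (idlP I)).
Definition idl_one : idl := Idl setT_ideal.

Lemma idl_mulC : commutative idl_mul.
Proof.
move=> I J; apply: idl_eq => u; split; apply: ideal_mul_sub (idlP (idl_mul _ _)) _ u => u v Iu Jv;
by rewrite mulrC; apply: ideal_mul_mem.
Qed.

Lemma idl_mulA : associative idl_mul.
Proof.
move=> I J L; apply: idl_eq => w; split.
  apply: ideal_mul_sub w; first exact: idlP (idl_mul _ _).
  move=> a b Ia JLb; rewrite mulrC; move: b JLb a Ia.
  suff : ideal_mul J L `<=` [set b | forall a, I a -> idl_mul (idl_mul I J) L (b * a)].
    by move=> h b /h.
  apply: ideal_mul_sub; first by apply: transporter_ideal; apply: idlP.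
  move=> u v Ju Lv a Ia; rewrite mulrC mulrA; apply: ideal_mul_mem => //.
  exact: ideal_mul_mem.
apply: ideal_mul_sub w; first exact: idlP (idl_mul _ _).
suff : ideal_mul I J `<=` [set b | forall a, L a -> idl_mul I (idl_mul J L) (b * a)].
  by move=> h a b /h; apply.
apply: ideal_mul_sub; first by apply: transporter_ideal; apply: idlP.
move=> u v Ju Lv a Ia; rewrite -mulrA; apply: ideal_mul_mem => //.
exact: ideal_mul_mem.
Qed.

Lemma idl_mul1 : left_id idl_one idl_mul.
Proof.
move=> I; apply: idl_eq => u; split.
  by apply: ideal_mul_sub (idlP I) _ u => a b _; apply: is_idealM (idlP I).
by move=> Iu; rewrite -[u]mul1r; apply: ideal_mul_mem.
Qed.

HB.instance Definition _ := Monoid.isComLaw.Build idl idl_one idl_mul idl_mulA idl_mulC idl_mul1.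

Lemma idl_mul_subl (I J : idl) : idl_mul I J `<=` I.
Proof.
by apply: ideal_mul_sub (idlP I) _ => u v Iu _; rewrite mulrC; apply: is_idealM (idlP I) Iu.
Qed.

Definition transversal I (s : seq R) : Prop :=
  [/\ uniq s, forall u, exists2 v, v \in s & I (u - v) &
      forall u v, u \in s -> v \in s -> I (u - v) -> u = v].

Lemma transversal_bounded I N : is_ideal I ->
  (forall s : seq R, uniq s -> (forall u v, u \in s -> v \in s -> I (u - v) -> u = v) ->
     (size s <= N)%N) ->
  exists2 s, transversal I s & (size s <= N)%N.
Proof.
move=> iI bd.
have [||s [[us si] mx]] := @maximal_seq R (fun s => uniq s /\
    forall u v, u \in s -> v \in s -> I (u - v) -> u = v) N.
- by split.
- by move=> s []; apply: bd.
exists s; last exact: bd.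
split=> // u; apply: contrapT => no; apply: (mx u).
have noI v : v \in s -> ~ I (u - v) by move=> vs Iuv; apply: no; exists v.
split=> [/=|v w].
  rewrite us andbT; apply/negP => /noI; apply; rewrite subrr; exact: is_ideal0.
rewrite !inE => /predU1P[->|vs] /predU1P[->|ws] //; last exact: si.
  by move/(noI _ ws).
by move/(is_idealN iI); rewrite opprB => /(noI _ vs).
Qed.

Lemma transversal_inject I (T : finType) (k : R -> T) : is_ideal I ->
  (forall u v, k u = k v -> I (u - v)) ->
  exists2 s, transversal I s & (size s <= #|T|)%N.
Proof.
move=> iI hk; apply: transversal_bounded => // s us si.
rewrite -(size_map k) cardT; apply: uniq_leq_size => [|x _]; last by rewrite mem_enum.
rewrite map_inj_in_uniq // => u v us' vs /hk; exact: si.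
Qed.

Lemma transversal_size I s t : is_ideal I -> transversal I s -> transversal I t ->
  (size s <= size t)%N.
Proof.
move=> iI [us _ hs] [_ ht _].
have tP u : exists v, v \in t /\ I (u - v) by have [v] := ht u; exists v.
have [f hf] := choice tP.
rewrite -(size_map f); apply: uniq_leq_size => [|_ /mapP[u _ ->]]; last exact: (hf u).1.
rewrite map_inj_in_uniq // => u v us' vs e; apply: hs => //.
have -> : u - v = (u - f u) - (v - f v) by rewrite e opprB addrA subrK.
by apply: is_idealB => //; apply: (hf _).2.
Qed.

Lemma ideal_norm_transversal I s : is_ideal I -> transversal I s -> ideal_norm I = size s.
Proof.
move=> iI [us hs1 hs2]; rewrite /ideal_norm /set_card.
pose c u : set R := [set u + v | v in I].
have cE u v : I (u - v) -> c u = c v.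
  move=> h; apply/seteqP; split=> _ [w Iw <-].
    by exists (u - v + w); [apply: is_idealD | ring].
  exists (v - u + w); last by ring.
  by apply: is_idealD => //; rewrite -opprB; apply: is_idealN.
have ci u v : c u = c v -> I (u - v).
  move=> e; have : c u u by exists 0; rewrite ?addr0 //; apply: is_ideal0.
  by rewrite e => -[w Iw <-]; rewrite addrC addKr.
have -> : size s = size [seq c v | v <- s] by rewrite size_map.
apply: set_card_enumerates; split.
  by rewrite map_inj_in_uniq // => u v us' vs /ci; apply: hs2.
move=> x; split=> [/mapP[v _ ->]|[u _ <-]]; first by exists v.
by have [v vs uv] := hs1 u; apply/mapP; exists v => //; apply: cE.
Qed.

End Ideals.

(** * Invertible ideals, indices and maximality of primes *)

Section Dedekind.
Variables (R : comNzRingType) (sigma : R -> R) (tr nm : R -> int) (z : R) (m : nat).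
Hypothesis qo : quadratic_order sigma tr nm z m.
Variable D : R -> nat.
Hypotheses (D0 : D 0 = 0%N) (D1 : D 1 = 1%N) (DN : forall u, D (- u) = D u).
Hypothesis DM : forall u v, D (u * v) = (D u * D v)%N.
Hypothesis D_par : forall u v, (D (u + v) + D (u - v) = 2 * D u + 2 * D v)%N.
Implicit Types (u v w r : R) (I p : idl R).

Let Dnm := degree_norm qo D0 D1 DN DM D_par.
Lemma qo_mulf_neq0 u v : u != 0 -> v != 0 -> u * v != 0.
Proof. by move=> u0 v0; apply/eqP => /(qo_dom qo)[] /eqP; apply/negP. Qed.

Lemma qo_mulfI c : c != 0 -> injective (fun u : R => c * u).
Proof.
move=> c0 u v /= e; apply/eqP; rewrite -subr_eq0; apply/eqP.
have : c * (u - v) = 0 by rewrite mulrBr e subrr.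
by move/(qo_dom qo) => [/eqP|//]; rewrite (negPf c0).
Qed.

Lemma qo_int_neq0 (k : int) : k != 0 -> k%:~R != 0 :> R.
Proof. by apply: contra => /eqP /(qo_char0 qo) ->. Qed.

Lemma D_natE u : u * sigma u = (D u)%:R.
Proof. by rewrite (qo_nm qo) -Dnm -pmulrn. Qed.

Lemma qo_D_gt0 u : u != 0 -> (0 < D u)%N.
Proof.
move=> u0; rewrite lt0n; apply/eqP => e; have := D_natE u; rewrite e.
case/(qo_dom qo) => [/eqP|s0]; first by rewrite (negPf u0).
by move: u0; rewrite -(qo_sigmaK qo u) s0 (sigma0 qo) eqxx.
Qed.

Definition nonzero_idl I := exists2 u, I u & u != 0.

(* I times its conjugate is generated by its least positive integer. *)
Lemma idl_inverse I : nonzero_idl I -> exists (J : set R) (c : R),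
  [/\ c != 0, forall i j, I i -> J j -> exists r, i * j = c * r & ideal_mul I J c].
Proof.
move=> [u Iu u0]; pose J : set R := [set v | I (sigma v)].
have iI := idlP I; have iIJ := ideal_mul_ideal J iI.
pose A n := `[< (0 < n)%N /\ ideal_mul I J n%:R >].
have exA : exists n, A n.
  exists (D u); apply/asboolP; split; first exact: qo_D_gt0.
  by rewrite -D_natE; apply: ideal_mul_mem => //; rewrite /J /= (qo_sigmaK qo).
case: (ex_minnP exA) => g /asboolP[g0 gIJ] gmin.
have gz0 : g%:Z != 0 by rewrite -lt0n.
have dvd_g (k : int) : ideal_mul I J k%:~R -> (g%:Z %| k)%Z.
  move=> kIJ; apply/dvdz_mod0P; apply: contrapT => /eqP r0.
  have rIJ : ideal_mul I J ((k %% g)%Z)%:~R.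
    rewrite /modz rmorphB rmorphM /=; apply: is_idealB => //.
    by apply: is_idealM => //; rewrite -pmulrn.
  have rg : (k %% g)%Z = `|(k %% g)%Z|%N%:Z by rewrite gez0_abs // modz_ge0.
  have : A `|(k %% g)%Z|%N.
    by apply/asboolP; rewrite absz_gt0 r0; split=> //; rewrite pmulrn -rg.
  by move/gmin; rewrite leqNgt -ltz_nat -rg ltz_pmod.
exists J, g%:R; split=> //; first by rewrite pmulrn qo_int_neq0.
(* The quotient i j / g is integral: the trace of i j lies in I J, and its norm is the product of nm
   i and nm j, both of which lie in I J, so that g^2 divides it. *)
move=> i j Ii Jj; rewrite pmulrn; apply: (qo_closed qo) => //.
  apply: dvd_g; rewrite -(qo_tr qo) (qo_sigmaM qo); apply: is_idealD => //.
    exact: ideal_mul_mem.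
  by rewrite mulrC; apply: ideal_mul_mem => //; rewrite /J /= (qo_sigmaK qo).
have -> : nm (i * j) = nm i * nm j.
  apply: (intr_injR qo); rewrite intrM -!(qo_nm qo) (qo_sigmaM qo); ring.
rewrite expr2 dvdz_mul //; apply: dvd_g; rewrite -(qo_nm qo).
  by apply: ideal_mul_mem => //; rewrite /J /= (qo_sigmaK qo).
by rewrite mulrC; apply: ideal_mul_mem.
Qed.

Definition residue (k : nat) (a : int) : 'I_k.-1.+1 := inord `|(a %% k)%Z|%N.

Lemma residue_eq k (a b : int) : (0 < k)%N -> residue k a = residue k b -> (k %| a - b)%Z.
Proof.
move=> k0 /(congr1 (@nat_of_ord _)).
have kz : k%:Z != 0 by rewrite -lt0n.
have lt (c : int) : (`|(c %% k)%Z|%N < k.-1.+1)%N.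
  by rewrite prednK // -ltz_nat gez0_abs ?modz_ge0 // ltz_pmod.
rewrite !inordK // => e; rewrite -eqz_mod_dvd; apply/eqP.
by have := congr1 Posz e; rewrite !gez0_abs ?modz_ge0.
Qed.

(** By [lattice_coord] the class of u modulo M is determined by m tr u and tr (u z) modulo 2 m M.
    The estimate is crude, which is harmless once it is applied to powers. *)
Lemma transversal_nat I (M : nat) : (0 < M)%N -> I M%:R ->
  exists2 s, transversal I s & (size s <= (2 * m * M) ^ 2)%N.
Proof.
move=> M0 IM; have m0 := qo_m qo; set k := (2 * m * M)%N.
have k0 : (0 < k)%N by rewrite /k; lia.
pose f u := (residue k (m%:Z * tr u), residue k (tr (u * z))).
have [|s ts ss] := transversal_inject (k := f) (idlP I); last first.
  by exists s => //; move: ss; rewrite card_prod !card_ord prednK.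
move=> u v [/(residue_eq k0) /dvdzP[a ea] /(residue_eq k0) /dvdzP[b eb]].
have e1 := lattice_coord qo u; have e2 := lattice_coord qo v.
have : (2 * m)%:R * (u - v) = (2 * m)%:R * ((a%:~R - b%:~R * z) * M%:R).
  rewrite mulrBr e1 e2.
  transitivity ((m%:Z * tr u - m%:Z * tr v)%:~R - (tr (u * z) - tr (v * z))%:~R * z).
    by rewrite !rmorphB /=; ring.
  by rewrite ea eb /k !intrM -!pmulrn !natrM; ring.
move/qo_mulfI => -> //; first by apply: is_idealM (idlP I) _.
by rewrite pmulrn qo_int_neq0 //; lia.
Qed.

Lemma transversal_exists I : nonzero_idl I -> exists s, transversal I s.
Proof.
move=> [u Iu u0]; have [||s ts _] := @transversal_nat I (D u); [exact: qo_D_gt0 | | by exists s].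
by rewrite -D_natE mulrC; apply: is_idealM (idlP I) _.
Qed.

Lemma principal_ideal u : is_ideal (principal u).
Proof.
split; first by exists 0; rewrite ?mul0r.
by move=> a _ _ [v _ <-] [w _ <-]; exists (a * v + w) => //; rewrite mulrDl mulrA.
Qed.

Definition pidl u : idl R := Idl (principal_ideal u).

Lemma pidlP u v : pidl u v <-> exists r, v = u * r.
Proof. by split=> [[r _ <-]|[r ->]]; exists r => //; rewrite mulrC. Qed.

Lemma transversal_mul u v s t : u != 0 -> transversal (pidl u) s -> transversal (pidl v) t ->
  transversal (pidl (u * v)) [seq a + u * b | a <- s, b <- t].
Proof.
move=> u0 [us h1 h2] [ut k1 k2]; have inj a b a' b' : a \in s -> a' \in s -> b \in t -> b' \in t ->
    pidl (u * v) (a + u * b - (a' + u * b')) -> a = a' /\ b = b'.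
  move=> sa sa' tb tb' /pidlP[r er].
  have ea : a = a'.
    apply: h2 => //; apply/pidlP; exists (v * r - b + b').
    have -> : a - a' = (a + u * b - (a' + u * b')) - u * b + u * b' by ring.
    by rewrite er; ring.
  subst a'; split=> //; apply: k2 => //; apply/pidlP; exists r; apply: (qo_mulfI u0).
  by rewrite mulrA -er; ring.
split.
- apply: allpairs_uniq => // -[a b] [a' b'] /allpairsP[[a1 b1] /= [sa tb [-> ->]]].
  move=> /allpairsP[[a2 b2] /= [sa' tb' [-> ->]]] e.
  have [|-> ->] // := inj _ _ _ _ sa sa' tb tb'.
  by rewrite e subrr; apply: is_ideal0 (idlP (pidl _)).
- move=> w; have [a sa /pidlP[c ec]] := h1 w; have [b tb /pidlP[c' ec']] := k1 c.
  exists (a + u * b); first by apply/allpairsP; exists (a, b).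
  apply/pidlP; exists c'; rewrite -mulrA -ec'.
  by rewrite opprD addrA ec; ring.
move=> _ _ /allpairsP[[a b] /= [sa tb ->]] /allpairsP[[a' b'] /= [sa' tb' ->]].
by move=> /(inj _ _ _ _ sa sa' tb tb')[-> ->].
Qed.

Lemma transversal_sigma u s : transversal (pidl u) s -> transversal (pidl (sigma u)) (map sigma s).
Proof.
have sB := fun x y => etrans (qo_sigmaD qo x (- y)) (congr1 _ (sigmaN qo y)).
have inj := inv_inj (qo_sigmaK qo).
move=> [us h1 h2]; split; first by rewrite map_inj_uniq.
  move=> w; have [a sa /pidlP[c ec]] := h1 (sigma w); exists (sigma a); first exact: map_f.
  apply/pidlP; exists (sigma c); rewrite -(qo_sigmaM qo) -ec sB (qo_sigmaK qo) //.
move=> _ _ /mapP[a sa ->] /mapP[b sb ->]; rewrite -sB => /pidlP[c ec]; congr sigma.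
apply: h2 => //; apply/pidlP; exists (sigma c); apply: inj.
by rewrite ec (qo_sigmaM qo) (qo_sigmaK qo).
Qed.

Lemma transversal_pow u s j : u != 0 -> transversal (pidl u) s ->
  exists2 t, transversal (pidl (u ^+ j)) t & size t = (size s ^ j)%N.
Proof.
move=> u0 ts; elim: j => [|j [t tt st]].
  exists [:: 0] => //; split=> // [w|a b]; first by exists 0; rewrite ?inE //; apply/pidlP; exists w; rewrite mul1r subr0.
  by rewrite !inE => /eqP-> /eqP->.
by exists [seq a + u * b | a <- s, b <- t]; rewrite ?size_allpairs ?st ?expnS // exprS; apply: transversal_mul.
Qed.

(** The crude bound for M^j against the exact index (size s)^j: the constant (2 m)^2 does not depend
    on j and is absorbed. *)
Lemma transversal_nat_size (M : nat) s : (0 < M)%N -> transversal (pidl M%:R) s ->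
  (size s <= M ^ 2)%N.
Proof.
move=> M0 ts; apply: (@leq_of_powers ((2 * m) ^ 2)) => j.
have Mn : M%:R != 0 :> R by rewrite pmulrn qo_int_neq0 //; lia.
have [t tt <-] := transversal_pow j Mn ts.
rewrite -natrX in tt; have [||t' tt' st'] := @transversal_nat (pidl (M ^ j)%:R) (M ^ j).
- by rewrite expn_gt0 M0.
- by apply/pidlP; exists 1; rewrite mulr1.
apply: leq_trans (transversal_size (idlP _) tt tt') _; apply: leq_trans st' _.
by rewrite expnMn -!expnM [(j * 2)%N]mulnC.
Qed.

(** u and its conjugate have the same index, and their product is the integer D u, whose index is at
    most (D u)^2. *)
Lemma principal_index_le u s : u != 0 -> transversal (pidl u) s -> (size s <= D u)%N.
Proof.
move=> u0 ts; have := transversal_mul u0 ts (transversal_sigma ts).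
rewrite D_natE => /(transversal_nat_size (qo_D_gt0 u0)).
by rewrite size_allpairs size_map mulnn leq_sqr.
Qed.

Definition prime_idl p := prime_ideal p /\ nonzero_idl p.

(** R / p is a finite domain: two powers v^i and v^j with i < j agree modulo p, and v^i can be
    cancelled. *)
Lemma prime_idl_maximal p v : prime_idl p -> ~ p v -> exists r, p (1 - r * v).
Proof.
move=> [[ip p1 pm] pn] pv; have [s [us h1 h2]] := transversal_exists pn.
have hx u : exists w, w \in s /\ p (u - w) by have [w] := h1 u; exists w.
have [f hf] := choice hx.
pose g (i : 'I_(size s).+1) := f (v ^+ i).
have : ~ injective g.
  move=> gi; have : (size (codom g) <= size s)%N.
    apply: uniq_leq_size; first exact/injectiveP.
    by move=> _ /codomP[i ->]; apply: (hf _).1.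
  by rewrite size_codom card_ord ltnn.
move=> ni; have [i [j [ij e]]] : exists i j : 'I_(size s).+1, (i < j)%N /\ g i = g j.
  apply: contrapT => no; apply: ni => i j e; apply: val_inj => /=.
  by case: (ltngtP i j) => // lt; case: no; [exists i, j | exists j, i].
have pij : p (v ^+ i * (1 - v ^+ (j - i))).
  rewrite mulrBr mulr1 -exprD subnKC 1?ltnW //.
  have -> : v ^+ i - v ^+ j = (v ^+ i - g i) - (v ^+ j - g j) by rewrite e; ring.
  by apply: is_idealB => //; apply: (hf _).2.
have pvi k : ~ p (v ^+ k).
  by elim: k => [|k IH]; rewrite ?expr0 // exprS => /pm[].
case/pm: pij => [/pvi //|]; rewrite -[(j - i)%N]prednK ?subn_gt0 // exprSr.
by exists (v ^+ (j - i).-1).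
Qed.

(* I = (x) + pI, and eps is 1 modulo p and maps I into (x): this replaces the
   localization at p, where x generates I. *)
Lemma idl_step I p : nonzero_idl I -> prime_idl p -> exists x eps,
  [/\ I x, x != 0, forall i, I i -> exists r, eps * i = x * r, p (1 - eps) &
      forall r, idl_mul p I (x * r) -> p r].
Proof.
move=> nI pp; have [[ip p1 pm] pn] := pp; have [J [c [c0 hJ [s [hs ec]]]]] := idl_inverse nI.
have red u j : idl_mul p I u -> J j -> exists2 v, p v & u * j = c * v.
  move=> pu Jj; move: u pu.
  suff : idl_mul p I `<=` [set u | exists2 v, p v & u * j = c * v] by move=> h u /h.
  apply: ideal_mul_sub.
    split; first by exists 0; rewrite ?mul0r ?mulr0 //; apply: is_ideal0.
    move=> a u w [v pv ev] [v' pv' ev']; exists (a * v + v'); first by apply: is_idealD => //; apply: is_idealM.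
    by rewrite mulrDl -mulrA ev ev'; ring.
  move=> u i pu Ii; have [r er] := hJ _ _ Ii Jj; exists (u * r).
    by rewrite mulrC; apply: is_idealM.
  by rewrite -mulrA er; ring.
(* If I were contained in p I, multiplying by J would give c in p c, hence 1 in p. *)
have [x [Ix nx]] : exists x, I x /\ ~ idl_mul p I x.
  apply: contrapT => no; apply: p1.
  suff [v pv ev] : exists2 v, p v & c = c * v.
    by have <- : v = 1 by apply: (qo_mulfI c0); rewrite /= mulr1.
  have {}hs q : q \in s -> exists2 v, p v & q.1 * q.2 = c * v.
    move=> qs; have [Iq Jq] := hs _ qs; apply: red => //.
    by apply: contrapT => n; apply: no; exists q.1.
  have : is_ideal [set u | exists2 v, p v & u = c * v].
    split; first by exists 0; rewrite ?mulr0 //; apply: is_ideal0.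
    move=> a _ _ [v pv ->] [v' pv' ->]; exists (a * v + v'); last by ring.
    by apply: is_idealD => //; apply: is_idealM.
  by move=> iC; rewrite {1}ec; apply: is_ideal_sum iC _ => q /hs.
(* If x j / c were in p for all j in J, writing c as a sum of products from I and J would put x in p
   I. *)
have [j [Jj [v ev nv]]] : exists j, J j /\ exists2 v, x * j = c * v & ~ p v.
  apply: contrapT => no; apply: nx.
  have hv q : q \in s -> exists2 v, p v & x * q.2 = c * v.
    move=> qs; have [Iq Jq] := hs _ qs; have [v ev] := hJ _ _ Ix Jq.
    by exists v => //; apply: contrapT => nv; apply: no; exists q.2; split=> //; exists v.
  have iC : is_ideal [set u | exists2 w, idl_mul p I w & u = c * w].
    have iPI := idlP (idl_mul p I); split; first by exists 0; rewrite ?mulr0 //; apply: is_ideal0.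
    move=> a _ _ [w pw ->] [w' pw' ->]; exists (a * w + w'); last by ring.
    by apply: is_idealD => //; apply: is_idealM.
  suff [w pw ew] : exists2 w, idl_mul p I w & x * c = c * w.
    by have -> : x = w by apply: (qo_mulfI c0); rewrite /= mulrC.
  rewrite {1}ec mulr_sumr.
  have mem q : q \in s -> [set u | exists2 w, idl_mul p I w & u = c * w] (x * (q.1 * q.2)).
    move=> qs; have [v pv ev] := hv _ qs; exists (v * q.1); last by rewrite mulrCA ev; ring.
    by apply: ideal_mul_mem => //; have [] := hs _ qs.
  exact: (is_ideal_sum iC mem).
have [r0 pr0] := prime_idl_maximal pp nv.
(* Thus eps is r0 x j / c, where r0 inverts v = x j / c modulo p. *)
exists x, (r0 * v); split=> //.
- by apply/eqP => x0; apply: nx; rewrite x0; apply: is_ideal0 (idlP (idl_mul p I)).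
- move=> i Ii; have [r er] := hJ _ _ Ii Jj; exists (r0 * r); apply: (qo_mulfI c0) => /=.
  transitivity (r0 * (x * j) * i); first by rewrite ev; ring.
  by transitivity (r0 * x * (i * j)); [ring | rewrite er; ring].
move=> r /red/(_ Jj)[v' pv' ev'].
have pvr : p (v * r).
  suff -> : v * r = v' by [].
  by apply: (qo_mulfI c0); rewrite /= -ev' mulrA -ev; ring.
have -> : r = r0 * (v * r) + r * (1 - r0 * v) by ring.
exact: (is_idealD ip (is_idealM _ ip pvr) (is_idealM _ ip pr0)).
Qed.

End Dedekind.

(** * Torsion in a divisible module *)

Lemma prod_leq_eq (T : eqType) (s : seq T) (E N : T -> nat) :
  (forall x, x \in s -> E x <= N x)%N -> (forall x, x \in s -> 0 < N x)%N ->
  (\prod_(x <- s) N x <= \prod_(x <- s) E x)%N -> forall x, x \in s -> E x = N x.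
Proof.
elim: s => [|x s IH] // EN N0; rewrite !big_cons => le.
have EN' y : y \in s -> (E y <= N y)%N by move=> ys; apply: EN; rewrite inE ys orbT.
have N0' y : y \in s -> (0 < N y)%N by move=> ys; apply: N0; rewrite inE ys orbT.
have PE : (\prod_(y <- s) E y <= \prod_(y <- s) N y)%N.
  by rewrite big_seq [leqRHS]big_seq; apply: leq_prod.
have PN : (0 < \prod_(y <- s) N y)%N by rewrite big_seq prodn_cond_gt0.
have Ex := EN x (mem_head _ _); have Nx := N0 x (mem_head _ _).
have ex : E x = N x.
  apply/eqP; rewrite eqn_leq Ex leqNgt; apply/negP => lt.
  by move: le; rewrite leqNgt => /negP; apply; nia.
move=> y; rewrite inE => /predU1P[->//|]; apply: IH => //.
by move: le; rewrite ex leq_mul2l eqn0Ngt Nx.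
Qed.

Section TorsionCount.
Variables (R : comNzRingType) (sigma : R -> R) (tr nm : R -> int) (z : R) (m : nat).
Hypothesis qo : quadratic_order sigma tr nm z m.
Variable D : R -> nat.
Hypotheses (D0 : D 0 = 0%N) (D1 : D 1 = 1%N) (DN : forall u, D (- u) = D u).
Hypothesis DM : forall u v, D (u * v) = (D u * D v)%N.
Hypothesis D_par : forall u v, (D (u + v) + D (u - v) = 2 * D u + 2 * D v)%N.
Variable M : lmodType R.
Hypothesis divisible : forall (u : R) (y : M), u != 0 -> exists x, u *: x = y.
Hypothesis ker_bound : forall (u : R) (s : seq M), u != 0 -> uniq s ->
  (forall x, x \in s -> u *: x = 0) -> (size s <= D u)%N.
Implicit Types (u v w r : R) (I p : idl R) (x y : M).

Definition ann (I : set R) : set M := [set x | forall u, I u -> u *: x = 0].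

Lemma annB (I : set R) x y : ann I x -> ann I y -> ann I (x - y).
Proof. by move=> hx hy u Iu; rewrite scalerBr hx // hy // subrr. Qed.

Lemma annD (I : set R) x y : ann I x -> ann I y -> ann I (x + y).
Proof. by move=> hx hy u Iu; rewrite scalerDr hx // hy // addr0. Qed.

Lemma ann_pidl u x : ann (pidl u) x <-> u *: x = 0.
Proof.
split=> [h|e v /pidlP[r ->]]; last by rewrite mulrC -scalerA e scaler0.
by apply: h; apply/pidlP; exists 1; rewrite mulr1.
Qed.

Lemma ann_enumerates I : nonzero_idl I -> exists s, enumerates s (ann I).
Proof.
move=> [u Iu u0]; have [|s es _] := @enumerate_bounded M (ann I) (D u); last by exists s.
by move=> s us h; apply: (ker_bound u0 us) => x /h; apply.
Qed.

Lemma nonzero_idl_mul I p : nonzero_idl I -> nonzero_idl p -> nonzero_idl (idl_mul p I).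
Proof.
move=> [u Iu u0] [v pv v0]; exists (v * u); first exact: ideal_mul_mem.
exact: (qo_mulf_neq0 qo).
Qed.

(** The elements x b, with b running through R / p, represent I / p I: [eps] gives I = (x) + p I,
    and x r in p I forces r in p. *)
Lemma transversal_step I p s t : nonzero_idl I -> prime_idl p ->
  transversal I s -> transversal p t ->
  exists2 w, transversal (idl_mul p I) w & size w = (size t * size s)%N.
Proof.
move=> nI pp [us h1 h2] [ut k1 k2].
have [x [eps [Ix x0 hx peps red]]] := idl_step qo D0 D1 DN DM D_par nI pp.
have iPI := idlP (idl_mul p I).
have inj a b a' b' : a \in s -> a' \in s -> b \in t -> b' \in t ->
    idl_mul p I (a + x * b - (a' + x * b')) -> a = a' /\ b = b'.
  move=> sa sa' tb tb' h.
  have ea : a = a'.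
    apply: h2 => //; have -> : a - a' = (a + x * b - (a' + x * b')) + (b' - b) * x by ring.
    apply: (is_idealD (idlP I)); last exact: is_idealM (idlP I) Ix.
    by rewrite idl_mulC in h; apply: (idl_mul_subl h).
  subst a'; split=> //; apply: k2 => //; apply: red.
  by have -> : x * (b - b') = a + x * b - (a + x * b') by ring.
exists [seq a + x * b | a <- s, b <- t]; last by rewrite size_allpairs mulnC.
split.
- apply: allpairs_uniq => // -[a b] [a' b'] /allpairsP[[a1 b1] /= [sa tb [-> ->]]].
  move=> /allpairsP[[a2 b2] /= [sa' tb' [-> ->]]] e.
  have [|-> ->] // := inj _ _ _ _ sa sa' tb tb'.
  by rewrite e subrr; apply: is_ideal0 iPI.
- move=> w; have [a sa Iwa] := h1 w; have [c ec] := hx _ Iwa; have [b tb pcb] := k1 c.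
  exists (a + x * b); first by apply/allpairsP; exists (a, b).
  have -> : w - (a + x * b) = (1 - eps) * (w - a) + (eps * (w - a) - x * c) + (c - b) * x by ring.
  rewrite ec subrr addr0; apply: is_idealD => //; exact: ideal_mul_mem.
move=> _ _ /allpairsP[[a b] /= [sa tb ->]] /allpairsP[[a' b'] /= [sa' tb' ->]].
by move=> /(inj _ _ _ _ sa sa' tb tb')[-> ->].
Qed.

(** Multiplication by x maps the p I-torsion onto the p-torsion with kernel the I-torsion. A
    preimage y' supplied by divisibility is corrected to eps y', which p I annihilates. *)
Lemma ann_step I p s t : nonzero_idl I -> prime_idl p ->
  enumerates s (ann I) -> enumerates t (ann p) ->
  exists2 w, enumerates w (ann (idl_mul p I)) & size w = (size t * size s)%N.
Proof.
move=> nI pp [us hs] [ut ht].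
have [x [eps [Ix x0 hx peps red]]] := idl_step qo D0 D1 DN DM D_par nI pp.
have hy (y : M) : exists y', ann p y -> ann (idl_mul p I) y' /\ x *: y' = y.
  have [py|npy] := pselect (ann p y); last by exists 0.
  have [y' ey] := divisible y x0; exists (eps *: y') => _; split; last first.
    rewrite scalerA mulrC -scalerA ey; apply/eqP; rewrite eq_sym -subr_eq0.
    by rewrite -{1}[y]scale1r -scalerBl py.
  move=> u; rewrite scalerA; move: u.
  suff : idl_mul p I `<=` [set u | (u * eps) *: y' = 0] by move=> h u /h.
  apply: ideal_mul_sub.
    split; first by rewrite /= mul0r scale0r.
    by move=> a u v /= eu ev; rewrite mulrDl scalerDl ev -mulrA -scalerA eu scaler0 addr0.
  move=> u i pu Ii /=; have [r er] := hx _ Ii.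
  by rewrite -mulrA [i * _]mulrC er mulrCA mulrC -scalerA ey mulrC -scalerA py ?scaler0 //.
have [f hf] := choice hy.
have sub y : ann I y -> ann (idl_mul p I) y.
  by move=> h u; rewrite idl_mulC => /idl_mul_subl; apply: h.
have xann y : ann (idl_mul p I) y -> ann p (x *: y).
  by move=> h u pu; rewrite scalerA h //; apply: ideal_mul_mem.
exists [seq f a + b | a <- t, b <- s]; last by rewrite size_allpairs.
split.
  apply: allpairs_uniq => // -[a b] [a' b'] /allpairsP[[a1 b1] /= [ta sb [-> ->]]].
  move=> /allpairsP[[a2 b2] /= [ta' sb' [-> ->]]] e.
  have [_ e1] := hf _ ((ht _).1 ta); have [_ e2] := hf _ ((ht _).1 ta').
  have ea : a1 = a2.
    have := congr1 (fun y => x *: y) e; rewrite /= !scalerDr e1 e2.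
    by rewrite ((hs _).1 sb _ Ix) ((hs _).1 sb' _ Ix) !addr0.
  by move: e; rewrite ea => /addrI ->.
move=> y; split=> [/allpairsP[[a b] /= [ta sb ->]]|hy'].
  by apply: annD; [have [] := hf _ ((ht _).1 ta) | apply: sub; apply/hs].
have pxy := xann _ hy'; have [fa ea] := hf _ pxy.
apply/allpairsP; exists (x *: y, y - f (x *: y)); split; rewrite /= ?subrKC //.
  exact/ht.
apply/hs => i Ii; have [r er] := hx _ Ii.
have -> : i = eps * i + (1 - eps) * i by ring.
have h0 := annB hy' fa; rewrite scalerDl (h0 ((1 - eps) * i)) ?addr0; last exact: ideal_mul_mem.
by rewrite er mulrC -scalerA scalerBr ea subrr scaler0.
Qed.

Definition iprod (ps : seq (idl R)) : idl R := \big[@idl_mul R/@idl_one R]_(p <- ps) p.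

Definition ann_card (I : set R) : nat := set_card (ann I).

Lemma iprod_count (ps : seq (idl R)) : (forall p, p \in ps -> prime_idl p) ->
  [/\ nonzero_idl (iprod ps),
   exists2 s, transversal (iprod ps) s & size s = (\prod_(p <- ps) ideal_norm p)%N &
   exists2 t, enumerates t (ann (iprod ps)) & size t = (\prod_(p <- ps) ann_card p)%N].
Proof.
rewrite /iprod; elim: ps => [|p ps IH] pr.
  rewrite !big_nil; split; first by exists 1; rewrite ?oner_neq0.
    exists [:: 0] => //; split=> // [u|u v]; first by exists 0; rewrite ?inE.
    by rewrite !inE => /eqP-> /eqP->.
  exists [:: 0] => //; split=> // x; rewrite inE; split=> [/eqP-> u _|h]; first by rewrite scaler0.
  by rewrite -[x]scale1r h.
have [|nI [s ts es] [t et est]] := IH.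
  by move=> q qs; apply: pr; rewrite inE qs orbT.
have pp := pr p (mem_head _ _); rewrite !big_cons; split.
- by apply: nonzero_idl_mul => //; case: pp.
- have [s' ts'] := transversal_exists qo D0 D1 DN DM D_par pp.2.
  have [w tw ew] := transversal_step nI pp ts ts'; exists w => //.
  by rewrite ew es (ideal_norm_transversal (idlP p) ts').
have [t' et'] := ann_enumerates pp.2; have [w tw ew] := ann_step nI pp et et'.
by exists w => //; rewrite ew est /ann_card (set_card_enumerates et').
Qed.

(** Pigeonhole on the (b + 1)^2 elements i + j z with 0 <= i, j <= b, where b is the integer square
    root of the index: two of them are congruent, and their difference has norm at most (1 + m)
    b^2. *)
Lemma small_element I s : nonzero_idl I -> transversal I s ->
  exists u, [/\ I u, u != 0 & (D u <= (1 + m) * size s)%N].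
Proof.
move=> nI [us h1 h2].
have [b [b1 b2]] : exists b, (b ^ 2 <= size s)%N /\ (size s < b.+1 ^ 2)%N.
  elim: (size s) => [|k [b [b1 b2]]]; first by exists 0%N.
  case: (ltnP k.+1 (b.+1 ^ 2)) => h; first by exists b; split=> //; apply: leq_trans b1 _.
  by exists b.+1; split=> //; apply: leq_ltn_trans b2 _; rewrite ltn_sqr.
have hx u : exists w, w \in s /\ I (u - w) by have [w] := h1 u; exists w.
have [f hf] := choice hx.
pose e (i : 'I_b.+1 * 'I_b.+1) : R := (i.1 : nat)%:Z%:~R + (i.2 : nat)%:Z%:~R * z.
have : ~ injective (fun i => f (e i)).
  move=> gi; have : (size (codom (fun i => f (e i))) <= size s)%N.
    apply: uniq_leq_size; first exact/injectiveP.
    by move=> _ /codomP[i ->]; apply: (hf _).1.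
  by rewrite size_codom card_prod !card_ord leqNgt b2.
move=> ni; have [i [j [ij eij]]] : exists i j, i != j /\ f (e i) = f (e j).
  apply: contrapT => no; apply: ni => i j eij; apply/eqP; apply: contrapT => /negP ij.
  by apply: no; exists i, j.
pose x : int := (i.1 : nat)%:Z - (j.1 : nat)%:Z; pose y : int := (i.2 : nat)%:Z - (j.2 : nat)%:Z.
have eu : e i - e j = x%:~R + y%:~R * z by rewrite /e /x /y !rmorphB /=; ring.
have du := degree_lattice qo D0 D1 DN DM D_par x y; rewrite -eu in du.
have m0 := qo_m qo.
have xy0 : (x != 0) || (y != 0).
  apply: contraT; rewrite negb_or !negbK !subr_eq0 !eqz_nat => /andP[/eqP e1 /eqP e2].
  move: ij; rewrite [i]surjective_pairing [j]surjective_pairing.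
  by rewrite (val_inj e1) (val_inj e2) eqxx.
exists (e i - e j); split.
- have -> : e i - e j = (e i - f (e i)) - (e j - f (e j)) by rewrite eij; ring.
  by apply: (is_idealB (idlP I)); apply: (hf _).2.
- apply/eqP => u0; move: du; rewrite u0 D0 => du.
  by case/orP: xy0 => /eqP; apply; nia.
have bi (k : 'I_b.+1) : (k <= b)%N by rewrite -ltnS.
have := bi i.1; have := bi i.2; have := bi j.1; have := bi j.2.
rewrite /x /y in du; move: (nat_of_ord i.1) (nat_of_ord i.2) (nat_of_ord j.1) (nat_of_ord j.2) du.
move=> i1 i2 j1 j2 du l4 l3 l2 l1; apply: leq_trans (_ : (1 + m) * b ^ 2 <= _)%N; last by rewrite leq_mul2l b1 orbT.
rewrite -lez_nat du.
have hxb : (i1%:Z - j1%:Z) ^+ 2 <= (b ^ 2)%N%:Z by nia.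
have hyb : (i2%:Z - j2%:Z) ^+ 2 <= (b ^ 2)%N%:Z by nia.
by nia.
Qed.

(* A power of p contains an element of norm at most a constant times the index;
   passing to high powers absorbs the constant. *)
Lemma ann_card_le_norm p : prime_idl p -> (ann_card p <= ideal_norm p)%N.
Proof.
move=> pp; apply: (@leq_of_powers (1 + m)) => j.
have pr q : q \in nseq j p -> prime_idl q by move=> /nseqP[->].
have [nI [s ts es] [t [ut ht] et]] := iprod_count pr.
have [u [Iu u0 Du]] := small_element nI ts.
have prodE (F : set R -> nat) : (\prod_(q <- nseq j p) F q = F p ^ j)%N.
  by rewrite big_nseq iter_muln_1.
rewrite (prodE ann_card) in et; rewrite (prodE (@ideal_norm R)) in es.
rewrite -et -es; apply: leq_trans Du; apply: (ker_bound u0 ut) => x /ht; exact.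
Qed.

(** The product of the norms is the index of (delta), which is at most D delta, hence at most the
    size of [ks], hence at most the size of the delta-torsion, which is the product of the sizes of
    the p-torsions. As each of these is at most the norm of p, all are equal to it. *)
Lemma torsion_count (delta : R) (ps : seq (idl R)) (ks : seq M) : delta != 0 ->
  (forall p, p \in ps -> prime_idl p) -> pidl delta = iprod ps ->
  uniq ks -> (forall x, x \in ks -> delta *: x = 0) -> (D delta <= size ks)%N ->
  forall qs : seq (idl R), (forall q, q \in qs -> q \in ps) ->
  ideal_norm (iprod qs) = (\prod_(q <- qs) ideal_norm q)%N /\
  exists2 t, enumerates t (ann (iprod qs)) & size t = (\prod_(q <- qs) ideal_norm q)%N.
Proof.
move=> d0 pr ed uks hks Dks; have [_ [s ts es] [t [ut ht] et]] := iprod_count pr.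
have N0 p : p \in ps -> (0 < ideal_norm p)%N.
  move=> /pr[_ np]; have [r tr'] := transversal_exists qo D0 D1 DN DM D_par np.
  rewrite (ideal_norm_transversal (idlP p) tr'); case: tr' => _ h _.
  by have [v] := h 0; case: r {h}.
have le : (\prod_(p <- ps) ideal_norm p <= \prod_(p <- ps) ann_card p)%N.
  rewrite -es -et; rewrite -ed in ts ht.
  apply: leq_trans (principal_index_le qo D0 D1 DN DM D_par d0 ts) _.
  apply: leq_trans Dks _; apply: uniq_leq_size => // x /hks e.
  by apply/ht/ann_pidl.
have EN := prod_leq_eq (fun p h => ann_card_le_norm (pr p h)) N0 le.
move=> qs hqs; have [_ [s' ts' es'] [t' et' est']] := iprod_count (fun q h => pr q (hqs q h)).
split; first by rewrite (ideal_norm_transversal (idlP _) ts').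
exists t' => //; rewrite est' big_seq [RHS]big_seq; apply: eq_bigr => q /hqs; exact: EN.
Qed.

End TorsionCount.

(** * The action on abscissas *)

Section Exactness.
Variables (K : closedFieldType) (E : ecurve K).
Local Notation pt := (curve_point E).
Implicit Types (P Q T : pt) (x y : K).

Lemma ae_double_neq Q : ae (fun T : pt => T + T <> Q).
Proof.
have [[T0 e0]|h] := pselect (exists T0, T0 + T0 = Q); last first.
  by apply: aeT => P e; apply: h; exists P.
apply: ae_imp (ae_shift (- T0) (ae_double E)) => T /eqP n e; apply: n.
by rewrite addrACA e -e0 -opprD addNr.
Qed.

Lemma sum_homog (k : nat) (p : {poly K}) (N D : K) : (size p <= k)%N -> D != 0 ->
  \sum_(i < k) p`_i * (N ^+ i * D ^+ (k.-1 - i)) = D ^+ k.-1 * p.[N / D].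
Proof.
move=> sp D0; have := @homogE K k p N%:P D%:P 0 sp; rewrite !hornerC => <- //.
rewrite horner_sum; apply: eq_bigr => i _.
by rewrite hornerZ hornerM !horner_exp !hornerC.
Qed.

Variables (g : pt -> pt) (a b c w : {poly K}).
Hypotheses (ig : isogeny g) (cab : coprimep a b) (b0 : b != 0) (w0 : w != 0).
Hypothesis form : forall P x y, coords P = Some (x, y) -> b.[x] != 0 -> w.[x] != 0 ->
  coords (g P) = Some (a.[x] / b.[x], y * (c.[x] / w.[x])).

(* The addition formula for x(P + T), as a quotient of regular functions of P,
   keeps a meaning where the denominator vanishes; comparing the two
   expressions of x(g(P + T)) near P = P0 - T gives the value at P0. *)
Lemma isog_xc_exact P : xc (g P) =
  if xc P is Some x then if b.[x] == 0 then None else Some (a.[x] / b.[x]) else None.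
Proof.
case eP : (xc P) => [x0|]; last by rewrite (xc_None eP) (isog0 ig).
have bw0 : b * w != 0 by rewrite mulf_neq0.
have genbw := ae_poly E bw0.
have P0 : P <> 0 by move=> e; rewrite e in eP.
(* Both T and P - T avoid the zeros of b and w. The condition 2 g T <> g P excludes P - T = T and g
   (P - T) = g T, so that no tangent formula is ever needed. *)
have [T [[[xT [yT eT]] gT] [[[x1 [y1 e1]] g1] [ndbl aff]]]] :
    exists T, ((exists x y, coords T = Some (x, y)) /\
               (forall x, xc T = Some x -> (b * w).[x] != 0)) /\
      (((exists x y, coords (P - T) = Some (x, y)) /\
        (forall x, xc (P - T) = Some x -> (b * w).[x] != 0)) /\
       (g T + g T <> g P /\ True)).
  have af := ae_and (ae_affine E) genbw.
  have [T [h1 [h2 h3]]] := ae_ex (ae_and af (ae_and (ae_opp (ae_shift P af)) (ae_pull ig (ae_double_neq (g P))))).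
  by exists T.
have := gT _ (xc_coords eT); rewrite hornerM mulf_eq0 negb_or => /andP[bT wT].
have := g1 _ (xc_coords e1); rewrite hornerM mulf_eq0 negb_or => /andP[b1 w1].
have egT := form eT bT wT; have eg1 := form e1 b1 w1.
set Xt := a.[xT] / b.[xT] in egT; set Yt := yT * (c.[xT] / w.[xT]) in egT.
have n1T : x1 != xT.
  apply/eqP => e; have /xc_eq : xc (P - T) = xc T by rewrite (xc_coords eT) (xc_coords e1) e.
  case=> [e'|/(congr1 (+%R^~ T))]; last by rewrite subrK opp_ptE addNr.
  by apply: ndbl; rewrite -(isogD ig) -{1}e' subrK.
pose k := (rdeg a b).+1.
have [sa sb] : (size a <= k)%N /\ (size b <= k)%N.
  by rewrite /k -size_rdeg // leq_maxl leq_maxr.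
(* At a generic point P' = (x, y), [Nx] / [Dx] is the abscissa of P' + T and [N2] / [D2] that of g
   P' + g T, while [H p] is the value of p at the former, times the power k - 1 of [Dx]. *)
pose Nx (x y : K) := (y - yT) ^+ 2 - (a2 E + x + xT) * (x - xT) ^+ 2.
pose Dx (x y : K) := (x - xT) ^+ 2.
pose H (p : {poly K}) x y := \sum_(i < k) p`_i * (Nx x y ^+ i * Dx x y ^+ (k.-1 - i)).
pose D2 (x y : K) := w.[x] ^+ 2 * b.[x] * (a.[x] - Xt * b.[x]) ^+ 2.
pose N2 (x y : K) := b.[x] ^+ 3 * (y * c.[x] - Yt * w.[x]) ^+ 2
  - w.[x] ^+ 2 * (a2 E * b.[x] + a.[x] + Xt * b.[x]) * (a.[x] - Xt * b.[x]) ^+ 2.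
have rP p := regular_poly E p; have rC k' := regular_cst E k'.
have rx := regular_x E; have ry := regular_y E.
have rNx : regular E Nx.
  apply: regularB; first by apply: regularX; apply: regularB.
  apply: regularM; first by apply: regularD => //; apply: regularD.
  by apply: regularX; apply: regularB.
have rDx : regular E Dx by apply: regularX; apply: regularB.
have rH (p : {poly K}) : regular E (H p).
  apply: (@regular_sum _ E k (fun i x y => p`_i * (Nx x y ^+ i * Dx x y ^+ (k.-1 - i)))) => i.
  by apply: regularM => //; apply: regularM; apply: regularX.
have rab : regular E (fun x y => (a.[x] - Xt * b.[x]) ^+ 2).
  by apply: regularX; apply: regularB => //; apply: regularM.
have rD2 : regular E D2.
  apply: regularM => //; apply: regularM => //; exact: regularX.
have rN2 : regular E N2.
  apply: regularB.
    apply: regularM; first exact: regularX.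
    by apply: regularX; apply: regularB; apply: regularM.
  apply: regularM => //; apply: regularM; first exact: regularX.
  by apply: regularD; [apply: regularD => //; apply: regularM | apply: regularM].
have chordT x y P' : coords P' = Some (x, y) -> x != xT ->
    Dx x y != 0 /\ xc (P' + T) = Some (Nx x y / Dx x y).
  move=> e n; rewrite (xc_coords (coords_chord e eT n)).
  have n' : xT - x != 0 by rewrite subr_eq0 eq_sym.
  have n'' : x - xT != 0 by rewrite subr_eq0.
  split; first by rewrite expf_neq0.
  by congr Some; rewrite /Nx /Dx; field; rewrite n' n''.
have HE (p : {poly K}) x y : (size p <= k)%N -> Dx x y != 0 ->
    H p x y = Dx x y ^+ k.-1 * p.[Nx x y / Dx x y] by move=> *; apply: sum_homog.
have chordG x y P' : coords P' = Some (x, y) -> b.[x] != 0 -> w.[x] != 0 ->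
    a.[x] / b.[x] != Xt -> D2 x y != 0 /\ xc (g P' + g T) = Some (N2 x y / D2 x y).
  move=> e bx wx n; rewrite (xc_coords (coords_chord (form e bx wx) egT n)).
  have n0 : a.[x] - Xt * b.[x] != 0.
    by rewrite subr_eq0; apply: contra n => /eqP->; rewrite mulfK.
  have n1 : Xt - a.[x] / b.[x] != 0 by rewrite subr_eq0 eq_sym.
  split; first by rewrite !mulf_neq0 ?expf_neq0.
  congr Some; rewrite /N2 /D2.
  have n2 : Xt * b.[x] - a.[x] != 0 by rewrite -opprB oppr_eq0.
  by field; rewrite ?bx ?wx ?n0 ?n1 ?n2.
have key : forall x y, y ^+ 2 = (rhs E).[x] -> H a x y * D2 x y - H b x y * N2 x y = 0.
  have rkey : regular E (fun x y => H a x y * D2 x y - H b x y * N2 x y).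
    by apply: regularB; apply: regularM.
  apply: (regular_eq0 rkey).
  have A1 := ae_and (ae_xc E (Some xT)) genbw.
  have genS : ae (fun P' => forall x, xc (T + P') = Some x -> (b * w).[x] != 0).
    exact: ae_shift genbw.
  apply: ae_imp2 (ae_and A1 genS) (ae_pull ig (ae_xc E (Some Xt))) => P' [[n2 n3] n4] n5 x y e.
  have nxT : x != xT by apply/eqP => e'; apply: n2; rewrite (xc_coords e) e'.
  have := n3 _ (xc_coords e); rewrite hornerM mulf_eq0 negb_or => /andP[bx wx].
  have nX : a.[x] / b.[x] != Xt.
    by apply/eqP => e'; apply: n5; rewrite (xc_coords (form e bx wx)) e'.
  have [dx0 es] := chordT _ _ _ e nxT; have [d20 eg] := chordG _ _ _ e bx wx nX.
  have := n4 (Nx x y / Dx x y); rewrite addrC => /(_ es).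
  rewrite hornerM mulf_eq0 negb_or => /andP[bs ws].
  have [ys eys] := xcP es.
  have := xc_coords (form eys bs ws); rewrite (isogD ig) eg => -[/eqP].
  rewrite eqr_div // => /eqP e3.
  rewrite !HE //; set B := _ ^+ k.-1; set s := Nx x y / _.
  have -> : B * a.[s] * D2 x y - B * b.[s] * N2 x y = B * (a.[s] * D2 x y - N2 x y * b.[s]) by ring.
  by rewrite e3 subrr mulr0.
have [dx0 es] := chordT _ _ _ e1 n1T; rewrite subrK eP in es; case: es => ex0.
have /eqP := key _ _ (coordsP e1); rewrite !HE // -ex0 subr_eq0 -!mulrA => /eqP.
move/(mulfI (expf_neq0 k.-1 dx0)) => {}key.
have egP : g (P - T) + g T = g P by rewrite -(isogD ig) subrK.
have [eX|nX] := eqVneq (a.[x1] / b.[x1]) Xt; last first.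
  have [d20 eg] := chordG _ _ _ e1 b1 w1 nX; rewrite egP in eg.
  have [bx|bx] := eqVneq b.[x0] 0.
    move/eqP: key; rewrite bx mul0r mulf_eq0 (negPf d20) orbF => /eqP ax.
    by have := coprimep_common_root cab ax; rewrite bx eqxx.
  rewrite eg; congr Some; by apply/eqP; rewrite eqr_div // key mulrC.
(* In the degenerate case g P = 0, and x0 has to be a zero of b. The identity [key] yields this,
   since at P - T the denominator [D2] vanishes and the numerator [N2] does not. *)
have Q : g (P - T) = - g T.
  have /xc_eq[e|//] : xc (g (P - T)) = xc (g T) by rewrite (xc_coords eg1) (xc_coords egT) eX.
  by case: ndbl; rewrite -egP e.
have gP0 : g P = 0 by rewrite -egP Q addNr.
rewrite gP0 xc0; case: eqP => // bx; exfalso; apply: bx.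
have abX : a.[x1] - Xt * b.[x1] = 0 by rewrite -eX divfK // subrr.
have D20 : D2 x1 y1 = 0 by rewrite /D2 abX expr0n mulr0.
have N20 : N2 x1 y1 != 0.
  rewrite /N2 abX expr0n mulr0 subr0 mulf_neq0 ?expf_neq0 // subr_eq0.
  apply/eqP => e; apply: ndbl; rewrite gP0 -(addNr (g T)) -{1}Q; congr (_ + _).
  apply: coords_inj; rewrite eg1 egT eX; congr (Some (_, _)).
  by rewrite mulrA e mulfK.
by move/eqP: key; rewrite D20 mulr0 eq_sym mulf_eq0 (negPf N20) orbF => /eqP.
Qed.

End Exactness.

(** * Vanishing of the linear terms of the equation *)

Section LinearTerms.
Variables (K : closedFieldType) (W : weierstrass K).
Local Notation pt := (curve_point W).
Local Notation cubic := (cubic_part W).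
Local Notation lin := (linear_part W).
Implicit Types (P Q X Y : pt) (x y : K).

Lemma neg_on_curve P :
  on_curve W (if coords P is Some (x, y) then Some (x, - y - a1 W * x - a3 W) else None).
Proof.
case e : (coords P) => [[x y]|] //=.
have := weierstrass_eq e; rewrite linear_partE cubic_partE => e'; rewrite /on_affine -subr_eq0.
by apply/eqP; rewrite -(subrr (y ^+ 2 + (a1 W * x + a3 W) * y)) [X in _ = _ - X]e'; ring.
Qed.

Definition neg_pt P : pt := CurvePoint (neg_on_curve P).

Lemma coords_neg P x y : coords P = Some (x, y) ->
  coords (neg_pt P) = Some (x, - y - a1 W * x - a3 W).
Proof. by rewrite /neg_pt /= => ->. Qed.

Lemma add_neg P : addp P (neg_pt P) = infinity W.
Proof.
apply: coords_inj; rewrite -[LHS]/(add_coords W (coords P) (coords (neg_pt P))).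
case e : (coords P) => [[x y]|]; first by rewrite (coords_neg e) /= !eqxx.
by rewrite /neg_pt /= e.
Qed.

Lemma add_eq_infinity X Y : addp X Y = infinity W -> Y = neg_pt X.
Proof.
move=> /(congr1 (@coords K W)) /=; case eX : (coords X) => [[x1 y1]|]; last first.
  by move=> /= eY; apply: coords_inj; rewrite eY /= eX.
case eY : (coords Y) => [[x2 y2]|] //=; case: eqP => // e; case: eqP => // e' _.
by apply: coords_inj; rewrite (coords_neg eX) eY -e e'.
Qed.

(** Read off the tangent formula, since the group law is established only for curves without linear
    terms: X + X = X makes X its own negative, a case in which the sum is infinity. *)
Lemma add_self_eq X : addp X X = X -> X = infinity W.
Proof.
move=> /(congr1 (@coords K W)) /=; case eX : (coords X) => [[x y]|] /=; last by move=> _; apply: coords_inj.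
rewrite eqxx; case: eqP => // ny [e1 e2]; case: ny; move: e2; rewrite e1 subrr mulr0 add0r.
by move=> ->.
Qed.

Variables (R : comNzRingType) (phi : R -> pt -> pt).
Hypothesis phiA : forall u P Q, phi u (addp P Q) = addp (phi u P) (phi u Q).
Hypothesis phiD : forall u v P, phi (u + v) P = addp (phi u P) (phi v P).
Hypothesis phiM : forall u v P, phi (u * v) P = phi u (phi v P).
Hypothesis phi1 : forall P, phi 1 P = P.
Hypothesis phi_fin : forall u, u != 0 -> ae (fun P => phi u P <> infinity W).
Hypothesis dom : forall u v : R, u * v = 0 -> u = 0 \/ v = 0.
Hypothesis two0 : 2%:R != 0 :> R.

Lemma phi0 P : phi 0 P = infinity W.
Proof. by apply: add_self_eq; rewrite -phiD addr0. Qed.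

Lemma phi_infinity u : phi u (infinity W) = infinity W.
Proof. by apply: add_self_eq; rewrite -phiA; congr (phi u _); apply: coords_inj. Qed.

Lemma phi_negl u P : phi (- u) P = neg_pt (phi u P).
Proof. by apply: add_eq_infinity; rewrite -phiD subrr phi0. Qed.

Lemma phi_negr u P : phi u (neg_pt P) = neg_pt (phi u P).
Proof. by apply: add_eq_infinity; rewrite -phiA add_neg phi_infinity. Qed.

Lemma phi_sub_eq u v P : phi u P = phi v P -> phi (u - v) P = infinity W.
Proof. by move=> e; rewrite phiD phi_negl e add_neg. Qed.

Variables (alpha : R) (a b c w : {poly K}).
Hypotheses (b0 : b != 0) (w0 : w != 0) (alpha0 : alpha != 0).
Hypothesis nunit : forall v, v * alpha <> 1.
Hypothesis form : forall P x y, coords P = Some (x, y) -> b.[x] != 0 -> w.[x] != 0 ->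
  coords (phi alpha P) = Some (a.[x] / b.[x], y * (c.[x] / w.[x])).

(* If l = a1 x + a3 is not zero, then y / l is invariant under alpha, so that
   orbits of alpha have at most three points, and alpha is a root of unity. *)
Lemma linear_terms_eq0 : a1 W = 0 /\ a3 W = 0.
Proof.
have [l0|l0] := eqVneq lin 0.
  have e3 : a3 W = 0 by have := linear_partE W 0; rewrite l0 horner0 mulr0 add0r.
  by have := linear_partE W 1; rewrite l0 horner0 mulr1 e3 addr0.
exfalso.
have bw0 : b * w != 0 by rewrite mulf_neq0.
(* Comparing ordinates in alpha (-P) = - alpha P shows that a1 x + a3 is multiplied by the same
   factor as y; this is the invariance of y / (a1 x + a3). *)
have lina P x y : coords P = Some (x, y) -> b.[x] != 0 -> w.[x] != 0 ->
    lin.[a.[x] / b.[x]] = lin.[x] * (c.[x] / w.[x]).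
  move=> e bx wx; have := form (coords_neg e) bx wx.
  rewrite phi_negr (coords_neg (form e bx wx)) => -[] e'.
  by rewrite !linear_partE; apply/eqP; rewrite -subr_eq0 -oppr_eq0; move/eqP: e';
    rewrite -subr_eq0; congr (_ == _); ring.
(* If c = 0, then alpha P is its own negative for almost all P, so 2 alpha would kill almost all
   points. *)
have c0 : c != 0.
  apply: contraT; rewrite negbK => /eqP c0; exfalso.
  have : alpha + alpha != 0.
    rewrite -mulr2n -mulr_natl; apply/eqP => /dom[] /eqP; by apply/negP.
  move/phi_fin => h; have [P [n [x [y [e]]]]] := ae_ex (ae_and h (ae_affine_poly W bw0)).
  rewrite hornerM mulf_eq0 negb_or => /andP[bx wx]; apply: n.
  have eP := form e bx wx; have := lina _ _ _ e bx wx; rewrite linear_partE => el.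
  rewrite phiD; have {2}-> : phi alpha P = neg_pt (phi alpha P); last exact: add_neg.
  apply: coords_inj; rewrite (coords_neg eP) eP; congr (Some (_, _)).
  move: el; rewrite c0 horner0 mul0r !mulr0 oppr0 sub0r => el.
  by rewrite -opprD el oppr0.
pose gp := b * w * (c * lin).
have gp0 : gp != 0 by rewrite !mulf_neq0.
pose good P t := exists x y, [/\ coords P = Some (x, y), gp.[x] != 0 & y = t * lin.[x]].
have goodP P x y : coords P = Some (x, y) -> gp.[x] != 0 -> good P (y / lin.[x]).
  move=> e gx; exists x, y; split=> //; rewrite divfK //.
  by move: gx; rewrite !hornerM !mulf_eq0 !negb_or => /andP[_ /andP[]].
have step P t : good P t -> exists x y, [/\ coords (phi alpha P) = Some (x, y),
    lin.[x] != 0 & y = t * lin.[x]].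
  move=> [x [y [e gx ey]]]; move: gx; rewrite !hornerM !mulf_eq0 !negb_or.
  move=> /andP[/andP[bx wx] /andP[cx lx]].
  exists (a.[x] / b.[x]), (y * (c.[x] / w.[x])); split; first exact: form.
    by rewrite (lina _ _ _ e) // !mulf_neq0 ?invr_eq0.
  by rewrite (lina _ _ _ e) // ey mulrA.
(* Substituting y = t (a1 x + a3) into the equation of the curve gives this cubic for the abscissas
   of the points with invariant t. *)
pose fib t : {poly K} := cubic - (t ^+ 2 + t) *: lin ^+ 2.
have fibE P x y t : coords P = Some (x, y) -> y = t * lin.[x] -> root (fib t) x.
  move=> e ey; have := weierstrass_eq e; rewrite ey /root /fib hornerD hornerN hornerZ horner_exp => <-.
  by apply/eqP; ring.
have size_fib t : size (fib t) = 4%N.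
  set k := t ^+ 2 + t.
  rewrite -(size_cubic (a2 W - k * a1 W ^+ 2) (a4 W - k * 2%:R * a1 W * a3 W) (a6 W - k * a3 W ^+ 2)).
  congr (size (polyseq _)); rewrite /fib /cubic_part /linear_part -/k -!mul_polyC !(polyCD, polyCN, polyCM).
  by ring.
have fib0 t : fib t != 0 by rewrite -size_poly_gt0 size_fib.
have good_ae : ae (fun P => exists t, good P t).
  by apply: ae_imp (ae_affine_poly W gp0) => P [x [y [e gx]]]; exists (y / lin.[x]); apply: goodP.
have pull (A : pt -> Prop) : ae A -> ae (fun P => A (phi alpha P)).
  move=> [s hs]; have : ae (fun P => forall Q, Q \in s -> phi alpha P <> Q).
    apply: ae_all => Q _; case eQ : (coords Q) => [[X Y]|]; last first.
      apply: ae_imp good_ae => P [t /step[x [y [e _ _]]]] eq.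
      by move: e; rewrite eq eQ.
    apply: ae_imp (ae_and good_ae (ae_affine_poly W (fib0 (Y / lin.[X])))) => P.
    move=> [[t gt] [x [y [e fx]]]] eq; have [x' [y' []]] := step _ _ gt.
    rewrite eq eQ => -[<- <-] lX eY; move: gt => [x1 [y1 []]]; rewrite e => -[<- <-] _ ey.
    have := fibE _ _ _ _ e ey; have -> : t = Y / lin.[X] by rewrite eY mulfK.
    by rewrite /root (negPf fx).
  by apply: ae_imp => P h; apply: hs; apply/negP => /h.
(* A coincidence among 1, alpha, alpha^2, alpha^3 would make alpha a unit after cancelling a power
   of it. *)
pose pairs : seq (nat * nat) := [:: (0, 1); (0, 2); (0, 3); (1, 2); (1, 3); (2, 3)]%N.
have [[[i j] [ijp e]]|nopair] :=
    pselect (exists ij : nat * nat, ij \in pairs /\ alpha ^+ ij.2 = alpha ^+ ij.1).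
  have ij : (i < j)%N by move: ijp; rewrite !inE => /or4P[||| /or3P[]] /eqP[-> ->].
  have : alpha ^+ i * (alpha ^+ (j - i) - 1) = 0.
    by rewrite mulrBr mulr1 -exprD subnKC 1?ltnW // e subrr.
  have ai k : alpha ^+ k != 0.
    elim: k => [|k IH]; first by rewrite expr0 oner_neq0.
    by rewrite exprS; apply/eqP => /dom[] /eqP; apply/negP.
  case/dom => /eqP; first by rewrite (negPf (ai i)).
  rewrite subr_eq0 -[(j - i)%N]prednK ?subn_gt0 // exprSr => /eqP.
  exact: nunit.
(* Otherwise the first four points of a generic orbit are distinct. They share one invariant, so the
   ordinate is determined by the abscissa, and the cubic [fib] would have four distinct roots. *)
have distinct : ae (fun P => forall ij : nat * nat, ij \in pairs ->
    phi (alpha ^+ ij.2 - alpha ^+ ij.1) P <> infinity W).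
  apply: ae_all => ij ijp; apply: phi_fin; rewrite subr_eq0.
  by apply/eqP => e; apply: nopair; exists ij.
have G1 := pull _ good_ae; have G2 := pull _ G1; have G3 := pull _ G2.
have [P [nd [[t0 g0] [[t1 g1] [[t2 g2] [t3 g3]]]]]] :=
  ae_ex (ae_and distinct (ae_and good_ae (ae_and G1 (ae_and G2 G3)))).
have next Q t t' : good Q t -> good (phi alpha Q) t' -> t' = t.
  move=> /step[x [y [e lx ey]]] [x' [y' []]]; rewrite e => -[<- <-] _.
  by rewrite ey => /(mulIf lx).
have e1 := next _ _ _ g0 g1; have e2 := next _ _ _ g1 g2; have e3 := next _ _ _ g2 g3.
rewrite e3 e2 e1 in g3; rewrite e2 e1 in g2; rewrite e1 in g1.
move: g0 g1 g2 g3 => [x0 [y0 [c_0 _ ey0]]] [x1 [y1 [c_1 _ ey1]]] [x2 [y2 [c_2 _ ey2]]] [x3 [y3 [c_3 _ ey3]]].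
have ne i j Q Q' x y x' y' : (i, j) \in pairs -> phi (alpha ^+ i) P = Q -> phi (alpha ^+ j) P = Q' ->
    coords Q = Some (x, y) -> coords Q' = Some (x', y') -> y = t0 * lin.[x] -> y' = t0 * lin.[x'] ->
    x != x'.
  move=> ijp eQ eQ' cQ cQ' ey ey'; apply/eqP => ex; apply: (nd _ ijp); apply: phi_sub_eq.
  by rewrite eQ eQ'; apply: coords_inj; rewrite cQ cQ' ey ey' ex.
have p0 : phi (alpha ^+ 0) P = P by rewrite expr0 phi1.
have p1 : phi (alpha ^+ 1) P = phi alpha P by rewrite expr1.
have p2 : phi (alpha ^+ 2) P = phi alpha (phi alpha P) by rewrite expr2 phiM.
have p3 : phi (alpha ^+ 3) P = phi alpha (phi alpha (phi alpha P)) by rewrite exprS phiM p2.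
have := max_poly_roots (rs := [:: x0; x1; x2; x3]) (fib0 t0).
rewrite size_fib /= !inE !negb_or.
rewrite (fibE _ _ _ _ c_0 ey0) (fibE _ _ _ _ c_1 ey1) (fibE _ _ _ _ c_2 ey2) (fibE _ _ _ _ c_3 ey3) /=.
rewrite (ne 0%N 1%N _ _ _ _ _ _ _ p0 p1 c_0 c_1) // (ne 0%N 2%N _ _ _ _ _ _ _ p0 p2 c_0 c_2) //.
rewrite (ne 0%N 3%N _ _ _ _ _ _ _ p0 p3 c_0 c_3) // (ne 1%N 2%N _ _ _ _ _ _ _ p1 p2 c_1 c_2) //.
rewrite (ne 1%N 3%N _ _ _ _ _ _ _ p1 p3 c_1 c_3) // (ne 2%N 3%N _ _ _ _ _ _ _ p2 p3 c_2 c_3) //.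
by move=> /(_ isT isT).
Qed.

End LinearTerms.

(** * Points over finite fields *)

(** Translation by 1 permutes the field and so preserves the sum of its elements. *)
Lemma card_finField_eq0 (F : finFieldType) : #|F|%:R = 0 :> F.
Proof.
have e : \sum_(x : F) x = \sum_(x : F) (x + 1).
  by rewrite (reindex_inj (addIr 1)).
move/eqP: e; rewrite big_split /= sumr_const -subr_eq0 opprD addrA subrr sub0r oppr_eq0.
by move/eqP.
Qed.

(** X^Q - X is separable, its derivative being -1. *)
Lemma frobenius_roots (K : closedFieldType) (Q : nat) : (1 < Q)%N -> Q%:R = 0 :> K ->
  exists s : seq K, [/\ uniq s, size s = Q & forall x, x \in s -> x ^+ Q = x].
Proof.
move=> Q1 Q0; pose p : {poly K} := 'X^Q - 'X.
have sp : size p = Q.+1.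
  by rewrite /p size_polyDl ?size_polyXn // size_polyN size_polyX.
have [s es] := closed_field_poly_normal p.
have lp : lead_coef p = 1.
  by rewrite /p lead_coefDl ?lead_coefXn // size_polyN size_polyX size_polyXn.
rewrite lp scale1r in es; exists s; split.
- rewrite -separable_prod_XsubC -es separable_poly.unlock /p derivB derivXn derivX.
  rewrite -mulr_natr -polyC_natr Q0 mulr0 sub0r.
  have -> : -1 = (-1) *: 1 :> {poly K} by rewrite scaleN1r.
  by rewrite coprimepZr ?oppr_eq0 ?oner_eq0 // coprimep1.
- by apply/eqP; rewrite -eqSS -sp es size_prod_XsubC.
move=> x; rewrite -root_prod_XsubC -es /root /p hornerD hornerN hornerXn hornerX.
by rewrite subr_eq0 => /eqP.
Qed.

Section FrobeniusCount.
Variables (K : closedFieldType) (E : ecurve K) (Q : nat).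
Local Notation pt := (curve_point E).
Hypotheses (Q1 : (1 < Q)%N) (Q0 : Q%:R = 0 :> K).
Variable psi : pt -> pt.
Hypothesis frob : forall P, coords (psi P) =
  if coords P is Some (x, y) then Some (x ^+ Q, y ^+ Q) else None.

Hypothesis psiN : forall P, psi (- P) = - psi P.

(** Above x fixed by Frobenius, psi sends (x, y) to (x, y) or (x, -y), so that P and -P go to the
    same list if y is nonzero. A point with y = 0 goes to both lists, as does infinity, which
    accounts for the final 2. *)
Lemma frobenius_count : exists sA sB : seq pt,
  [/\ uniq sA /\ uniq sB, forall P, P \in sA -> psi P = P, forall P, P \in sB -> psi P = - P &
    (size sA + size sB = 2 * Q + 2)%N].
Proof.
have [rs [urs srs hrs]] := frobenius_roots Q1 Q0.
have main : exists sA sB : seq pt,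
    [/\ uniq sA /\ uniq sB, forall P, P \in sA -> psi P = P, forall P, P \in sB -> psi P = - P,
     forall P, P \in sA ++ sB -> exists2 x, x \in rs & xc P = Some x &
    (size sA + size sB = 2 * size rs)%N].
  elim: rs urs hrs {srs} => [|x rs IH] /=; first by exists [::], [::].
  move=> /andP[xrs urs] hrs.
  have [|sA [sB [[uA uB] hA hB hx sz]]] := IH urs.
    by move=> y ys; apply: hrs; rewrite inE ys orbT.
  have [y ey] := sqrt_exists (rhs E).[x]; have [P eP] := point_of ey.
  have ex := hrs x (mem_head _ _).
  have eF : coords (psi P) = Some (x, y ^+ Q) by rewrite frob eP ex.
  have xP : xc P = Some x by rewrite (xc_coords eP).
  have xN : xc (- P) = Some x by rewrite xc_oppr.
  have nin S : xc S = Some x -> S \notin sA ++ sB.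
    by move=> eS; apply/negP => /hx[x' xs']; rewrite eS => -[e]; move: xrs; rewrite e xs'.
  have ninA S : xc S = Some x -> S \notin sA by move/nin; rewrite mem_cat negb_or => /andP[].
  have ninB S : xc S = Some x -> S \notin sB by move/nin; rewrite mem_cat negb_or => /andP[].
  have hx' S : S \in sA ++ sB -> exists2 x', x' \in x :: rs & xc S = Some x'.
    by move=> /hx[x' xs' e]; exists x' => //; rewrite inE xs' orbT.
  have yN : y != 0 -> P != - P.
    move=> y0; apply/eqP => /(congr1 (@coords K E)); rewrite eP (coords_opp_aff eP) => -[e].
    move: y0; have /eqP : 2%:R * y = 0 by rewrite mulr_natl mulr2n {1}e addNr.
    by rewrite mulf_eq0 (negPf (ec_two E)) /= => ->.
  have hx1 : exists2 x', x' \in x :: rs & xc P = Some x' by exists x; rewrite ?mem_head.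
  have hx2 : exists2 x', x' \in x :: rs & xc (- P) = Some x' by exists x; rewrite ?mem_head.
  have [y0|y0] := eqVneq y 0.
    have eNP : - P = P by apply: coords_inj; rewrite (coords_opp_aff eP) eP y0 oppr0.
    have psP : psi P = P.
      by apply: coords_inj; rewrite eF eP y0 expr0n eqn0Ngt ltnW.
    exists (P :: sA), (P :: sB); split.
    - by rewrite /= ninA // ninB.
    - by move=> S; rewrite inE => /predU1P[->|/hA].
    - by move=> S; rewrite inE => /predU1P[->|/hB //]; rewrite eNP.
    - by move=> S; rewrite cat_cons inE mem_cat inE => /predU1P[-> //|/or3P[h|/eqP->|h]] //;
        apply: hx'; rewrite mem_cat h ?orbT.
    by rewrite /= addSn addnS sz; lia.
  have yQ : (y ^+ Q) ^+ 2 = (rhs E).[x] by have := coordsP eF.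
  have [eq|eq] := eq_sqr_or ey yQ.
    have psP : psi P = P by apply: coords_inj; rewrite eF eP eq.
    exists [:: P, - P & sA], sB; split=> //.
    - by rewrite /= inE negb_or yN // !ninA.
    - by move=> S; rewrite !inE => /or3P[/eqP->|/eqP->|/hA] //; rewrite psiN psP.
    - move=> S; rewrite !cat_cons !inE => /or3P[/eqP->|/eqP->|/hx'] //.
    by rewrite /= !addSn sz; lia.
  have psP : psi P = - P by apply: coords_inj; rewrite eF (coords_opp_aff eP) eq.
  exists sA, [:: P, - P & sB]; split=> //.
  - by rewrite /= inE negb_or yN // !ninB.
  - by move=> S; rewrite !inE => /or3P[/eqP->|/eqP->|/hB] //; rewrite psiN psP.
  - move=> S; rewrite mem_cat !inE => /or4P[h|/eqP->|/eqP->|h] //;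
      by apply: hx'; rewrite mem_cat h ?orbT.
  by rewrite /= !addnS sz; lia.
have [sA [sB [[uA uB] hA hB hx sz]]] := main.
have ps0 : psi 0 = 0 by apply: coords_inj; rewrite frob.
have n0 : 0 \notin sA ++ sB by apply/negP => /hx[x _].
move: n0; rewrite mem_cat negb_or => /andP[nA nB].
exists (0 :: sA), (0 :: sB); split.
- by rewrite /= nA nB.
- by move=> S; rewrite inE => /predU1P[->|/hA].
- by move=> S; rewrite inE => /predU1P[->|/hB //]; rewrite oppr0.
by rewrite /= addSn addnS sz srs; lia.
Qed.

End FrobeniusCount.

(** * The torsion of alpha^h and delta *)

Section Comaximal.
Variable R : comNzRingType.
Implicit Types (I J p q : idl R).

Definition comaximal I J := exists2 u, I u & J (1 - u).

Lemma comaximalC I J : comaximal I J -> comaximal J I.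
Proof. by move=> [u Iu Ju]; exists (1 - u) => //; rewrite opprB addrC subrK. Qed.

Lemma comaximalM I J J' : comaximal I J -> comaximal I J' -> comaximal I (idl_mul J J').
Proof.
move=> [u Iu Ju] [v Iv Jv]; exists (u + v * (1 - u)).
  by apply: is_idealD (idlP I) Iu _; rewrite mulrC; apply: is_idealM (idlP I) Iv.
have -> : 1 - (u + v * (1 - u)) = (1 - u) * (1 - v) by ring.
exact: ideal_mul_mem.
Qed.

Lemma comaximal1 I : comaximal I (idl_one R).
Proof. by exists 0; first exact: is_ideal0 (idlP I). Qed.

Lemma comaximal_iprod (ps qs : seq (idl R)) :
  (forall p q, p \in ps -> q \in qs -> comaximal p q) -> comaximal (iprod ps) (iprod qs).
Proof.
move=> h; rewrite /iprod big_seq; elim/big_ind: _ => [|I J cI cJ|p pps].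
- exact/comaximalC/comaximal1.
- by apply: comaximalC; apply: comaximalM; apply: comaximalC.
rewrite big_seq; elim/big_ind: _ => [|I J cI cJ|q qqs]; [exact: comaximal1 | exact: comaximalM | exact: h].
Qed.

Lemma iprod_cat (ps qs : seq (idl R)) : iprod (ps ++ qs) = idl_mul (iprod ps) (iprod qs).
Proof. exact: big_cat. Qed.

Lemma iprod_sub (ps : seq (idl R)) p : p \in ps -> iprod ps `<=` p.
Proof. by move=> pps; rewrite /iprod (big_rem p pps) /=; apply: idl_mul_subl. Qed.

(** Exponents are unrolled into repetitions, the form in which the counts for [iprod] apply. *)
Definition plist l (B : 'I_l -> idl R) (e : 'I_l -> nat) : seq (idl R) :=
  flatten [seq nseq (e i) (B i) | i <- enum 'I_l].

Lemma mem_plist l (B : 'I_l -> idl R) e p : p \in plist B e -> exists2 i, p = B i & (0 < e i)%N.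
Proof.
move=> /flatten_mapP[i _ /nseqP[-> ei]]; by exists i.
Qed.

Lemma iprod_nseq k p : idl_set (iprod (nseq k p)) = ideal_exp p k.
Proof. by elim: k => [|k IH]; rewrite /iprod ?big_nil // big_cons /= -/(iprod _) IH. Qed.

Lemma iprod_plistE l (B : 'I_l -> idl R) e :
  iprod (plist B e) = \big[@idl_mul R/idl_one R]_(i < l) iprod (nseq (e i) (B i)).
Proof. by rewrite /iprod /plist big_flatten big_map big_enum. Qed.

Lemma iprod_plist l (B : 'I_l -> idl R) e :
  idl_set (iprod (plist B e)) = ideal_prod (fun i => idl_set (B i)) e.
Proof.
rewrite iprod_plistE (big_morph (@idl_set R) (id1 := setT) (op1 := @ideal_mul R)) //.
by apply: eq_bigr => i _; rewrite iprod_nseq.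
Qed.

Lemma iprod_plistD l (B : 'I_l -> idl R) e e' :
  iprod (plist B (fun i => (e i + e' i)%N)) = idl_mul (iprod (plist B e)) (iprod (plist B e')).
Proof.
rewrite !iprod_plistE -big_split; apply: eq_bigr => i _.
by rewrite nseqD iprod_cat.
Qed.

Definition idl_pow I h := iprod (nseq h I).

Lemma idl_powS I h : idl_pow I h.+1 = idl_mul I (idl_pow I h).
Proof. exact: big_cons. Qed.

Lemma idl_powM I J h : idl_pow (idl_mul I J) h = idl_mul (idl_pow I h) (idl_pow J h).
Proof.
elim: h => [|h IH]; first by rewrite /idl_pow /iprod !big_nil Monoid.mulm1.
by rewrite !idl_powS IH Monoid.mulmACA.
Qed.

Lemma idl_pow_plist l (B : 'I_l -> idl R) e h :
  idl_pow (iprod (plist B e)) h = iprod (plist B (fun i => (e i * h)%N)).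
Proof.
elim: h => [|h IH].
  rewrite [RHS]iprod_plistE /idl_pow {1}/iprod big_nil big1 // => i _.
  by rewrite muln0 /iprod big_nil.
rewrite idl_powS IH -iprod_plistD; congr iprod; congr flatten; apply: eq_map => i.
by rewrite mulnS.
Qed.

Lemma comaximal_pow I J h : comaximal I J -> comaximal I (idl_pow J h).
Proof.
move=> c; elim: h => [|h IH]; last by rewrite idl_powS; apply: comaximalM.
by rewrite /idl_pow /iprod big_nil; apply: comaximal1.
Qed.

Lemma pidl_pow u h : idl_pow (pidl u) h = pidl (u ^+ h).
Proof.
elim: h => [|h IH].
  apply: idl_eq => v; rewrite /idl_pow /iprod big_nil; split=> // _.
  by apply/pidlP; exists v; rewrite mul1r.
rewrite idl_powS IH; apply: idl_eq => v; split.
  apply: ideal_mul_sub (idlP (pidl _)) _ v => x y /pidlP[a ->] /pidlP[b ->].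
  by apply/pidlP; exists (a * b); rewrite exprS; ring.
move=> /pidlP[a ->]; rewrite exprS -mulrA; apply: ideal_mul_mem; apply/pidlP.
  by exists 1; rewrite mulr1.
by exists a.
Qed.

End Comaximal.

Section Kappa.
Variables (R : comNzRingType) (sigma : R -> R) (tr nm : R -> int) (z : R) (m : nat).
Hypothesis qo : quadratic_order sigma tr nm z m.
Variable D : R -> nat.
Hypotheses (D0 : D 0 = 0%N) (D1 : D 1 = 1%N) (DN : forall u, D (- u) = D u).
Hypothesis DM : forall u v, D (u * v) = (D u * D v)%N.
Hypothesis D_par : forall u v, (D (u + v) + D (u - v) = 2 * D u + 2 * D v)%N.

Lemma distinct_primes_comaximal (p q : idl R) : prime_idl p -> prime_idl q ->
  idl_set p <> idl_set q -> comaximal p q.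
Proof.
move=> pp pq ne.
have half (p' q' : idl R) : prime_idl p' -> (exists2 v, q' v & ~ p' v) -> comaximal p' q'.
  move=> pp' [v qv pv]; have [r hr] := prime_idl_maximal qo D0 D1 DN DM D_par pp' pv.
  exists (1 - r * v) => //; have -> : 1 - (1 - r * v) = r * v by ring.
  exact: is_idealM (idlP q') qv.
have [h|no] := pselect (exists2 v, q v & ~ p v); first exact: half.
have [h|no'] := pselect (exists2 v, p v & ~ q v); first exact/comaximalC/half.
case: ne; apply/seteqP; split=> v hv; apply: contrapT => n.
  by apply: no'; exists v.
by apply: no; exists v.
Qed.

Lemma factorization_idl (I : set R) k (C : 'I_k -> set R) g : prime_factorization I C g ->
  exists C' : 'I_k -> idl R, [/\ forall i, idl_set (C' i) = C i, forall i, prime_idl (C' i),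
    forall i, (0 < g i)%N & I = idl_set (iprod (plist C' g))].
Proof.
move=> [hC _ g0 eI].
have iC i : is_ideal (C i) by have [[]] := hC i.
exists (fun i => Idl (iC i)); split=> // [i|]; last by rewrite iprod_plist eI.
split; first by have [] := hC i.
apply: contrapT => no; have [_ n0] := hC i; apply: n0; apply/seteqP; split=> [v Cv|_ ->].
  by apply: contrapT => /eqP v0; apply: no; exists v.
exact: is_ideal0 (iC i).
Qed.

Variable M : lmodType R.
Hypothesis divisible : forall (u : R) (y : M), u != 0 -> exists x, u *: x = y.
Hypothesis ker_bound : forall (u : R) (s : seq M), u != 0 -> uniq s ->
  (forall x, x \in s -> u *: x = 0) -> (size s <= D u)%N.

Variables (alpha delta : R) (Ic It : set R).
Hypothesis hdelta : principal delta = ideal_mul Ic It.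
Variables (k : nat) (C : 'I_k -> set R) (g : 'I_k -> nat).
Hypotheses (hIc : prime_factorization Ic C g) (hC : forall i, ~ C i alpha).
Variables (l : nat) (B : 'I_l -> set R) (e : 'I_l -> nat).
Hypotheses (hIt : prime_factorization It B e) (hB : forall i, B i alpha).
Variables (f : 'I_l -> nat) (J : set R).
Hypothesis hf : principal alpha = ideal_mul (ideal_prod B f) J.
Hypothesis hJ : exists (m : nat) (Q : 'I_m -> set R) (u : 'I_m -> nat),
  prime_factorization J Q u /\ forall i j, B i <> Q j.
Variable ks : seq M.
Hypotheses (delta0 : delta != 0) (uks : uniq ks) (kks : forall x, x \in ks -> delta *: x = 0).
Hypothesis Dks : (D delta <= size ks)%N.

Definition kappa (h : nat) : nat :=
  (\prod_(i < l) ideal_norm (ideal_exp (B i) (minn (e i) (f i * h))))%N.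

(** The product G of the powers of B i with exponents [mm] satisfies (delta) = G V and (alpha^h) = G
    U with U and V comaximal. Hence G is the sum of these two ideals, and its torsion is the common
    torsion of delta and alpha^h. The base N i is the norm of B i, which exceeds 1 since B i is
    proper. *)
Lemma kappa_spec : exists2 N : 'I_l -> nat, (forall i, (1 < N i)%N) & forall h,
  kappa h = (\prod_(i < l) N i ^ (minn (e i) (f i * h)))%N /\
  exists2 t : seq M, enumerates t (fun x => delta *: x = 0 /\ alpha ^+ h *: x = 0) &
    size t = kappa h.
Proof.
have [C' [eC pC g0 eIc]] := factorization_idl hIc.
have [B' [eB pB e0 eIt]] := factorization_idl hIt.
have [mJ [Q [uQ [hQ BQ]]]] := hJ; have [Q' [eQ pQ u0 eJ]] := factorization_idl hQ.
have [_ injB _ _] := hIt.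
pose ps := plist C' g ++ plist B' e.
have eB' e' : idl_set (iprod (plist B' e')) = ideal_prod B e'.
  by rewrite iprod_plist; congr ideal_prod; apply/funext.
have ed : pidl delta = iprod ps.
  by apply: idl_eq => v; rewrite /ps iprod_cat /idl_mem /= hdelta eIc eIt.
have ea : pidl alpha = idl_mul (iprod (plist B' f)) (iprod (plist Q' uQ)).
  by apply: idl_eq => v; rewrite /idl_mem /= hf eJ eB'.
have pps p : p \in ps -> prime_idl p.
  by rewrite mem_cat => /orP[] /mem_plist[i -> _].
have count := torsion_count qo D0 D1 DN DM D_par divisible ker_bound delta0 pps ed uks kks Dks.
have Bps i : B' i \in ps.
  rewrite mem_cat; apply/orP; right; apply/flatten_mapP; exists i; first by rewrite mem_enum.
  by rewrite mem_nseq e0 eqxx.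
have expE i j : ideal_norm (ideal_exp (B i) j) = (ideal_norm (B i) ^ j)%N.
  have [|h _] := count (nseq j (B' i)); first by move=> q /nseqP[->].
  by rewrite -eB -iprod_nseq h big_nseq iter_muln_1.
exists (fun i => ideal_norm (B i)) => [i|h].
  have [s [us h1 h2]] := transversal_exists qo D0 D1 DN DM D_par (pB i).2.
  rewrite -eB (ideal_norm_transversal (idlP (B' i)) (And3 us h1 h2)).
  have [x xs x0] := h1 0; have [y ys y1] := h1 1.
  case: s us h1 h2 xs ys => [|a [|b s]] // _ _ _; rewrite !inE => /eqP ex /eqP ey.
  exfalso; have [[iB nB1 _] _] := pB i; apply: nB1.
  have -> : 1 = (1 - y) - (0 - x) :> R by rewrite ex ey; ring.
  exact: is_idealB.
split; first by rewrite /kappa; apply: eq_bigr => i _; apply: expE.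
pose mm i := minn (e i) (f i * h).
have kE : kappa h = (\prod_(q <- plist B' mm) ideal_norm q)%N.
  rewrite /kappa /plist big_flatten big_map big_enum; apply: eq_bigr => i _.
  by rewrite expE big_nseq iter_muln_1 eB.
have [|_ [t [ut ht] st]] := count (plist B' mm).
  by move=> q /mem_plist[i -> _]; apply: Bps.
exists t; last by rewrite st kE.
split=> // x; rewrite ht.
pose n1 i := (f i * h - mm i)%N; pose n2 i := (e i - mm i)%N.
have eF : (fun i => f i * h)%N = (fun i => mm i + n1 i)%N.
  by apply/funext => i; rewrite /n1 subnKC // geq_minr.
have eE : e = (fun i => mm i + n2 i)%N.
  by apply/funext => i; rewrite /n2 subnKC // geq_minl.
pose U := idl_mul (iprod (plist B' n1)) (idl_pow (iprod (plist Q' uQ)) h).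
pose V := idl_mul (iprod (plist C' g)) (iprod (plist B' n2)).
have eA : pidl (alpha ^+ h) = idl_mul (iprod (plist B' mm)) U.
  by rewrite -pidl_pow ea idl_powM idl_pow_plist eF iprod_plistD Monoid.mulmA.
have eD : pidl delta = idl_mul (iprod (plist B' mm)) V.
  by rewrite ed /ps iprod_cat {1}eE iprod_plistD Monoid.mulmCA.
have self (v : R) : pidl v v by apply/pidlP; exists 1; rewrite mulr1.
have aQ j : Q' j alpha.
  have : pidl alpha alpha by [].
  rewrite ea idl_mulC => /idl_mul_subl; apply: iprod_sub.
  by apply/flatten_mapP; exists j; rewrite ?mem_enum // mem_nseq u0 eqxx.
have UV : comaximal U V.
  have cm := distinct_primes_comaximal.
  have BC i j : idl_set (B' i) <> idl_set (C' j).
    by rewrite eB eC => eq; apply: (hC (i := j)); rewrite -eq.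
  have QC i j : idl_set (Q' i) <> idl_set (C' j).
    by move=> eq; have := aQ i; rewrite /idl_mem eq eC; apply: hC.
  have QB i j : idl_set (Q' i) <> idl_set (B' j) by rewrite eQ eB => /esym; apply: BQ.
  have BB i j : (0 < n1 i)%N -> (0 < n2 j)%N -> idl_set (B' i) <> idl_set (B' j).
    rewrite !eB => h1 h2 /injB eij; move: h1 h2; rewrite eij /n1 /n2 /mm; lia.
  apply: comaximalM.
    apply: comaximalC; apply: comaximalM.
      apply: comaximal_iprod => p q /mem_plist[i -> _] /mem_plist[j -> _].
      by apply/comaximalC/cm.
    apply: comaximal_pow; apply: comaximal_iprod => p q /mem_plist[i -> _] /mem_plist[j -> _].
    by apply/comaximalC/cm.
  apply: comaximalC; apply: comaximalM.
    apply: comaximal_iprod => p q /mem_plist[i -> hi] /mem_plist[j -> hj].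
    by apply/comaximalC/cm => //; apply: BB.
  apply: comaximal_pow; apply: comaximal_iprod => p q /mem_plist[i -> _] /mem_plist[j -> _].
  by apply/comaximalC/cm.
split=> [hx|[dx ax]].
  split; apply: hx.
    have := self delta; rewrite {1}eD; exact: idl_mul_subl.
  have := self (alpha ^+ h); rewrite {1}eA; exact: idl_mul_subl.
move=> i Ii; have [u Uu Vu] := UV.
have -> : i = i * u + i * (1 - u) by ring.
rewrite scalerDl.
have : pidl (alpha ^+ h) (i * u) by rewrite eA; apply: ideal_mul_mem.
move=> /pidlP[r ->].
have : pidl delta (i * (1 - u)) by rewrite eD; apply: ideal_mul_mem.
move=> /pidlP[r' ->].
by rewrite ![_ * r]mulrC ![_ * r']mulrC -!scalerA dx ax !scaler0 addr0.
Qed.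

End Kappa.

(** * Levels of the trees *)

Section Tree.
Variables (M : zmodType) (T : choiceType) (X : M -> T) (al : M -> M) (r : T -> T).
Variables (G : M -> Prop) (Dom S E0 : set T).
Hypothesis alD : forall x y, al (x + y) = al x + al y.
Hypothesis X_eq : forall x y, X x = X y <-> x = y \/ x = - y.
Hypothesis rX : forall x, r (X x) = X (al x).
Hypotheses (GD : forall x y, G x -> G y -> G (x + y)) (GN : forall x, G x -> G (- x)).
Hypothesis Gal : forall x, G x -> G (al x).
Hypothesis SG : forall t, S t <-> exists2 x, G x & X x = t.
Hypothesis E0G : forall t, E0 t <-> exists x, [/\ G x, x = - x & X x = t].
Hypothesis SDom : S `<=` Dom.

Let al0 : al 0 = 0.
Proof. by apply: (addrI (al 0)); rewrite -alD !addr0. Qed.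

Let alN x : al (- x) = - al x.
Proof. by apply: (addrI (al x)); rewrite -alD !subrr al0. Qed.

Let itD n x y : iter n al (x + y) = iter n al x + iter n al y.
Proof. by elim: n => //= n ->; rewrite alD. Qed.

Let itN n x : iter n al (- x) = - iter n al x.
Proof. by elim: n => //= n ->; rewrite alN. Qed.

Let it0 n : iter n al 0 = 0.
Proof. by elim: n => //= n ->; rewrite al0. Qed.

Let itG n x : G x -> G (iter n al x).
Proof. by move=> Gx; elim: n => //= n; apply: Gal. Qed.

Let itX n x : iter n r (X x) = X (iter n al x).
Proof. by elim: n => //= n ->; rewrite rX. Qed.

Lemma periodic_mul (U : Type) (h : U -> U) m k x : iter m h x = x -> iter (k * m) h x = x.
Proof. by move=> e; elim: k => //= k IH; rewrite mulSn iterD IH e. Qed.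

Lemma periodic_iter (U : Type) (h : U -> U) k x : periodic h x -> periodic h (iter k h x).
Proof. by move=> [m m0 e]; exists m => //; rewrite -iterD addnC iterD e. Qed.

(** A return of X x only gives al^m x = x or -x; in the second case the period is doubled. *)
Lemma periodicX x : periodic r (X x) <-> periodic al x.
Proof.
split=> [[m m0]|[m m0 e]]; last by exists m => //; rewrite itX e.
rewrite itX => /X_eq[e|e]; first by exists m.
by exists (m + m)%N; [rewrite addn_gt0 m0 | rewrite iterD e itN e opprK].
Qed.

Lemma periodicD x y : periodic al x -> periodic al y -> periodic al (x + y).
Proof.
move=> [m m0 e] [m' m0' e']; exists (m * m')%N; first by rewrite muln_gt0 m0.
by rewrite itD (periodic_mul _ e') mulnC (periodic_mul _ e).
Qed.

Lemma periodicN x : periodic al x -> periodic al (- x).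
Proof. by move=> [m m0 e]; exists m => //; rewrite itN e. Qed.

Lemma periodic_nilpotent x : al x = 0 -> periodic al x <-> x = 0.
Proof.
move=> e; split=> [[[|m] // _ em]|->]; last by exists 1%N.
by rewrite -em iterSr e it0.
Qed.

Variables (kap : nat -> nat) (ker : nat -> seq M).
Hypothesis ker_enum : forall h, enumerates (ker h) (fun x => G x /\ iter h al x = 0).
Hypothesis ker_size : forall h, size (ker h) = kap h.

Variable x0 : M.
Hypotheses (Gx0 : G x0) (per0 : periodic al x0).

(** A point above t is determined up to sign, and the sign is chosen to reach x0 instead of -x0. *)
Lemma level_succE h t : level Dom r (X x0) S h.+1 t <->
  exists x, [/\ G x, iter h.+1 al x = x0, ~ periodic al (iter h al x) & X x = t].
Proof.
split.
  move=> [/SG[x Gx <-] _]; rewrite itX => /X_eq[e|e]; rewrite [h.+1.-1]/= itX periodicX => np.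
    by exists x.
  exists (- x); split; [exact: GN | by rewrite itN e opprK | | by apply/X_eq; right].
  by rewrite itN => /periodicN; rewrite opprK.
move=> [x [Gx e np <-]]; have SX : S (X x) by apply/SG; exists x.
split=> //; last 2 first.
- by rewrite itX e.
- by rewrite /= itX periodicX.
right; have nx j : (j < h.+1)%N -> ~ periodic r (iter j r (X x)).
  rewrite ltnS => jh pj; apply: np; have := periodic_iter (h - j) pj.
  by rewrite -iterD subnK // itX periodicX.
split; [exact: SDom | exact: (nx 0%N) |].
by exists h.+1; rewrite itX e.
Qed.

(** Going on along the cycle of length m for m h - h steps is the same as going back h steps. *)
Lemma lift_periodic h : exists2 y, G y & iter h al y = x0 /\ periodic al y.
Proof.
have [m m0 e] := per0; exists (iter (m * h - h) al x0); first exact: itG.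
split; last exact: periodic_iter.
rewrite -iterD subnKC; last by rewrite leq_pmull.
by rewrite mulnC periodic_mul.
Qed.

(** With y a periodic lift of x0, the other lifts are y + N with N in the kernel of al^(h+1).
    Periodic points form a group, so al^h (y + N) is periodic exactly when al^h N is; as al kills
    al^h N, this means al^h N = 0. *)
Lemma level_seq h : exists L : seq M,
  [/\ uniq L, forall x, x \in L <-> [/\ G x, iter h.+1 al x = x0 & ~ periodic al (iter h al x)]
    & (size L + kap h = kap h.+1)%N].
Proof.
have [y Gy [ey py]] := lift_periodic h.+1.
have [u1 k1] := ker_enum h.+1; have [u0 k0] := ker_enum h.
exists [seq y + N | N <- ker h.+1 & iter h al N != 0]; split.
- by rewrite map_inj_uniq ?filter_uniq //; apply: addrI.
- move=> x; split.
    move=> /mapP[N]; rewrite mem_filter => /andP[N0 /k1[GN' eN] ->]; split.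
    + exact: GD.
    + by rewrite itD ey eN addr0.
    move=> px; move/eqP: N0; apply; apply/(periodic_nilpotent eN).
    have := periodicD px (periodicN (periodic_iter h py)).
    by rewrite itD addrAC subrr add0r.
  move=> [Gx ex npx]; apply/mapP; exists (x - y); last by rewrite addrC subrK.
  rewrite mem_filter; apply/andP; split.
    apply/eqP => e; apply: npx; have := periodic_iter h py.
    by move/eqP: e; rewrite itD itN subr_eq0 => /eqP ->.
  by apply/k1; split; [apply: GD => //; apply: GN | rewrite itD itN ex ey subrr].
rewrite size_map -!ker_size size_filter -(count_predC (fun N => iter h al N != 0) (ker h.+1)).
congr (_ + _)%N; rewrite -size_filter; apply/perm_size/uniq_perm => [//||N].
  exact: filter_uniq.
rewrite mem_filter /= negbK; apply/idP/andP => [/k0[GN' e]|[/eqP e /k1[GN' _]]].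
  by split; [apply/eqP | apply/k1; rewrite /= e al0].
by apply/k0.
Qed.

(** The fibres of X on L are the pairs x, -x, which become single elements when x = -x. The
    induction removes a whole pair at a time, hence runs over a bound on the size. *)
Lemma half_image (L : seq M) : uniq L -> (forall x, x \in L -> - x \in L) ->
  exists2 U : seq T, enumerates U (fun t => exists2 x, x \in L & X x = t) &
    (2 * size U = size L + size [seq x <- L | x == - x])%N.
Proof.
have [k] := ubnP (size L); elim: k L => // k IH [|x L] sL uL cL.
  by exists [::] => //; split=> // t; split=> // -[].
have xL : x \notin L by case/andP: uL.
have uL' : uniq L by case/andP: uL.
have [ex|nx] := eqVneq x (- x).
  have cL' y : y \in L -> - y \in L.
    move=> yL; have := cL y; rewrite !inE yL orbT => /(_ isT) /predU1P[e|//].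
    have ey : y = x by rewrite -[y]opprK e -ex.
    by move: xL; rewrite -ey yL.
  have [U [uU hU] sU] := IH L sL uL' cL'.
  exists (X x :: U); last by rewrite /= -ex eqxx /= mulnS sU add2n addSn addnS.
  split=> [/=|t].
    rewrite uU andbT; apply/negP => /hU[y yL /X_eq ey].
    move: xL; suff -> : x = y by rewrite yL.
    by case: ey => [->//|->]; rewrite -ex.
  rewrite inE; split=> [/predU1P[->|/hU[y yL <-]]|[y]].
  - by exists x; rewrite ?mem_head.
  - by exists y; rewrite // inE yL orbT.
  rewrite inE => /predU1P[->|yL] <-; first by rewrite eqxx.
  by apply/orP; right; apply/hU; exists y.
have NxL : - x \in L by have := cL x (mem_head _ _); rewrite inE eq_sym (negPf nx).
pose L' := rem (- x) L.
have uL2 : uniq L' by apply: rem_uniq.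
have memL' y : (y \in L') = (y != - x) && (y \in L) by rewrite mem_rem_uniq.
have cL' y : y \in L' -> - y \in L'.
  rewrite !memL' eqr_opp => /andP[n1 yL].
  have := cL y; rewrite !inE yL orbT => /(_ isT) /predU1P[e|->].
    by rewrite -e opprK eqxx in n1.
  by rewrite andbT; apply/negP => /eqP e; move: xL; rewrite -e yL.
have sLS : size L = (size L').+1.
  by rewrite /L' size_rem // prednK //; case: (L) NxL.
have sL' : (size L' < k)%N by move: sL; rewrite /= sLS ltnS => /ltnW.
have [U [uU hU] sU] := IH L' sL' uL2 cL'.
exists (X x :: U); last first.
  rewrite /= (negPf nx) mulnS sU sLS.
  have -> : [seq y <- L' | y == - y] = [seq y <- L | y == - y].
    rewrite /L' rem_filter // -filter_predI; apply: eq_in_filter => y yL /=.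
    case: eqP => //= ey; apply/eqP => e; have /eqP : x = - x by rewrite -[LHS]opprK -e -ey.
    by rewrite (negPf nx).
  by rewrite add2n !addSn.
split=> [/=|t].
  rewrite uU andbT; apply/negP => /hU[y]; rewrite memL' => /andP[n1 yL] /X_eq[e|e].
    by move: xL; rewrite -e yL.
  by rewrite e eqxx in n1.
rewrite inE; split=> [/predU1P[->|/hU[y yL <-]]|[y]].
- by exists x; rewrite ?mem_head.
- by exists y => //; move: yL; rewrite memL' inE => /andP[_ ->]; rewrite orbT.
rewrite inE => /predU1P[->|yL] <-; first by rewrite eqxx.
have [->|n1] := eqVneq y (- x).
  by apply/orP; left; apply/eqP/X_eq; right.
by apply/orP; right; apply/hU; exists y; rewrite // memL' n1.
Qed.

(** If x0 = -x0, the set of lifts is symmetric and [half_image] applies. Otherwise X is injective on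
    it, and no lift satisfies x = -x, since iterating al would give x0 = -x0. *)
Lemma level_count h (lev := level Dom r (X x0) S h.+1) :
  [/\ (kap h <= kap h.+1)%N, lev !=set0 <-> (kap h < kap h.+1)%N,
   E0 (X x0) -> (2 * set_card lev = (kap h.+1 - kap h) + set_card (lev `&` E0))%N &
   ~ E0 (X x0) -> set_card lev = (kap h.+1 - kap h)%N /\ set_card (lev `&` E0) = 0%N].
Proof.
have [L [uL hL sL]] := level_seq h.
have levE t : lev t <-> exists2 x, x \in L & X x = t.
  rewrite /lev level_succE; split=> [[x [Gx e np <-]]|[x /hL[Gx e np] <-]]; last by exists x.
  by exists x => //; apply/hL.
have E0P x : G x -> E0 (X x) <-> x = - x.
  move=> Gx; rewrite E0G; split=> [[y [_ ey /X_eq[e|e]]]|e]; last by exists x.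
    by rewrite -e.
  by rewrite e in ey; move: ey; rewrite opprK => ->.
have fixE : enumerates [seq X x | x <- L & x == - x] (lev `&` E0).
  split=> [|t].
    rewrite map_inj_in_uniq ?filter_uniq // => x y; rewrite !mem_filter => /andP[/eqP ex _] /andP[/eqP ey _].
    by move/X_eq => [//|->]; rewrite -ey.
  split=> [/mapP[x]|[/levE[x xL <-]]].
    rewrite mem_filter => /andP[/eqP ex xL] ->; split; first by apply/levE; exists x.
    by apply/E0P => //; have [] := (hL x).1 xL.
  have [Gx _ _] := (hL x).1 xL; move/(E0P x Gx) => ex.
  by apply/mapP; exists x; rewrite // mem_filter -ex eqxx.
split.
- by rewrite -sL leq_addl.
- have -> : (kap h < kap h.+1)%N = (0 < size L)%N by rewrite -sL; lia.
  split=> [[t /levE[x xL _]]|]; first by case: (L) xL.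
  by case: (L) levE => // x L1 levE _; exists (X x); apply/levE; exists x; rewrite ?mem_head.
- move=> /(E0P x0 Gx0) e0.
  have cL x : x \in L -> - x \in L.
    move=> /hL[Gx ex np]; apply/hL; split; [exact: GN | by rewrite itN ex -e0 |].
    by rewrite itN => /periodicN; rewrite opprK.
  have [U hU sU] := half_image uL cL.
  rewrite (set_card_enumerates fixE) size_map.
  have eU : enumerates U lev by case: hU => uU hU; split=> // t; rewrite levE.
  by rewrite (set_card_enumerates eU) sU -sL addnK.
move=> ne0; have n0 : x0 <> - x0 by move=> e; apply: ne0; apply/E0P.
have eL : enumerates [seq X x | x <- L] lev.
  split=> [|t]; last first.
    by rewrite levE; split=> [/mapP[x xL ->]|[x xL <-]]; [exists x | apply: map_f].
  rewrite map_inj_in_uniq // => x y /hL[_ ex _] /hL[_ ey _] /X_eq[//|e].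
  by case: n0; rewrite -{1}ex e itN ey.
rewrite (set_card_enumerates eL) (set_card_enumerates fixE) !size_map; split; first by rewrite -sL addnK.
have -> : [seq x <- L | x == - x] = [::]; last by [].
apply/eqP; rewrite -(negbK (_ == _)) -has_filter; apply/hasPn => x /hL[_ ex _].
by apply/eqP => e; apply: n0; rewrite -{1}ex e itN ex.
Qed.

End Tree.

(** * Growth of the kernel sizes, which determines the depth *)

Lemma ceil_div_gt0 e f : (0 < e)%N -> (0 < f)%N -> (0 < ceil_div e f)%N.
Proof. by move=> e0 f0; rewrite /ceil_div divn_gt0 //; lia. Qed.

Lemma leq_mul_ceil_div e f : (0 < f)%N -> (e <= f * ceil_div e f)%N.
Proof.
move=> f0; have := ltn_ceil (e + f.-1) f0; rewrite /ceil_div mulSn mulnC; lia.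
Qed.

Lemma ceil_div_pred_lt e f : (0 < e)%N -> (0 < f)%N -> (f * (ceil_div e f).-1 < e)%N.
Proof.
move=> e0 f0; have := ceil_div_gt0 e0 f0; have := leq_divM (e + f.-1) f.
by rewrite -/(ceil_div e f); case: (ceil_div e f) => // k; rewrite mulSn /= mulnC; lia.
Qed.

Section KappaGrowth.
Variables (l : nat) (e f N : 'I_l -> nat).
Hypotheses (e0 : forall i, (0 < e i)%N) (N1 : forall i, (1 < N i)%N).
Local Notation K h := (\prod_(i < l) N i ^ (minn (e i) (f i * h)))%N.
Local Notation d := (\max_(i < l | f i != 0%N) ceil_div (e i) (f i)).

Lemma kappa_stationary h : (d <= h)%N -> K h = K h.+1.
Proof.
move=> dh; apply: eq_bigr => i _; congr (_ ^ _)%N.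
have [->|f0] := eqVneq (f i) 0%N; first by rewrite !mul0n.
have f1 : (0 < f i)%N by rewrite lt0n.
have : (e i <= f i * h)%N.
  apply: leq_trans (leq_mul_ceil_div (e i) f1) _; rewrite leq_mul2l; apply/orP; right.
  by apply: leq_trans dh; apply: (@leq_bigmax_cond _ (fun i => f i != 0%N)).
by rewrite mulnS; lia.
Qed.

(** For an index i attaining the maximum, f i (d - 1) < e i, so that the exponent of N i still
    increases in the step to d, while no other exponent decreases. *)
Lemma kappa_growth : (exists i, f i != 0%N) -> (0 < d)%N /\ (K d.-1 < K d)%N.
Proof.
move=> [i0 fi0]; have [|i fi ed] := @eq_bigmax_cond _ (fun i => f i != 0%N) (fun i => ceil_div (e i) (f i)).
  by apply/card_gt0P; exists i0.
have f1 : (0 < f i)%N by rewrite lt0n.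
have ed' : d = ceil_div (e i) (f i) by [].
have d0 : (0 < d)%N by rewrite ed' ceil_div_gt0.
split=> //; rewrite (bigD1 i) //= [ltnRHS](bigD1 i) //=.
have lt := ceil_div_pred_lt (e0 i) f1; rewrite -ed' in lt.
have lt1 : (N i ^ minn (e i) (f i * d.-1) < N i ^ minn (e i) (f i * d))%N.
  by rewrite ltn_exp2l //; move: (d) d0 lt => [|k0] //= _ lt; rewrite mulnS; lia.
have le2 : (\prod_(j < l | j != i) N j ^ minn (e j) (f j * d.-1) <=
            \prod_(j < l | j != i) N j ^ minn (e j) (f j * d))%N.
  apply: leq_prod => j _; rewrite leq_exp2l // leq_min geq_minl /=.
  by rewrite (leq_trans (geq_minr _ _)) // leq_mul2l leq_pred orbT.
have p0 : (0 < \prod_(j < l | j != i) N j ^ minn (e j) (f j * d))%N.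
  by rewrite prodn_cond_gt0 // => j _; rewrite expn_gt0 ltnW.
apply: leq_ltn_trans (_ : N i ^ minn (e i) (f i * d.-1) * \prod_(j < l | j != i) N j ^ minn (e j) (f j * d) < _)%N.
  by rewrite leq_mul2l le2 orbT.
by rewrite ltn_mul2r p0.
Qed.

End KappaGrowth.

(** * The data of the theorem as an instance of the abstract counts *)

Lemma regular_eval (K : closedFieldType) (E : ecurve K) (v : {poly {poly K}}) :
  regular E (fun x y => v.[y%:P].[x]).
Proof.
elim/poly_ind: v => [|v c IH].
  have [a [b h]] := regular_cst E 0; exists a, b => x y exy.
  by rewrite !horner0; exact: h.
have [a [b h]] := regularD (regularM IH (regular_y E)) (regular_poly E c).
exists a, b => x y exy; rewrite hornerD hornerM hornerX hornerC hornerD hornerM hornerC; exact: h.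
Qed.

(* An alias of the group of points that carries the action, from which the
   module structure is inferred. *)
Definition cm_module (K : closedFieldType) (E : ecurve K) (R : comNzRingType)
  (phi : R -> curve_point E -> curve_point E) (act : isogeny_action phi) : Type := curve_point E.

Section CMModule.
Variables (K : closedFieldType) (E : ecurve K) (R : comNzRingType).
Variables (phi : R -> curve_point E -> curve_point E) (act : isogeny_action phi).

HB.instance Definition _ := GRing.Zmodule.on (cm_module act).

Lemma act_addr u P Q : phi u (P + Q) = phi u P + phi u Q.
Proof.
have [->|u0] := eqVneq u 0; first by rewrite !(act0l act) addr0.
exact: isogD (act_isog act u0) P Q.
Qed.

HB.instance Definition _ := GRing.Zmodule_isLmodule.Build R (cm_module act)
  (fun u v P => esym (actM act u v P)) (act1 act) act_addr (fun P u v => actD act u v P).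

End CMModule.

Section FrobeniusSets.
Variables (K : closedFieldType) (E : ecurve K) (q n : nat).
Local Notation pt := (curve_point E).
Hypothesis q0 : (0 < q)%N.
Variable psi : pt -> pt.
Hypothesis frob : forall P, coords (psi P) =
  if coords P is Some (x, y) then Some (x ^+ (q ^ n), y ^+ (q ^ n)) else None.
Hypothesis psiN : forall P, psi (- P) = - psi P.

Lemma eq_oppP (P : pt) : P = - P <-> (forall x y, coords P = Some (x, y) -> y = 0).
Proof.
split=> [e x y eP|h].
  move: (congr1 (@coords K E) e); rewrite eP (coords_opp_aff eP) => -[e'].
  have /eqP : 2%:R * y = 0 by rewrite mulr_natl mulr2n {1}e' addNr.
  by rewrite mulf_eq0 (negPf (ec_two E)) => /eqP.
case eP : (coords P) => [[x y]|]; last by rewrite (coords_None0 eP) oppr0.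
apply: coords_inj; rewrite eP (coords_opp_aff eP).
by rewrite (h x y) // oppr0.
Qed.

Lemma An_points t : An E q n t <-> exists2 P, psi P = P & xc P = t.
Proof.
split=> [|[P eP <-]].
  case: t => [x|_]; last by exists (0 : pt) => //; apply: coords_inj; rewrite frob.
  move=> [ex [y ey]]; rewrite on_affineE => /eqP /point_of[P eP].
  exists P; last exact: xc_coords eP.
  by apply: coords_inj; rewrite frob eP ex ey.
rewrite /xc; have := frob P; rewrite eP.
case cP : (coords P) => [[x y]|] //= [ex ey]; split; first exact/esym.
by exists y; [exact/esym | rewrite on_affineE (coordsP cP)].
Qed.

Lemma E0_points t : E0 E q n t <-> exists P, [/\ psi P = P, P = - P & xc P = t].
Proof.
split=> [|[P [eP /eq_oppP hP <-]]].
  case: t => [x|_]; last first.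
    by exists (0 : pt); split; rewrite ?oppr0 //; apply: coords_inj; rewrite frob.
  move=> [ex]; rewrite on_affineE => /eqP /point_of[P eP].
  exists P; split; last exact: xc_coords eP.
    by apply: coords_inj; rewrite frob eP ex expr0n eqn0Ngt expn_gt0 q0.
  by apply/eq_oppP => x' y'; rewrite eP => -[].
rewrite /xc; have := frob P; rewrite eP.
case cP : (coords P) => [[x y]|] //= [ex ey]; split; first exact/esym.
by rewrite on_affineE -(coordsP cP) (hP _ _ cP).
Qed.

(** For x fixed by the Frobenius power, y^(q^n) is y or -y. If y is nonzero, the sign -1 says that y
    lies in the field with q^(2 n) elements but not in the one with q^n elements; y = 0 gives the
    points of [E0]. *)
Lemma Bn_points t : Bn E q n t <-> exists2 P, psi P = - P & xc P = t.
Proof.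
have ps0 : psi 0 = 0 by apply: coords_inj; rewrite frob.
split.
  case=> [|/E0_points[P [e1 e2 e3]]]; last by exists P; rewrite ?e1.
  case: t => [x|//] [ex [y [ey nsub]]]; rewrite on_affineE => /eqP exy.
  have [P eP] := point_of exy; exists P; last exact: xc_coords eP.
  have eF : coords (psi P) = Some (x, y ^+ (q ^ n)) by rewrite frob eP ex.
  have [e|e] := eq_sqr_or exy (coordsP eF); first by case: nsub.
  by apply: coords_inj; rewrite eF (coords_opp_aff eP) e.
move=> [P eP <-]; rewrite /xc; have eF := frob P.
case cP : (coords P) => [[x y]|]; last by right.
rewrite eP (coords_opp_aff cP) cP in eF; case: eF => ex ey.
have [y0|y0] := eqVneq y 0.
  right; split; first exact/esym.
  by rewrite on_affineE -(coordsP cP) y0.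
left; split; first exact/esym.
exists y; last by rewrite on_affineE (coordsP cP).
split; last first.
  move=> /esym sy; rewrite -ey in sy.
  move: y0; have /eqP : 2%:R * y = 0 by rewrite mulr_natl mulr2n {1}sy addNr.
  by rewrite mulf_eq0 (negPf (ec_two E)) /= => ->.
have := frob (- P); rewrite psiN eP opprK cP (coords_opp_aff cP) => -[_ eN].
by rewrite /subfield /= mul2n -addnn expnD exprM -ey -eN.
Qed.

End FrobeniusSets.

Lemma frobenius_iterate (K : closedFieldType) (W : weierstrass K) (R : comNzRingType)
    (phi : R -> curve_point W -> curve_point W) (q n : nat) (u : R) :
  (forall v w P, phi (v * w) P = phi v (phi w P)) -> (forall P, phi 1 P = P) ->
  is_frobenius q (phi u) ->
  forall P, coords (phi (u ^+ n) P) =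
    if coords P is Some (x, y) then Some (x ^+ (q ^ n), y ^+ (q ^ n)) else None.
Proof.
move=> phiM phi1 fr; elim: n => [|n IH] P.
  by rewrite expr0 phi1; case: (coords P) => [[x y]|] //; rewrite expn0 !expr1.
rewrite exprS phiM fr IH; case: (coords P) => [[x y]|] //.
by rewrite -!exprM -expnSr.
Qed.

Lemma discriminant_map (F K : fieldType) (iota : {rmorphism F -> K}) (W : weierstrass F) :
  discriminant (map_weierstrass iota W) = iota (discriminant W).
Proof.
by rewrite /discriminant /=; ring.

Qed.

(** An equation y^2 = f(x) is singular in characteristic 2, so an elliptic curve without linear
    terms lives in odd characteristic. *)
Lemma discriminant_char2 (K : fieldType) (W : weierstrass K) :
  a1 W = 0 -> a3 W = 0 -> 2%:R = 0 :> K -> discriminant W = 0.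
Proof.
move=> e1 e3 two; rewrite /discriminant e1 e3.
have -> : 4%:R = 0 :> K by rewrite (natrM _ 2 2) two mul0r.
have -> : 8%:R = 0 :> K by rewrite (natrM _ 2 4) two mul0r.
by rewrite two; ring.
Qed.

Lemma leq_of_sum (x y X Y s : nat) : (x <= X)%N -> (y <= Y)%N -> (x + y = s)%N ->
  (Y + X = s)%N -> (X <= x)%N /\ (Y <= y)%N.
Proof. by lia. Qed.

Theorem theorem3p6
  (F : finFieldType) (q : nat) (hq : #|F| = q)
  (K : closedFieldType) (iota : {rmorphism F -> K}) (hK : integralRange iota)
  (W : weierstrass F) (EK := map_weierstrass iota W)
  (hW : is_elliptic W) (hord : ordinary EK)
  (R : comNzRingType) (phi : R -> curve_point EK -> curve_point EK)
  (hR : endomorphism_ring phi) (hRmax : imaginary_quadratic_integers R)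
  (pi_q : R) (hpi : is_frobenius q (phi pi_q))
  (alpha : R) (a b c w : {poly F})
  (hb : b != 0) (hab : coprimep a b) (hw : w != 0)
  (halpha : has_form a b c w (phi alpha))
  (n : nat) (hn : (1 <= n)%N)
  (r := x_map iota a b)
  (S : set (option K)) (delta : R)
  (hS : (S = An EK q n /\ delta = pi_q ^+ n - 1) \/
        (S = Bn EK q n /\ delta = pi_q ^+ n + 1))
  (Ic It : set R) (hdelta : principal delta = ideal_mul Ic It)
  (k : nat) (C : 'I_k -> set R) (g : 'I_k -> nat)
  (hIc : prime_factorization Ic C g) (hC : forall i, ~ C i alpha)
  (l : nat) (B : 'I_l -> set R) (e : 'I_l -> nat)
  (hIt : prime_factorization It B e) (hB : forall i, B i alpha)
  (f : 'I_l -> nat) (J : set R)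
  (hf : principal alpha = ideal_mul (ideal_prod B f) J)
  (hJ : exists (m : nat) (Q : 'I_m -> set R) (u : 'I_m -> nat),
      prime_factorization J Q u /\ forall i j, B i <> Q j)
  (hne : exists i, f i != 0%N)
  (d := \max_(i < l | f i != 0%N) ceil_div (e i) (f i))
  (xt : option K) (hxt : S xt) (hper : periodic r xt)
  (T := level (P1 q n) r xt S) :
  has_depth (P1 q n) r xt S d /\
  forall h : nat, (1 <= h <= d)%N ->
    let v := vertex_count B e f h in
    let vt := set_card (T h `&` E0 EK q n) in
    (E0 EK q n xt -> (set_card (T h))%:R = (v + vt%:R) / 2 :> rat) /\
    (~ E0 EK q n xt -> (set_card (T h))%:R = v - vt%:R :> rat).
Proof.
have [sigma [tr [nm [z [m qo]]]]] := quadratic_order_of_integers hRmax.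
have dom := qo_dom qo.
have two0 : 2%:R != 0 :> R by rewrite pmulrn; apply: (qo_int_neq0 qo).
have phiA u P Q : phi u (Defs.add P Q) = Defs.add (phi u P) (phi u Q) := (end_in hR u).1 P Q.
have phiD := end_add hR; have phiM := end_mul hR; have phi1 := end_one hR.
have phi00 := phi0 phiD.
have nz u : u != 0 -> exists n1 d1 n2 d2 : {poly {poly F}}, exists s : seq (curve_point EK),
     forall (P : curve_point EK) (x y : K), coords P = Some (x, y) -> P \notin s ->
       [/\ eval2 iota d1 x y != 0, eval2 iota d2 x y != 0 &
         coords (phi u P) = Some (eval2 iota n1 x y / eval2 iota d1 x y,
                              eval2 iota n2 x y / eval2 iota d2 x y)].
  move=> u0; case: (end_in hR u) => _ [h|//]; exfalso; move/eqP: u0; apply.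
  by apply: (end_inj hR) => P; rewrite h phi00.
have fin u : u != 0 -> ae (fun P => phi u P <> infinity EK).
  move=> /nz[n1 [d1 [n2 [d2 [s hs]]]]]; exists (infinity EK :: s) => P.
  rewrite inE negb_or => /andP[/eqP nP Ps].
  case eP : (coords P) => [[x y]|]; last by case: nP; apply: val_inj.
  by have [_ _] := hs _ _ _ eP Ps; move=> + e0; rewrite e0.
pose aK := map_poly iota a; pose bK := map_poly iota b.
pose cK := map_poly iota c; pose wK := map_poly iota w.
have bK0 : bK != 0 by rewrite map_poly_eq0.
have wK0 : wK != 0 by rewrite map_poly_eq0.
have cab : coprimep aK bK by rewrite coprimep_map.
have form (P : curve_point EK) (x y : K) : coords P = Some (x, y) -> bK.[x] != 0 -> wK.[x] != 0 ->
  coords (phi alpha P) = Some (aK.[x] / bK.[x], y * (cK.[x] / wK.[x])) by apply: halpha.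
have alpha0 : alpha != 0.
  apply/eqP => e0; have [P [x [y [eP]]]] := ae_ex (ae_affine_poly EK (mulf_neq0 bK0 wK0)).
  rewrite hornerM mulf_eq0 negb_or => /andP[bx wx].
  by have := form _ _ _ eP bx wx; rewrite e0 phi00.
(* The index given by [hne] provides a proper ideal B i containing alpha. *)
have nunit v : v * alpha <> 1.
  move=> e1; have [i _] := hne; have [hp _ _ _] := hIt; have [[iB B1 _] _] := hp i.
  by apply: B1; rewrite -e1; apply: is_idealM.
have [e1 e3] := linear_terms_eq0 phiA phiD phiM phi1 fin dom two0 bK0 wK0 alpha0 nunit form.
have ellK : is_elliptic EK by rewrite /is_elliptic discriminant_map fmorph_eq0.
have twoK : 2%:R != 0 :> K.
  by apply: contra ellK => /eqP two; apply/eqP; apply: discriminant_char2.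
pose E := ECurve e1 e3 twoK ellK.
pose ph : R -> curve_point E -> curve_point E := phi.
have act : isogeny_action ph.
  split=> // u u0; split; first exact: phiA.
    by have [s hs] := fin u u0; exists s.
  have [n1 [d1 [n2 [d2 [s hs]]]]] := nz u u0.
  exists (eval2 iota n1), (eval2 iota d1); split; [exact: regular_eval | exact: regular_eval |].
  exists s => P Ps x y eP; have [h1 _ h2] := hs P x y eP Ps; split=> //.
  exact: (@xc_coords K E (ph u P) _ _ h2).
have [D [D0 Dx]] := degree_exists act.
have D1 := degree1 act Dx; have DN := degreeN act Dx.
have DM := degreeM act D0 Dx; have Dp := degree_parallelogram act D0 Dx.
have kb u := degree_ker_bound act Dx (u := u).
set Q := (q ^ n)%N.
have q1 : (1 < q)%N by rewrite -hq; apply: finNzRing_gt1.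
have Q1 : (1 < Q)%N by rewrite /Q -(exp1n n) ltn_exp2r.
have Q0 : Q%:R = 0 :> K.
  rewrite /Q natrX -hq -(rmorph_nat iota) card_finField_eq0 rmorph0.
  by rewrite expr0n eqn0Ngt hn.
pose psi := ph (pi_q ^+ n).
have frob : forall P, coords (psi P) =
    if coords P is Some (x, y) then Some (x ^+ Q, y ^+ Q) else None.
  exact: (frobenius_iterate n phiM phi1 hpi).
have pn0 : pi_q ^+ n != 0.
  apply/eqP => e0; have [P [x [y eP]]] := ae_ex (ae_affine E).
  by have := frob P; rewrite /psi e0 eP (act0l act).
have psiN P : psi (- P) = - psi P by apply: (isogN (act_isog act pn0)).
have DQ : D (pi_q ^+ n) = Q.
  apply: (degree_frob Dx pn0) => P; rewrite /xc -/psi.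
  by have := frob P; rewrite /psi => ->; case: (coords P) => [[x y]|].
have [sA [sB [[uA uB] fixA fixB sAB]]] := frobenius_count Q1 Q0 frob psiN.
have xQ0 : ae (fun P : curve_point E => xc (psi P) <> xc P).
  have p0 : 'X^Q - 'X != 0 :> {poly K}.
    by rewrite -size_poly_gt0 size_polyDl ?size_polyXn // size_polyN size_polyX.
  apply: ae_imp2 (ae_affine E) (ae_poly E p0) => P [x [y eP]] /(_ _ (xc_coords eP)).
  rewrite hornerD hornerN hornerXn hornerX subr_eq0 /xc frob eP /=.
  by move=> /eqP n0 [].
have dm0 : pi_q ^+ n - 1 != 0.
  rewrite subr_eq0; apply/eqP => e0; have [P] := ae_ex xQ0.
  by rewrite /psi e0 [ph 1 P]phi1.
have dp0 : pi_q ^+ n + 1 != 0.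
  rewrite addr_eq0; apply/eqP => e0; have [P] := ae_ex xQ0.
  by rewrite /psi e0 (actNl act) xc_oppr [ph 1 P]phi1.
have kerm (P : curve_point E) : ph (pi_q ^+ n - 1) P = 0 <-> psi P = P.
  rewrite (actBl act) (act1 act) -[ph (pi_q ^+ n) P]/(psi P); split=> [/eqP|->]; last by rewrite subrr.
  by rewrite subr_eq0 => /eqP.
have kerp (P : curve_point E) : ph (pi_q ^+ n + 1) P = 0 <-> psi P = - P.
  rewrite (actD act) (act1 act) -[ph (pi_q ^+ n) P]/(psi P); split=> [/eqP|->]; last by rewrite addNr.
  by rewrite addr_eq0 => /eqP.
have bA : (size sA <= D (pi_q ^+ n - 1)%R)%N by apply: (kb _ _ dm0 uA) => P /fixA /kerm.
have bB : (size sB <= D (pi_q ^+ n + 1)%R)%N by apply: (kb _ _ dp0 uB) => P /fixB /kerp.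
(* The parallelogram law for pi_q^n and 1, of degrees Q and 1. The total agrees with [sAB], so both
   kernel bounds are attained. *)
have sumD : (D (pi_q ^+ n + 1)%R + D (pi_q ^+ n - 1)%R = 2 * Q + 2)%N.
  by rewrite Dp DQ D1.
have [szA szB] := leq_of_sum bA bB sAB sumD.
have E0psi t := E0_points (ltnW q1) frob t.
have [G0 [ks [delta0 uks kks Dks]]] : (forall t, S t <-> exists2 P : curve_point E, ph delta P = 0 & xc P = t) /\
    exists ks : seq (curve_point E), [/\ delta != 0, uniq ks, forall P, P \in ks -> ph delta P = 0 &
      (D delta <= size ks)%N].
  case: hS => [[-> ->]|[-> ->]]; split.
  - by move=> t; rewrite (An_points frob); split=> [][P /kerm eP <-]; exists P.
  - by exists sA; split=> // P /fixA /kerm.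
  - by move=> t; rewrite (Bn_points (ltnW q1) frob psiN); split=> [][P /kerp eP <-]; exists P.
  - by exists sB; split=> // P /fixB /kerp.
(* On points with P = -P the conditions psi P = P and psi P = -P coincide, so [E0] is described in
   the same way in both cases for delta. *)
have E0P t : E0 EK q n t <-> exists P : curve_point E, [/\ ph delta P = 0, P = - P & xc P = t].
  rewrite -[E0 EK q n t]/(E0 E q n t) E0psi.
  case: hS => [[_ ->]|[_ ->]]; split=> [][P [h1 h2 h3]]; exists P; split=> //.
  - exact/kerm.
  - exact/kerm.
  - by apply/kerp; rewrite h1.
  - by rewrite {2}h2; apply/kerp.
have SP1 : S `<=` P1 q n.
  move=> [x|] //; case: hS => [[-> _]|[-> _]]; first by case.
  by case=> [][].
have rX (P : curve_point E) : r (xc P) = xc (ph alpha P).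
  by rewrite (isog_xc_exact (act_isog act alpha0) cab bK0 wK0 form).
have divM (u : R) (y : cm_module act) : u != 0 -> exists x, u *: x = y.
  by move=> u0; apply: isog_surj (act_isog act u0) y.
have [N N1 kapP] := kappa_spec qo D0 D1 DN DM Dp (M := cm_module act) divM kb hdelta hIc hC hIt hB hf hJ
  delta0 uks kks Dks.
have [ker kerP] : exists ker : nat -> seq (curve_point E), forall h,
    enumerates (ker h) (fun P => ph delta P = 0 /\ iter h (ph alpha) P = 0) /\
    size (ker h) = kappa B e f h.
  have itE h (P : curve_point E) : ph (alpha ^+ h) P = iter h (ph alpha) P.
    by elim: h => [|h IH]; rewrite ?expr0 ?(act1 act) // exprS (actM act) IH.
  suff kx h : exists t : seq (curve_point E), enumerates t (fun P => ph delta P = 0 /\ iter h (ph alpha) P = 0) /\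
    size t = kappa B e f h by have [ker] := choice kx; exists ker.
  have [_ [t [ut ht] st]] := kapP h; exists t; split=> //; split=> // P.
  by rewrite ht /= -itE.
have [x0 Gx0 ex0] := (G0 xt).1 hxt.
have phD u P P' : ph u (P + P') = ph u P + ph u P' by apply: act_addr act u P P'.
have GD (P P' : curve_point E) : ph delta P = 0 -> ph delta P' = 0 -> ph delta (P + P') = 0.
  by move=> h1 h2; rewrite phD h1 h2 addr0.
have GN (P : curve_point E) : ph delta P = 0 -> ph delta (- P) = 0.
  by move=> h1; rewrite (isogN (act_isog act delta0)) h1 oppr0.
have Gal (P : curve_point E) : ph delta P = 0 -> ph delta (ph alpha P) = 0.
  by move=> h1; rewrite -(actM act) mulrC (actM act) h1 (isog0 (act_isog act alpha0)).
have Xeq (P P' : curve_point E) : xc P = xc P' <-> P = P' \/ P = - P'.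
  by split=> [/xc_eq //|[->//|->]]; rewrite xc_oppr.
have per0 : periodic (ph alpha) x0.
  by apply/(periodicX (phD alpha) Xeq rX); rewrite ex0.
have LC h := level_count (phD alpha) Xeq rX GD GN Gal G0 E0P SP1
  (fun h => (kerP h).1) (fun h => (kerP h).2) Gx0 per0 h.
rewrite ex0 in LC.
have kapE h : kappa B e f h = (\prod_(i < l) N i ^ (minn (e i) (f i * h)))%N by have [] := kapP h.
have e0 i : (0 < e i)%N by have [] := hIt.
have [d0 kd] := kappa_growth e0 N1 hne; rewrite -/d in d0 kd.
split.
  split.
    move: d0 kd; rewrite -!kapE; case: (d) => // d' _ kd.
    by have [_ ne _ _] := LC d'; apply/ne.
  (* A vertex at level h + 1 requires the kernel to grow from h to h + 1, which does not happen once
     h is at least d. *)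
  case=> [|h] // lh; rewrite ltnNge; apply/negP => dh.
  have [_ [ne _] _ _] := LC h; have := ne lh.
  by rewrite !kapE (kappa_stationary N dh) ltnn.
case=> // h /andP[_ hd] v vt.
have [le ne cE0 cn0] := LC h.
have vE : v = (kappa B e f h.+1 - kappa B e f h)%:R.
  by rewrite natrB // /v /vertex_count /kappa !natr_prod.
split=> [/cE0 h1|/cn0[h1 h2]]; last first.
  by rewrite /vt /T h2 subr0 h1 vE.
have two : 2%:R != 0 :> rat by [].
apply: (mulfI two); rewrite mulrC [RHS]mulrC divfK //.
by rewrite vE /vt -natrD -h1 natrM mulrC.
Qed.
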